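(* Let $n\ge2$ and let $\mathbb{T}^n_\theta$ be a noncommutative $n$-torus. The following hold. (1) If $\rho(\xi)\in\mathbb{S}^{-m}(\mathbb{T}^n_\theta\times\mathbb{R}^n)$ with $m>n$, and $x\in L_2(\mathbb{T}^n_\theta)$, then (the operator $\lambda(x)P_\rho$ being trace-class) $$\operatorname{Tr}\big[\lambda(x)P_\rho\big]=\sum_{k\in\mathbb{Z}^n}\tau\big[x\rho(k)\big].$$ (2) If $x\in L_1(\mathbb{T}^n_\theta)$ and $\rho(\xi),\sigma(\xi)\in\mathbb{S}^{-m}(\mathbb{T}^n_\theta\times\mathbb{R}^n)$ with $m>n/2$, then (the operator $P_\sigma^*\lambda(x)P_\rho$ being trace-class) $$\operatorname{Tr}\big[P_\sigma^*\lambda(x)P_\rho\big]=\sum_{k\in\mathbb{Z}^n}\tau\big[x\rho(k)\sigma(k)^*\big].$$ In particular, $$\operatorname{Tr}\big[P_\rho^*\lambda(x)P_\rho\big]=\sum_{k\in\mathbb{Z}^n}\tau\big[x\,\rho(k)\rho(k)^*\big].$$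
   Context: Noncommutative torus. Let $n\ge2$ and let $\theta=(\theta_{jk})$ be a real antisymmetric $n\times n$ matrix with columns $\theta_1,\dots,\theta_n$. On $L_2(\mathbb{T}^n)$, $\mathbb{T}^n=\mathbb{R}^n/(2\pi\mathbb{Z})^n$, with inner product $(2\pi)^{-n}\int \xi\bar\eta\,dx$, let $(U_j\xi)(x)=e^{ix_j}\xi(x+\pi\theta_j)$; these unitaries satisfy $U_kU_j=e^{2i\pi\theta_{jk}}U_jU_k$. $C(\mathbb{T}^n_\theta)$ and $L_\infty(\mathbb{T}^n_\theta)$ are the $C^*$-algebra and von Neumann algebra generated by $U_1,\dots,U_n$. Set $U^k=U_1^{k_1}\cdots U_n^{k_n}$, $k\in\mathbb{Z}^n$. $\tau(T)=\langle T1|1\rangle$ is a faithful normal tracial state on $L_\infty(\mathbb{T}^n_\theta)$ with $\tau(U^k)=0$ for $k\ne0$. $L_p(\mathbb{T}^n_\theta)$, $1\le p<\infty$, is the noncommutative $L_p$-space of $(L_\infty(\mathbb{T}^n_\theta),\tau)$, with norm $\|x\|_{L_p}=\tau(|x|^p)^{1/p}$; $\tau$ extends to $L_1(\mathbb{T}^n_\theta)$. $L_2(\mathbb{T}^n_\theta)$ has inner product $\langle u|v\rangle=\tau(uv^* )$ and orthonormal basis $(U^k)_{k\in\mathbb{Z}^n}$. $C^\infty(\mathbb{T}^n_\theta)$ is the Fréchet $*$-algebra of series $\sum u_kU^k$ with rapidly decaying coefficients; $\partial_j$ is the derivation with $\partial_jU^k=ik_jU^k$, and $\delta_j=\frac1i\partial_j$.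 $\lambda(x)$ denotes left multiplication by $x$. With $\Lambda U^k=(1+|k|^2)^{1/2}U^k$, $W_2^s(\mathbb{T}^n_\theta)=\{u\in L_2(\mathbb{T}^n_\theta):\Lambda^su\in L_2(\mathbb{T}^n_\theta)\}$, $s\ge0$; for $s>n/2$ it embeds continuously in $C(\mathbb{T}^n_\theta)$. Pseudodifferential operators. $\mathbb{S}^m(\mathbb{T}^n_\theta\times\mathbb{R}^n)$, $m\in\mathbb{R}$, consists of $C^\infty$ maps $\rho:\mathbb{R}^n\to C^\infty(\mathbb{T}^n_\theta)$ such that $\|\delta^\alpha\partial_\xi^\beta\rho(\xi)\|\le C_{\alpha\beta}(1+|\xi|)^{m-|\beta|}$ for all multi-orders $\alpha,\beta$ and all $\xi$. For such $\rho$, $P_\rho u=\sum_k u_k\rho(k)U^k$ for $u=\sum u_kU^k\in C^\infty(\mathbb{T}^n_\theta)$. If $\rho\in\mathbb{S}^{-m}$ with $m\ge0$, $P_\rho$ extends to a bounded operator $L_2(\mathbb{T}^n_\theta)\to W_2^{m}(\mathbb{T}^n_\theta)$. Meaning of the products. In (1), $P_\rho$ maps $L_2(\mathbb{T}^n_\theta)$ to $C(\mathbb{T}^n_\theta)$ and $\lambda(x)$, $x\in L_2$, maps $C(\mathbb{T}^n_\theta)$ to $L_2(\mathbb{T}^n_\theta)$. In (2), $P_\sigma^*\lambda(x)P_\rho$ is the bounded operator on $L_2(\mathbb{T}^n_\theta)$ determined by $\langle P_\sigma^*\lambda(x)P_\rho u|v\rangle=\tau[(P_\sigma v)^*x(P_\rho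 u)]$, $u,v\in L_2(\mathbb{T}^n_\theta)$ (here $P_\rho u,P_\sigma v\in C(\mathbb{T}^n_\theta)$). $\operatorname{Tr}$ is the operator trace on $L_2(\mathbb{T}^n_\theta)$. *)

(* Defs.v *)
From HB Require Import structures.
From mathcomp Require Import all_boot all_order all_algebra finmap.
From mathcomp Require Import complex.
From mathcomp Require Import all_classical all_reals all_analysis.

Set Implicit Arguments.
Unset Strict Implicit.
Unset Printing Implicit Defensive.

Import Order.TTheory GRing.Theory Num.Theory.
Import numFieldNormedType.Exports.

Local Open Scope classical_set_scope.
Local Open Scope complex_scope.
Local Open Scope ring_scope.

Section complex_analysis.
Context {R : realType}.

Definition cabs (z : R[i]) : \bar R := (Normc.normc z)%:E.

Definition expi (t : R) : R[i] := cos t +i* sin t.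

Definition climn (z : nat -> R[i]) : R[i] :=
  limn (fun i => complex.Re (z i)) +i* limn (fun i => complex.Im (z i)).

(* Unconditional convergence of the family f to s for the norm N, i.e. along
   the directed set of finite subsets of I. *)
Definition sums_to (I : choiceType) (V : zmodType) (N : V -> \bar R)
    (f : I -> V) (s : V) : Prop :=
  forall e : R, 0 < e ->
  exists A : {fset I}, forall B : {fset I}, fsubset A B ->
    (N ((\sum_(i <- B) f i)%R - s)%R < e%:E)%E.

End complex_analysis.

(* A Hilbert space is presented by a subspace hdom of a vector space, with a
   positive semi-definite inner product; vectors at distance 0 represent the
   same element (as in L_2-spaces, or in a completion by Cauchy sequences).
   An operator on it is presented by a map defined on the whole ambient vector
   space, of which only the values on hdom, up to heq, are relevant.  Below,
   [xget 0 A] picks an element of A when A is characterized by a property that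
   determines its elements up to this identification (and 0 if A is empty). *)
Record hilbert (R : realType) := Hilbert {
  hvec :> lmodType R[i];
  hdom : set hvec;
  hip : hvec -> hvec -> R[i] }.

Section operators.
Context {R : realType} {H : hilbert R}.
Implicit Types (S T : H -> H) (u v : H).

Definition hnorm u : R := Num.sqrt (complex.Re (hip u u)).

Definition heq u v : Prop := hnorm (u - v) = 0.

Definition op_eq S T : Prop := forall u, hdom u -> heq (S u) (T u).

Definition bounded_op T : Prop :=
  [/\ forall u, hdom u -> hdom (T u),
      forall (a : R[i]) u v, hdom u -> hdom v ->
        heq (T (a *: u + v)) (a *: T u + T v)
    & exists c : R, forall u, hdom u -> hnorm (T u) <= c * hnorm u].

Definition opnorm T : \bar R :=
  ereal_sup [set (hnorm (T u))%:E | u in [set u | hdom u /\ hnorm u <= 1]].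

Definition adj T : H -> H :=
  xget 0 [set S | bounded_op S /\
    forall u v, hdom u -> hdom v -> hip (T u) v = hip u (S v)].

Definition positive_op T : Prop := forall u, hdom u -> 0 <= hip (T u) u.

Definition abs_op T : H -> H :=
  xget 0 [set A | [/\ bounded_op A, positive_op A
                    & op_eq (A \o A) (adj T \o T)]].

Definition orthonormal_basis (I : choiceType) (e : I -> H) : Prop :=
  [/\ forall i, hdom (e i),
      forall i j, hip (e i) (e j) = (i == j)%:R
    & forall u, hdom u -> (forall i, hip u (e i) = 0) -> hnorm u = 0].

Definition trace_class T : Prop :=
  bounded_op T /\
  exists (I : choiceType) (e : I -> H), orthonormal_basis e /\
    (\esum_(i in [set: I]) (complex.Re (hip (abs_op T (e i)) (e i)))%:E
       < +oo)%E.

Definition trace T : R[i] :=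
  xget 0 [set t | forall (I : choiceType) (e : I -> H), orthonormal_basis e ->
    sums_to cabs (fun i => hip (T (e i)) (e i)) t].

Definition star_algebra (A : set (H -> H)) : Prop :=
  [/\ A `<=` bounded_op,
      forall S T, A S -> bounded_op T -> op_eq S T -> A T,
      forall (a : R[i]) S T, A S -> A T -> A (a *: S + T),
      forall S T, A S -> A T -> A (S \o T)
    & forall S, A S -> A (adj S)].

Definition cstar_algebra (A : set (H -> H)) : Prop :=
  star_algebra A /\
  forall T, bounded_op T ->
    (forall e : R, 0 < e -> exists2 S, A S & (opnorm (T - S)%R < e%:E)%E) ->
    A T.

Definition commutant (A : set (H -> H)) : set (H -> H) :=
  [set T | bounded_op T /\ forall S, A S -> op_eq (S \o T) (T \o S)].

Definition vonNeumann_algebra (A : set (H -> H)) : Prop :=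
  star_algebra A /\ commutant (commutant A) = A.

End operators.

Section torus_measure.
Context {R : realType}.

Lemma two_pi_gt0 : (0 : R) < 2 * pi.
Proof. by rewrite mulr_gt0// pi_gt0. Qed.

Definition consT n (p : measurableTypeR R * n.-tuple (measurableTypeR R)) :
  n.+1.-tuple (measurableTypeR R) := [the n.+1.-tuple _ of p.1 :: p.2].

Lemma measurable_consT n : measurable_fun setT (@consT n).
Proof. exact: measurable_cons. Qed.

HB.instance Definition _ n :=
  isMeasurableFun.Build _ _ _ _ (@consT n) (@measurable_consT n).

(* (2 pi)^-n dx on [0, 2 pi]^n *)
Fixpoint torus_measure n : probability (n.-tuple (measurableTypeR R)) R :=
  match n with
  | 0 => \d_ [tuple]
  | n'.+1 => distribution (uniform_prob two_pi_gt0 \x torus_measure n')%E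
               [the {mfun _ >-> _} of @consT n']
  end.

End torus_measure.

Section noncommutative_torus.
Context {R : realType} (n : nat) (theta : 'M[R]_n).

Definition point := n.-tuple (measurableTypeR R).
Definition func := point -> R[i]^o.
Definition oper := func -> func.

Definition translate (x : point) (a : 'I_n -> R) : point :=
  [tuple (tnth x i + a i : measurableTypeR R) | i < n].

Definition cmeasurable (f : func) : Prop :=
  measurable_fun setT (fun x => complex.Re (f x)) /\
  measurable_fun setT (fun x => complex.Im (f x)).

Definition cintegral (f : func) : R[i] :=
  (\int[torus_measure n]_x complex.Re (f x)) +i*
  (\int[torus_measure n]_x complex.Im (f x)).

(* Functions on R^n / (2 pi Z)^n are functions on R^n that are 2 pi-periodic in
   each coordinate. *)
Definition periodic (f : func) : Prop :=
  forall (j : 'I_n) (x : point),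
    f (translate x (fun i => 2 * pi * (i == j)%:R)) = f x.

Definition L2_Tn : hilbert R :=
  @Hilbert R func
    [set f | [/\ cmeasurable f, periodic f &
       (\int[torus_measure n]_x ((Normc.normc (f x)) ^+ 2)%:E < +oo)%E]]
    (fun f g => cintegral (fun x => f x * (g x)^*)).

Definition U (j : 'I_n) : oper := fun xi x =>
  expi (tnth x j) * xi (translate x (fun i => pi * theta i j)).

Definition one : func := fun=> 1.

Definition tau (T : oper) : R[i] := @hip R L2_Tn (T one) one.

Definition C_Tn : set oper := smallest (@cstar_algebra R L2_Tn) (range U).

Definition Linfty_Tn : set oper :=
  smallest (@vonNeumann_algebra R L2_Tn) (range U).

Definition star (T : oper) : oper := @adj R L2_Tn T.

Definition modulus (T : oper) : oper := @abs_op R L2_Tn T.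

Definition norm_op (T : oper) : \bar R := @opnorm R L2_Tn T.

Definition norm_Lp (p : nat) (T : oper) : R :=
  (complex.Re (tau (iter p (fun S => modulus T \o S) id))) `^ (p%:R^-1).

(* Elements of L_p are presented by Cauchy sequences of elements of L_infty
   for the norm tau(|x|^p)^(1/p): L_p is the completion of L_infty. *)
Definition Lp (p : nat) : set (nat -> oper) :=
  [set x | (forall i, Linfty_Tn (x i)) /\
     forall e : R, 0 < e -> exists N, forall i j, (N <= i)%N -> (N <= j)%N ->
       norm_Lp p (x i - x j) < e].

Definition in_Lp (a : oper) : nat -> oper := fun=> a.

Definition tau1 (x : nat -> oper) : R[i] := climn (fun i => tau (x i)).

Definition L2_theta : hilbert R :=
  @Hilbert R (nat -> oper) (Lp 2) (fun x y => tau1 (fun i => x i \o star (y i))).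

Definition Zn := {ffun 'I_n -> int}.

(* U_j is unitary, so its negative powers are those of its adjoint. *)
Definition U_pow (j : 'I_n) (z : int) : oper :=
  match z with
  | Posz m => iter m (fun S => U j \o S) id
  | Negz m => iter m.+1 (fun S => star (U j) \o S) id
  end.

Definition U_mono (k : Zn) : oper :=
  \big[(fun S T : oper => S \o T)/id]_(j < n) U_pow j (k j).

Definition vecZ (k : Zn) : 'rV[R]_n := \row_j (k j)%:~R.

Definition enorm (xi : 'rV[R]_n) : R := Num.sqrt (\sum_j xi ord0 j ^+ 2).

Definition op_sum (f : Zn -> oper) : oper :=
  xget 0 [set T | @bounded_op R L2_Tn T /\ sums_to norm_op f T].

(* Elements of C^infty are presented by their coefficients (u_k), which are
   rapidly decaying; series u is the operator sum_k u_k U^k. *)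
Definition coefs := Zn -> R[i]^o.

Definition rapid (u : coefs) : Prop :=
  forall N : nat, exists c : R, forall k,
    (1 + enorm (vecZ k)) ^+ N * Normc.normc (u k) <= c.

Definition series (u : coefs) : oper := op_sum (fun k => u k *: U_mono k).

Definition multi := {ffun 'I_n -> nat}.

Definition mlen (b : multi) : nat := (\sum_j b j)%N.

Definition msucc (b : multi) (j : 'I_n) : multi :=
  [ffun i => (b i + (i == j))%N].

(* delta^a U^k = k^a U^k *)
Definition delta (a : multi) (u : coefs) : coefs :=
  fun k => (\prod_j ((k j)%:~R : R[i]) ^+ a j) * u k.

(* The topology of C^infty is defined by the seminorms u |-> ||delta^a u||. *)
Definition seminorm (a : multi) (u : coefs) : \bar R :=
  norm_op (series (delta a u)).

Definition cinf_continuous (f : 'rV[R]_n -> coefs) : Prop :=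
  forall (a : multi) xi (e : R), 0 < e ->
  exists2 d : R, 0 < d & forall eta, enorm (eta - xi) < d ->
    (seminorm a (f eta - f xi)%R < e%:E)%E.

Definition cinf_partial (j : 'I_n) (f g : 'rV[R]_n -> coefs) : Prop :=
  forall (a : multi) xi (e : R), 0 < e ->
  exists2 d : R, 0 < d & forall t : R, t != 0 -> `|t| < d ->
    (seminorm a
       ((t^-1)%:C *: (f (xi + t *: delta_mx ord0 j) - f xi) - g xi)%R
     < e%:E)%E.

(* D b is the partial derivative of multi-order b of the smooth map rho. *)
Definition symbol (m : R) (rho : 'rV[R]_n -> coefs) : Prop :=
  exists D : multi -> 'rV[R]_n -> coefs,
  [/\ D [ffun=> 0%N] = rho,
      forall b xi, rapid (D b xi),
      forall b, cinf_continuous (D b),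
      forall b j, cinf_partial j (D b) (D (msucc b j))
    & forall a b, exists c : R, forall xi,
        (seminorm a (D b xi)
         <= (c * (1 + enorm xi) `^ (m - (mlen b)%:R))%:E)%E].

Definition rho_at (rho : 'rV[R]_n -> coefs) (k : Zn) : oper :=
  series (rho (vecZ k)).

Definition Psdo_cinf (rho : 'rV[R]_n -> coefs) (u : coefs) : oper :=
  op_sum (fun k => u k *: (rho_at rho k \o U_mono k)).

(* The extension of P_rho from C^infty to L_2 by continuity. *)
Definition Psdo (rho : 'rV[R]_n -> coefs) : L2_theta -> L2_theta :=
  xget 0 [set P | @bounded_op R L2_theta P /\
    forall u, rapid u ->
      @heq R L2_theta (P (in_Lp (series u))) (in_Lp (Psdo_cinf rho u))].

(* P_rho as a map from L_2 to the subspace C(T^n_theta) of L_2. *)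
Definition Psdo_C (rho : 'rV[R]_n -> coefs) (u : L2_theta) : oper :=
  xget 0 [set a | C_Tn a /\ @heq R L2_theta (in_Lp a) (Psdo rho u)].

Definition lambda_Psdo (x : nat -> oper) (rho : 'rV[R]_n -> coefs) :
  L2_theta -> L2_theta := fun u i => x i \o Psdo_C rho u.

(* P_sigma^* lambda(x) P_rho, as determined by its sesquilinear form
   tau[(P_sigma v)^* x (P_rho u)] *)
Definition sandwich (sigma : 'rV[R]_n -> coefs) (x : nat -> oper)
    (rho : 'rV[R]_n -> coefs) : L2_theta -> L2_theta :=
  xget 0 [set T | @bounded_op R L2_theta T /\
    forall u v, @hdom R L2_theta u -> @hdom R L2_theta v ->
      hip (T u) v =
      tau1 (fun i => star (Psdo_C sigma v) \o (x i \o Psdo_C rho u))].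

End noncommutative_torus.

Arguments lambda_Psdo {R n} theta x rho.
Arguments sandwich {R n} theta sigma x rho.
Arguments Psdo {R n} theta rho.
Arguments Psdo_C {R n} theta rho.

(* Main.v *)
From HB Require Import structures.
Require Import Defs.
From mathcomp Require Import all_boot all_order all_algebra finmap.
From mathcomp Require Import complex ring lra.
From mathcomp Require Import all_classical all_reals all_analysis.
From mathcomp Require Import measurable_realfun.

(* The map x |-> x 1 identifies L_2(T^n_theta) with the Hilbert space of
   L_2(T^n), the vectors U^k 1 forming an orthonormal basis.  The right
   multiplications are the Weyl operators with theta replaced by - theta; they
   commute with the U_j, so that 1 is cyclic and separating, and expanding in the
   bases U^k 1 and (U^k)^* 1 by Parseval's formula shows that tau is a trace.

   As sum_k |rho(k)|^2 < oo for m > n/2, the sums S_u = sum_k u_k rho(k) U^k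
   converge in operator norm, and P_rho u is S_u 1.  A bounded operator T has a
   trace, computed in any orthonormal basis, as soon as T P_K tends to T for the
   trace norm, P_K being the projection on the e_k for k in a finite set K; here
   the trace norm is tested on pairs of finite Bessel families, which avoids polar
   decompositions.  For lambda(x) P_rho this follows from
   |x rho(k) U^k|_2 <= |x|_2 |rho(k)|.  For P_sigma^* lambda(x) P_rho, elements x
   of L_infty are factored, up to a small error in norm, as y^* z with |y|_2^2
   and |z|_2^2 at most 4 |x|_1, which exhibits the operator as a product of two
   Hilbert-Schmidt operators up to a small error in norm.  The traces are then
   computed in the basis U^k 1. *)

Set Implicit Arguments.
Unset Strict Implicit.
Unset Printing Implicit Defensive.

Import Order.TTheory GRing.Theory Num.Theory.
Import numFieldNormedType.Exports.

Local Open Scope complex_scope.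
Local Open Scope ring_scope.

(** * Complex numbers and Hilbert spaces *)

(** [adj], [abs_op], [trace], [Psdo] and [sandwich] are picked among the solutions of a property, on
    spaces whose vectors are determined up to distance 0. Each calls for an existence proof, and
    most for uniqueness, obtained on a genuine Hilbert space [V] that presents both L_2(T^n) and
    L_2(T^n_theta); hence the completeness of L_2(T^n), Riesz representation and square roots below.

    The partial isometry of T = w |T| is replaced by T h_N, with h_N a polynomial in |T| such that
    |T| h_N = 1 - (1 - |T| / c)^N. It stays in the algebra and has norm at most 2, whence the
    constants 2 and 4 below; T h_N |T| tends to T in norm. As the vectors T h_N e_k need not be
    orthonormal, the trace norm is tested on Bessel families.

    An element of L_1 is a Cauchy sequence of bounded elements. The factors y and z change with the
    approximant, but their bounds in L_2 do not, so |z rho(k) U^k|_2 <= |rho(k)| |z|_2 controls the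
    tails uniformly. *)

Notation Re := complex.Re.
Notation Im := complex.Im.
Notation normc := Normc.normc.

Section complex_facts.
Context {R : realType}.
Implicit Types (z w : R[i]) (x : R).

Lemma half_gt0 x : 0 < x -> 0 < x / 2.
Proof. by move=> x0; rewrite divr_gt0. Qed.

Lemma ReD z w : Re (z + w) = Re z + Re w. Proof. by case: z; case: w. Qed.
Lemma ImD z w : Im (z + w) = Im z + Im w. Proof. by case: z; case: w. Qed.
Lemma ReN z : Re (- z) = - Re z. Proof. by case: z. Qed.
Lemma ImN z : Im (- z) = - Im z. Proof. by case: z. Qed.
Lemma ReB z w : Re (z - w) = Re z - Re w. Proof. by rewrite ReD ReN. Qed.
Lemma ImB z w : Im (z - w) = Im z - Im w. Proof. by rewrite ImD ImN. Qed.
Lemma ReM z w : Re (z * w) = Re z * Re w - Im z * Im w.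
Proof. by case: z; case: w. Qed.
Lemma ImM z w : Im (z * w) = Re z * Im w + Im z * Re w.
Proof. by case: z => a b; case: w => c d /=; rewrite addrC; congr (_ + _); rewrite mulrC. Qed.
Lemma ReJ z : Re z^* = Re z. Proof. by case: z. Qed.
Lemma ImJ z : Im z^* = - Im z. Proof. by case: z. Qed.
Lemma conjcM z w : (z * w)^* = z^* * w^*. Proof. exact: rmorphM. Qed.
Lemma conjcD z w : (z + w)^* = z^* + w^*. Proof. exact: rmorphD. Qed.
Lemma rcM x y : (x * y)%:C = x%:C * y%:C. Proof. exact: rmorphM. Qed.
Lemma rcD x y : (x + y)%:C = x%:C + y%:C. Proof. exact: rmorphD. Qed.
Lemma rcB x y : (x - y)%:C = x%:C - y%:C. Proof. exact: rmorphB. Qed.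
Lemma rcX x k : (x ^+ k)%:C = x%:C ^+ k. Proof. exact: rmorphXn. Qed.
Lemma conjJK z : z^*^* = z. Proof. exact: conjcK. Qed.
Lemma Re_rc x : Re x%:C = x. Proof. by []. Qed.
Lemma conjc_rc x : (x%:C)^* = x%:C. Proof. exact: conjc_real. Qed.

Lemma Re_sum (I : Type) (r : seq I) (P : pred I) (F : I -> R[i]) :
  Re (\sum_(i <- r | P i) F i) = \sum_(i <- r | P i) Re (F i).
Proof. by apply: (big_morph _ ReD). Qed.

Lemma complex_ext z w : Re z = Re w -> Im z = Im w -> z = w.
Proof. by case: z => a b; case: w => c d /= -> ->. Qed.

Lemma ge0_ReIm z : 0 <= z -> 0 <= Re z /\ Im z = 0.
Proof. by rewrite lecE => /andP[/eqP /= -> ->]. Qed.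

Lemma ReIm_ge0 z : 0 <= Re z -> Im z = 0 -> 0 <= z.
Proof. by move=> h1 h2; rewrite lecE /= h1 h2 eqxx. Qed.

Lemma normc_sq z : normc z ^+ 2 = Re z ^+ 2 + Im z ^+ 2.
Proof.
by case: z => a b /=; rewrite sqr_sqrtr // addr_ge0 // sqr_ge0.
Qed.

Lemma normc_ge0 z : 0 <= normc z.
Proof. by case: z => a b /=; exact: sqrtr_ge0. Qed.

Lemma normcJ z : normc z^* = normc z.
Proof. by case: z => a b /=; rewrite sqrrN. Qed.

Lemma normc_rc x : normc x%:C = `|x|.
Proof. by rewrite /= expr0n /= addr0 sqrtr_sqr. Qed.

Lemma mulcJ z : z * z^* = (normc z ^+ 2)%:C.
Proof.
apply: complex_ext; rewrite ?ReM ?ImM ReJ ImJ ?Re_rc ?normc_sq; first by ring.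
by rewrite /=; ring.
Qed.

Lemma Re_le_normc z : Re z <= normc z.
Proof.
apply: le_trans (ler_norm _) _.
by rewrite -(@ler_pXn2r _ 2) ?nnegrE ?normc_ge0 // normc_sq real_normK ?num_real // lerDl sqr_ge0.
Qed.

Lemma Im_le_normc z : `|Im z| <= normc z.
Proof.
by rewrite -(@ler_pXn2r _ 2) ?nnegrE ?normc_ge0 // normc_sq real_normK ?num_real // lerDr sqr_ge0.
Qed.

Lemma absRe_le_normc z : `|Re z| <= normc z.
Proof.
by rewrite -(@ler_pXn2r _ 2) ?nnegrE ?normc_ge0 // normc_sq real_normK ?num_real // lerDl sqr_ge0.
Qed.

Lemma normc_le_ReIm z : normc z <= `|Re z| + `|Im z|.
Proof.
rewrite -(@ler_pXn2r _ 2) ?nnegrE ?normc_ge0 ?addr_ge0 // normc_sq.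
rewrite sqrrD !real_normK ?num_real //; have := mulr_ge0 (normr_ge0 (Re z)) (normr_ge0 (Im z)).
lra.
Qed.

Lemma normc_sum (I : Type) (r : seq I) (P : pred I) (F : I -> R[i]) :
  normc (\sum_(i <- r | P i) F i) <= \sum_(i <- r | P i) normc (F i).
Proof.
elim/big_rec2 : _ => [|i x y _ h]; first by rewrite Normc.normc0.
by apply: le_trans (le_normcD _ _) _; rewrite lerD2l.
Qed.

Lemma normcBC z w : normc (z - w) = normc (w - z).
Proof. by rewrite -normcN opprB. Qed.

End complex_facts.

(** The genuine counterpart of [hilbert]: the inner product is definite, so that vectors at distance
    0 are equal and linearity of operators can be stated as an equation. *)
Record hspace (R : realType) := HSpace {
  hs :> lmodType R[i];
  ip : hs -> hs -> R[i];
  ip_linear : forall a u v w, ip (a *: u + v) w = a * ip u w + ip v w;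
  ipC : forall u v, ip v u = (ip u v)^*;
  ipuu_ge0 : forall u, 0 <= ip u u;
  ipuu_eq0 : forall u, ip u u = 0 -> u = 0;
  hs_complete : forall u : nat -> hs,
    (forall e : R, 0 < e -> exists N, forall i j, (N <= i)%N -> (N <= j)%N ->
       Num.sqrt (Re (ip (u i - u j) (u i - u j))) < e) ->
    exists l, forall e : R, 0 < e -> exists N, forall i, (N <= i)%N ->
       Num.sqrt (Re (ip (u i - l) (u i - l))) < e }.

Section inner_product.
Context {R : realType} {V : hspace R}.
Implicit Types (u v w : V) (a : R[i]) (T S : V -> V).

Definition nrm u : R := Num.sqrt (Re (ip u u)).

Lemma nrm_ge0 u : 0 <= nrm u. Proof. exact: sqrtr_ge0. Qed.

Lemma nrm_sq u : nrm u ^+ 2 = Re (ip u u).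
Proof. by rewrite sqr_sqrtr //; case/ge0_ReIm: (ipuu_ge0 u). Qed.

Lemma ipuu u : ip u u = (nrm u ^+ 2)%:C.
Proof.
by apply: complex_ext; rewrite ?nrm_sq //=; case/ge0_ReIm: (ipuu_ge0 u).
Qed.

Lemma ipDl u v w : ip (u + v) w = ip u w + ip v w.
Proof. by rewrite -[u]scale1r ip_linear scale1r mul1r. Qed.
Lemma ip0l w : ip 0 w = 0.
Proof. by have := ipDl 0 0 w; rewrite addr0 => /eqP; rewrite -subr_eq subrr => /eqP. Qed.
Lemma ipZl a u w : ip (a *: u) w = a * ip u w.
Proof. by rewrite -[a *: u]addr0 ip_linear ip0l addr0. Qed.
Lemma ipNl u w : ip (- u) w = - ip u w.
Proof. by rewrite -scaleN1r ipZl mulN1r. Qed.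
Lemma ipBl u v w : ip (u - v) w = ip u w - ip v w.
Proof. by rewrite ipDl ipNl. Qed.
Lemma ipDr u v w : ip w (u + v) = ip w u + ip w v.
Proof. by rewrite ipC ipDl rmorphD /= -!ipC. Qed.
Lemma ip0r w : ip w 0 = 0.
Proof. by rewrite ipC ip0l rmorph0. Qed.
Lemma ipZr a u w : ip w (a *: u) = a^* * ip w u.
Proof. by rewrite ipC ipZl rmorphM /= -ipC. Qed.
Lemma ipNr u w : ip w (- u) = - ip w u.
Proof. by rewrite ipC ipNl rmorphN /= -ipC. Qed.
Lemma ipBr u v w : ip w (u - v) = ip w u - ip w v.
Proof. by rewrite ipDr ipNr. Qed.

Lemma ip_suml (I : Type) (r : seq I) (P : pred I) (F : I -> V) w :
  ip (\sum_(i <- r | P i) F i) w = \sum_(i <- r | P i) ip (F i) w.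
Proof. by elim/big_rec2 : _ => [|i x y _ <-]; rewrite ?ip0l ?ipDl. Qed.
Lemma ip_sumr (I : Type) (r : seq I) (P : pred I) (F : I -> V) w :
  ip w (\sum_(i <- r | P i) F i) = \sum_(i <- r | P i) ip w (F i).
Proof. by elim/big_rec2 : _ => [|i x y _ <-]; rewrite ?ip0r ?ipDr. Qed.

Lemma nrm0 : nrm 0 = 0. Proof. by rewrite /nrm ip0l sqrtr0. Qed.

Lemma nrm_eq0 u : nrm u = 0 -> u = 0.
Proof. by move=> h; apply: ipuu_eq0; rewrite ipuu h expr0n. Qed.

Lemma nrmN u : nrm (- u) = nrm u.
Proof. by rewrite /nrm ipNl ipNr opprK. Qed.

Lemma nrmBC u v : nrm (u - v) = nrm (v - u).
Proof. by rewrite -nrmN opprB. Qed.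

Lemma nrmZ a u : nrm (a *: u) = normc a * nrm u.
Proof.
apply/eqP; rewrite -(@eqrXn2 _ 2) ?mulr_ge0 ?normc_ge0 ?nrm_ge0 //; apply/eqP.
by rewrite nrm_sq ipZl ipZr mulrA mulcJ ipuu -rmorphM Re_rc exprMn.
Qed.

Lemma nrmD_sq u v : nrm (u + v) ^+ 2 = nrm u ^+ 2 + 2 * Re (ip u v) + nrm v ^+ 2.
Proof.
rewrite !nrm_sq ipDl !ipDr !ReD (ipC u v) ReJ; ring.
Qed.

Lemma nrmB_sq u v : nrm (u - v) ^+ 2 = nrm u ^+ 2 - 2 * Re (ip u v) + nrm v ^+ 2.
Proof. by rewrite nrmD_sq ipNr ReN nrmN; ring. Qed.

Lemma cauchy_schwarz u v : normc (ip u v) <= nrm u * nrm v.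
Proof.
have [v0|v0] := eqVneq (nrm v) 0.
  by rewrite (nrm_eq0 v0) ip0r Normc.normc0 nrm0 mulr0.
have vp : 0 < nrm v by rewrite lt_def v0 nrm_ge0.
rewrite -(@ler_pXn2r _ 2) ?nnegrE ?normc_ge0 ?mulr_ge0 ?nrm_ge0 // exprMn.
(* [c * ip u v] is the coefficient of the projection of [u] on [v]; the squared distance from [u] to
   this projection is nonnegative. *)
set c : R := (nrm v ^+ 2)^-1.
have := sqr_ge0 (nrm (u - (c%:C * ip u v) *: v)).
rewrite nrmB_sq nrmZ ipZr conjcM; rewrite conjc_rc -mulrA [_^* * _]mulrC mulcJ.
rewrite -rmorphM Re_rc Normc.normcM normc_rc !exprMn real_normK ?num_real //.
rewrite /c; set p := normc _ ^+ 2; set q := nrm v ^+ 2; set t := nrm u ^+ 2.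
have q0 : 0 < q by rewrite exprn_gt0.
have -> : t - 2 * (q^-1 * p) + q^-1 ^+ 2 * p * q = (t * q - p) / q.
  by field; rewrite gt_eqF.
by rewrite pmulr_lge0 ?invr_gt0 // subr_ge0.
Qed.

Lemma nrmD u v : nrm (u + v) <= nrm u + nrm v.
Proof.
rewrite -(@ler_pXn2r _ 2) ?nnegrE ?addr_ge0 ?nrm_ge0 // nrmD_sq sqrrD.
have := le_trans (Re_le_normc _) (cauchy_schwarz u v); lra.
Qed.

Lemma nrmB u v : nrm (u - v) <= nrm u + nrm v.
Proof. by rewrite -(nrmN v) nrmD. Qed.

Lemma nrm_dist u v w : nrm (u - w) <= nrm (u - v) + nrm (v - w).
Proof. by rewrite -[u - w](subrKA v); apply: nrmD. Qed.

Lemma nrm_leD u v : nrm u <= nrm v + nrm (u - v).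
Proof. by rewrite -{1}[u](subrKC v); exact: nrmD. Qed.

Lemma nrm_sum (I : Type) (r : seq I) (P : pred I) (F : I -> V) :
  nrm (\sum_(i <- r | P i) F i) <= \sum_(i <- r | P i) nrm (F i).
Proof.
elim/big_rec2 : _ => [|i x y _ h]; first by rewrite nrm0.
by apply: le_trans (nrmD _ _) _; rewrite lerD2l.
Qed.

Lemma parallelogram u v :
  nrm (u + v) ^+ 2 + nrm (u - v) ^+ 2 = 2 * nrm u ^+ 2 + 2 * nrm v ^+ 2.
Proof. by rewrite nrmD_sq nrmB_sq; ring. Qed.

Lemma ip_ext u v : (forall w, ip u w = ip v w) -> u = v.
Proof.
move=> h; apply/eqP; rewrite -subr_eq0; apply/eqP/ipuu_eq0.
by rewrite ipBl h subrr.
Qed.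

Lemma nrm_small u : (forall e : R, 0 < e -> nrm u <= e) -> u = 0.
Proof.
move=> h; apply: nrm_eq0; apply/eqP; rewrite eq_le nrm_ge0 andbT.
by apply/ler_addgt0Pr => e e0; rewrite add0r h.
Qed.

Definition vconv (u : nat -> V) (l : V) : Prop :=
  forall e : R, 0 < e -> exists N, forall i, (N <= i)%N -> nrm (u i - l) < e.

Definition vcauchy (u : nat -> V) : Prop :=
  forall e : R, 0 < e -> exists N, forall i j, (N <= i)%N -> (N <= j)%N ->
    nrm (u i - u j) < e.

Lemma vcauchyP (u : nat -> V) : vcauchy u -> exists l, vconv u l.
Proof. exact: hs_complete. Qed.

Lemma vconv_cauchy (u : nat -> V) l : vconv u l -> vcauchy u.
Proof.
move=> h e e0; have [N hN] := h (e / 2) (half_gt0 e0).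
exists N => i j iN jN; rewrite (le_lt_trans (nrm_dist _ l _)) // [e]splitr ltrD //; first exact: hN.
by rewrite nrmBC hN.
Qed.

Lemma vconv_unique (u : nat -> V) l l' : vconv u l -> vconv u l' -> l = l'.
Proof.
move=> h h'; apply/eqP; rewrite -subr_eq0; apply/eqP/nrm_small => e e0.
have [N hN] := h (e / 2) (half_gt0 e0).
have [N' hN'] := h' (e / 2) (half_gt0 e0).
rewrite (le_trans (nrm_dist _ (u (maxn N N')) _)) // [leRHS]splitr lerD //.
  by rewrite nrmBC ltW // hN // leq_maxl.
by rewrite ltW // hN' // leq_maxr.
Qed.

End inner_product.

(** * Bounded operators *)

Section operators.
Context {R : realType} {V : hspace R}.
Implicit Types (u v w : V) (a : R[i]) (T S : V -> V).

Definition islin T := forall a u v, T (a *: u + v) = a *: T u + T v.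
Definition obound T (c : R) := forall u, nrm (T u) <= c * nrm u.
Definition bop T := islin T /\ exists c : R, 0 <= c /\ obound T c.

Section linear.
Variable T : V -> V.
Hypothesis lT : islin T.
Lemma islinD u v : T (u + v) = T u + T v.
Proof. by rewrite -[u]scale1r lT !scale1r. Qed.
Lemma islin0 : T 0 = 0.
Proof. by have /eqP := islinD 0 0; rewrite addr0 -subr_eq subrr => /eqP. Qed.
Lemma islinZ a u : T (a *: u) = a *: T u.
Proof. by rewrite -[a *: u]addr0 lT islin0 addr0. Qed.
Lemma islinN u : T (- u) = - T u.
Proof. by rewrite -scaleN1r islinZ scaleN1r. Qed.
Lemma islinB u v : T (u - v) = T u - T v.
Proof. by rewrite islinD islinN. Qed.
Lemma islin_sum (I : Type) (r : seq I) (P : pred I) (F : I -> V) :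
  T (\sum_(i <- r | P i) F i) = \sum_(i <- r | P i) T (F i).
Proof. by elim/big_rec2 : _ => [|i x y _ <-]; rewrite ?islin0 ?islinD. Qed.
End linear.

Lemma bop_lin T : bop T -> islin T. Proof. by case. Qed.
Hint Resolve bop_lin : core.

Lemma islin_comp S T : islin S -> islin T -> islin (S \o T).
Proof. by move=> hS hT a u v /=; rewrite hT hS. Qed.
Lemma islin_lin b S T : islin S -> islin T -> islin (fun u => b *: S u + T u).
Proof.
move=> hS hT a u v; rewrite hS hT !scalerDr !scalerA (mulrC b).
by rewrite addrACA.
Qed.

Lemma obound_comp S T c d : 0 <= c -> obound S c -> obound T d ->
  obound (S \o T) (c * d).
Proof.
move=> c0 hS hT u /=; apply: le_trans (hS _) _.
by rewrite -mulrA ler_wpM2l.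
Qed.
Lemma obound_lin b S T c d : obound S c -> obound T d ->
  obound (fun u => b *: S u + T u) (normc b * c + d).
Proof.
move=> hS hT u; apply: le_trans (nrmD _ _) _; rewrite mulrDl lerD // nrmZ -mulrA.
by rewrite ler_wpM2l // normc_ge0.
Qed.

Lemma bop_id : bop id.
Proof. by split => //; exists 1; split => // u; rewrite mul1r. Qed.
Lemma bop_comp S T : bop S -> bop T -> bop (S \o T).
Proof.
move=> [lS [c [c0 hS]]] [lT [d [d0 hT]]]; split; first exact: islin_comp.
by exists (c * d); split; [rewrite mulr_ge0|exact: obound_comp].
Qed.
Lemma bop_lincomb b S T : bop S -> bop T -> bop (fun u => b *: S u + T u).
Proof.
move=> [lS [c [c0 hS]]] [lT [d [d0 hT]]]; split; first exact: islin_lin.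
exists (normc b * c + d); split; last exact: obound_lin.
by rewrite addr_ge0 // mulr_ge0 // normc_ge0.
Qed.
Lemma bop_cst0 : bop (fun=> 0).
Proof.
split; first by move=> a u v; rewrite scaler0 addr0.
by exists 0; split => // u; rewrite nrm0 mul0r.
Qed.
Lemma bopD S T : bop S -> bop T -> bop (fun u => S u + T u).
Proof.
move=> hS hT; have := bop_lincomb 1 hS hT.
by congr bop; apply/funext => u; rewrite scale1r.
Qed.
Lemma bopZ b S : bop S -> bop (fun u => b *: S u).
Proof.
move=> hS; have := bop_lincomb b hS bop_cst0.
by congr bop; apply/funext => u; rewrite addr0.
Qed.
Lemma bopB S T : bop S -> bop T -> bop (fun u => S u - T u).
Proof.
move=> hS hT; have := bop_lincomb (-1) hT hS.
by congr bop; apply/funext => u; rewrite scaleN1r addrC.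
Qed.
Lemma bop_iter n T : bop T -> bop (iter n T).
Proof.
move=> hT; elim: n => [|n IH]; first exact: bop_id.
exact: (bop_comp hT IH).
Qed.
Lemma bop_sum (I : Type) (r : seq I) (F : I -> V -> V) :
  (forall i, bop (F i)) -> bop (fun u => \sum_(i <- r) F i u).
Proof.
move=> hF; elim: r => [|i r IH].
  by have := bop_cst0; congr bop; apply/funext => u; rewrite big_nil.
by have := bopD (hF i) IH; congr bop; apply/funext => u; rewrite big_cons.
Qed.

Lemma bop_conv T : bop T -> forall (u : nat -> V) l, vconv u l -> vconv (T \o u) (T l).
Proof.
move=> [lT [c [c0 hT]]] u l h e e0.
have c1 : 0 < c + 1 by rewrite ltr_wpDl.
have [N hN] := h (e / (c + 1)) (divr_gt0 e0 c1); exists N => i iN /=.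
rewrite -islinB //; apply: le_lt_trans (hT _) _.
apply: (@le_lt_trans _ _ ((c + 1) * nrm (u i - l))).
  by rewrite ler_wpM2r ?nrm_ge0 // lerDl.
by rewrite mulrC -ltr_pdivlMr // hN.
Qed.

(* Minimizing |w|^2 - 2 Re (f w); the parallelogram law makes minimizing
   sequences Cauchy. *)
Lemma riesz (f : V -> R[i]) :
  (forall a u v, f (a *: u + v) = a * f u + f v) ->
  (exists c : R, forall u, normc (f u) <= c * nrm u) ->
  exists w, forall u, f u = ip u w.
Proof.
move=> lf [c0 hc0].
pose c : R := `|c0|.
have c_ge0 : 0 <= c by rewrite /c normr_ge0.
have hc u : normc (f u) <= c * nrm u.
  by apply: le_trans (hc0 u) _; rewrite ler_wpM2r ?nrm_ge0 // ler_norm.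
have fD u v : f (u + v) = f u + f v by rewrite -[u]scale1r lf mul1r scale1r.
have f0 : f 0 = 0 by have /eqP := fD 0 0; rewrite addr0 -subr_eq subrr => /eqP.
have fZ a u : f (a *: u) = a * f u by rewrite -[a *: u]addr0 lf f0 addr0.
pose Q w := nrm w ^+ 2 - 2 * Re (f w).
have Qlb w : - c ^+ 2 <= Q w.
  rewrite /Q; have h1 : Re (f w) <= c * nrm w := le_trans (Re_le_normc _) (hc w).
  have := sqr_ge0 (nrm w - c); rewrite sqrrB; lra.
have hinf : has_inf [set Q w | w in [set: V]].
  split; first by exists (Q 0), 0.
  by exists (- c ^+ 2) => _ [w _ <-].
pose m := inf [set Q w | w in [set: V]].
have mle w : m <= Q w by apply: ge_inf; [case: hinf | exists w].
have mapx (e : R) : 0 < e -> exists w, Q w < m + e.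
  by move=> e0; have [_ [w _ <-] h] := inf_adherent e0 hinf; exists w.
(* The linear terms of [Q] cancel in the parallelogram law. As [Q] is at least [m] at the midpoint,
   |u - v|^2 is at most 2 (Q u - m) + 2 (Q v - m). *)
have mid u v : nrm (u - v) ^+ 2 = 2 * Q u + 2 * Q v - 4 * Q ((2^-1)%:C *: (u + v)).
  have := parallelogram u v; rewrite /Q nrmZ fZ fD exprMn normc_rc.
  rewrite ger0_norm ?invr_ge0 // ReM !ReD /= mul0r subr0 => h.
  set x := nrm (u + v) ^+ 2 in h *.
  have -> : (2^-1 : R) ^+ 2 = 4^-1 by field.
  lra.
have /choice[w hw] : forall n, exists w, Q w < m + n.+1%:R^-1.
  by move=> n; apply: mapx; rewrite invr_gt0.
have wd i j : nrm (w i - w j) ^+ 2 <= 2 * i.+1%:R^-1 + 2 * j.+1%:R^-1.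
  rewrite mid; have := mle ((2^-1)%:C *: (w i + w j)).
  have := hw i; have := hw j; move: (i.+1%:R^-1) (j.+1%:R^-1) => a b; lra.
have small (e : R) : 0 < e -> exists N, forall i, (N <= i)%N -> i.+1%:R^-1 < e.
  move=> e0; exists (Num.truncn e^-1) => i Ni.
  rewrite invf_plt ?posrE // (lt_le_trans (truncnS_gt _)) // ler_nat ltnS.
  exact: Ni.
have cw : vcauchy w.
  move=> e e0; have e40 : 0 < e ^+ 2 / 4 by rewrite divr_gt0 // exprn_gt0.
  have [N hN] := small _ e40; exists N => i j iN jN.
  rewrite -(@ltr_pXn2r _ 2) ?nnegrE ?nrm_ge0 //; last exact: ltW.
  apply: le_lt_trans (wd i j) _; have := hN _ iN; have := hN _ jN.
  move: (i.+1%:R^-1) (j.+1%:R^-1) (e ^+ 2) => a b d; lra.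
have [l hl] := vcauchyP cw.
have Ql : forall e : R, 0 < e -> Q l <= m + e.
  move=> e e0.
  have K0 : 0 < 1 + 2 * nrm l + 2 * c by have := nrm_ge0 l; lra.
  (* Passing from [w i] to [l], at distance less than [d <= 1], raises [Q] by at most
     [d * (1 + 2 * nrm l + 2 * c)]. *)
  pose d := Num.min 1 (e / 2 / (1 + 2 * nrm l + 2 * c)).
  have d0 : 0 < d by rewrite lt_min ltr01 divr_gt0 // half_gt0.
  have [N hN] := hl _ d0; have [M hM] := small _ (half_gt0 e0).
  pose i := maxn N M.
  have hdi := hN i (leq_maxl _ _); have hmi := hM i (leq_maxr _ _).
  have hdd : d * (1 + 2 * nrm l + 2 * c) <= e / 2.
    by rewrite -ler_pdivlMr // ge_min lexx orbT.
  have d1 : d <= 1 by rewrite ge_min lexx.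
  have h1 : Re (f (w i)) - Re (f l) <= c * d.
    rewrite -ReB -[f (w i) - f l](_ : f (w i - l) = _).
      apply: le_trans (Re_le_normc _) (le_trans (hc _) _).
      by rewrite ler_wpM2l // ltW.
    by rewrite fD -scaleN1r fZ mulN1r.
  have h2 : nrm l <= nrm (w i) + d.
    by apply: le_trans (nrm_leD l (w i)) _; rewrite lerD2l nrmBC ltW.
  have h3 : nrm (w i) <= nrm l + d.
    by apply: le_trans (nrm_leD (w i) l) _; rewrite lerD2l ltW.
  have h4 : nrm l ^+ 2 <= nrm (w i) ^+ 2 + d * (1 + 2 * nrm l).
    have := nrm_ge0 l; have := nrm_ge0 (w i); nra.
  have := hw i; rewrite /Q => h5; move: hmi h5; move: (i.+1%:R^-1) => a; lra.
have Qlm : Q l <= m by apply/ler_addgt0Pr.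
(* First variation: [Q l <= Q (t u + l)] is divided by [t], then [t] tends to 0. The vectors [- u]
   and ['i *: u] will give the opposite inequality and the imaginary part. *)
have key u : Re (f u) <= Re (ip u l).
  have h (t : R) : 0 < t -> 2 * Re (f u) <= 2 * Re (ip u l) + t * nrm u ^+ 2.
    move=> t0; have h1 := le_trans Qlm (mle (t%:C *: u + l)).
    move: h1; rewrite /Q nrmD_sq nrmZ normc_rc gtr0_norm // ipZl lf ReD !ReM !Re_rc !mul0r.
    rewrite !subr0 exprMn => h1.
    have : t * (2 * Re (f u)) <= t * (2 * Re (ip u l) + t * nrm u ^+ 2) by lra.
    by rewrite ler_pM2l.
  have : 2 * Re (f u) <= 2 * Re (ip u l).
    apply/ler_addgt0Pr => e e0.
    have n1 : 0 < 1 + nrm u ^+ 2 by have := sqr_ge0 (nrm u); lra.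
    apply: le_trans (h (e / (1 + nrm u ^+ 2)) (divr_gt0 e0 n1)) _.
    rewrite lerD2l mulrAC ler_pdivrMr // ler_wpM2l //; first exact: ltW.
    by rewrite lerDr.
  by rewrite ler_pM2l.
have key' u : Re (f u) = Re (ip u l).
  apply/eqP; rewrite eq_le key /=.
  by have := key (- u); rewrite -scaleN1r fZ ipZl !mulN1r !ReN lerN2.
exists l => u; apply: complex_ext => //.
have := key' ('i *: u); rewrite fZ ipZl !ReM /= !mul0r !mul1r !sub0r.
by move=> /oppr_inj.
Qed.

Lemma adjoint_ex T : bop T -> exists S, bop S /\ forall u v, ip (T u) v = ip u (S v).
Proof.
move=> bT; have [lT [c [c0 hT]]] := bT.
have /choice[S hS] : forall v, exists w, forall u, ip (T u) v = ip u w.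
  move=> v; apply: riesz => [a x y|]; first by rewrite lT ip_linear.
  exists (c * nrm v) => u; apply: le_trans (cauchy_schwarz _ _) _.
  by rewrite mulrAC ler_wpM2r ?nrm_ge0.
exists S; split; last by move=> u v; exact: hS.
split.
  move=> a x y; apply: ip_ext => w.
  by rewrite ipC -hS [RHS]ipC ipDr ipZr (ipDr (a *: S x)) ipZr -!hS.
exists c; split => // v.
have [->|v0] := eqVneq (nrm (S v)) 0; first by rewrite mulr_ge0 ?nrm_ge0.
have p : 0 < nrm (S v) by rewrite lt_def v0 nrm_ge0.
rewrite -(ler_pM2l p) -expr2 nrm_sq -hS.
apply: le_trans (Re_le_normc _) (le_trans (cauchy_schwarz _ _) _).
by rewrite mulrCA mulrA ler_wpM2r ?nrm_ge0 // hT.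
Qed.

Definition adjV T : V -> V :=
  xget T [set S | bop S /\ forall u v, ip (T u) v = ip u (S v)].

Lemma adjV_bop T : bop T -> bop (adjV T).
Proof. by move=> /adjoint_ex[S hS]; rewrite /adjV; case: xgetP => [? _ []|/(_ S)]. Qed.

Lemma ip_adj T u v : bop T -> ip (T u) v = ip u (adjV T v).
Proof. by move=> /adjoint_ex[S hS]; rewrite /adjV; case: xgetP => [? _ []|/(_ S)]. Qed.

Lemma ip_adjl T u v : bop T -> ip (adjV T u) v = ip u (T v).
Proof. by move=> bT; rewrite ipC -ip_adj // -ipC. Qed.

Lemma adjV_uniq T S : (forall u v, ip (T u) v = ip u (S v)) -> bop T -> adjV T = S.
Proof.
move=> h bT; apply/funext => v; apply: ip_ext => w.
by rewrite ip_adjl // ipC h -ipC.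
Qed.

Lemma adjVK T : bop T -> adjV (adjV T) = T.
Proof. by move=> bT; apply: adjV_uniq (adjV_bop bT) => u v; rewrite ip_adjl. Qed.

Lemma adjV_comp S T : bop S -> bop T -> adjV (S \o T) = adjV T \o adjV S.
Proof.
move=> bS bT; apply: adjV_uniq (bop_comp bS bT) => u v /=.
by rewrite !ip_adj.
Qed.

Lemma obound_adj T c : 0 <= c -> bop T -> obound T c -> obound (adjV T) c.
Proof.
move=> c0 bT hT v; set S := adjV T.
have [->|v0] := eqVneq (nrm (S v)) 0; first by rewrite mulr_ge0 ?nrm_ge0.
have p : 0 < nrm (S v) by rewrite lt_def v0 nrm_ge0.
rewrite -(ler_pM2l p) -expr2 nrm_sq -ip_adj //.
apply: le_trans (Re_le_normc _) (le_trans (cauchy_schwarz _ _) _).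
by rewrite mulrCA mulrA ler_wpM2r ?nrm_ge0 // hT.
Qed.

End operators.
#[export] Hint Resolve bop_lin : core.

(** * Positive operators and square roots *)

Section limits.
Context {R : realType} {V : hspace R}.
Implicit Types (u v w l : nat -> V) (a : R[i]) (T S : V -> V).

Definition cconv (z : nat -> R[i]) (l : R[i]) : Prop :=
  forall e : R, 0 < e -> exists N, forall i, (N <= i)%N -> normc (z i - l) < e.

Lemma inv_small (e : R) : 0 < e -> exists N, forall i, (N <= i)%N -> i.+1%:R^-1 < e.
Proof.
move=> e0; exists (Num.truncn e^-1) => i Ni.
rewrite invf_plt ?posrE // (lt_le_trans (truncnS_gt _)) // ler_nat ltnS.
exact: Ni.
Qed.

Lemma vconv_bound (u : nat -> V) (l : V) (a : nat -> R) :
  (forall e : R, 0 < e -> exists N, forall i, (N <= i)%N -> a i < e) ->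
  (forall i, nrm (u i - l) <= a i) -> vconv u l.
Proof.
move=> ha h e e0; have [N hN] := ha e e0; exists N => i iN.
exact: le_lt_trans (h i) (hN i iN).
Qed.

Lemma vconv_cst (x : V) : vconv (fun=> x) x.
Proof. by move=> e e0; exists 0%N => i _; rewrite subrr nrm0. Qed.

Lemma vconvS u (x : V) : vconv u x -> vconv (fun n => u n.+1) x.
Proof. by move=> h e e0; have [N hN] := h e e0; exists N => i iN; apply: hN; rewrite ltnW. Qed.

Lemma vconvD u v (x y : V) : vconv u x -> vconv v y -> vconv (fun n => u n + v n) (x + y).
Proof.
move=> hu hv e e0; have [N hN] := hu _ (half_gt0 e0); have [M hM] := hv _ (half_gt0 e0).
exists (maxn N M) => i; rewrite geq_max => /andP[iN iM].
rewrite opprD addrACA (le_lt_trans (nrmD _ _)) // [e]splitr ltrD //; first exact: hN.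
exact: hM.
Qed.

Lemma vconvZ a u (x : V) : vconv u x -> vconv (fun n => a *: u n) (a *: x).
Proof.
by move=> hu; exact: (bop_conv (bopZ a (@bop_id R V)) hu).
Qed.

Lemma vconv_le u (x : V) (c : R) : vconv u x -> (forall n, nrm (u n) <= c) -> nrm x <= c.
Proof.
move=> hu hc; apply/ler_addgt0Pr => e e0; have [N hN] := hu e e0.
by apply: le_trans (nrm_leD x (u N)) _; rewrite lerD // nrmBC ltW // hN.
Qed.

Lemma cconv_ip u v (x y : V) : vconv u x -> vconv v y -> cconv (fun n => ip (u n) (v n)) (ip x y).
Proof.
move=> hu hv e e0.
have Kx : 0 < nrm x + 1 by rewrite ltr_wpDl // nrm_ge0.
have Ky : 0 < nrm y + 1 by rewrite ltr_wpDl // nrm_ge0.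
pose e1 := Num.min 1 (e / 2 / (nrm x + 1)).
have e10 : 0 < e1 by rewrite lt_min ltr01 divr_gt0 // half_gt0.
have [N hN] := hu _ (divr_gt0 (half_gt0 e0) (addr_gt0 Ky ltr01)).
have [M hM] := hv _ e10.
exists (maxn N M) => i; rewrite geq_max => /andP[iN iM].
have -> : ip (u i) (v i) - ip x y = ip (u i - x) (v i) + ip x (v i - y).
  by rewrite ipBl ipBr addrA subrK.
have h1 : nrm (v i) <= nrm y + 1.
  apply: le_trans (nrm_leD _ y) _; rewrite lerD2l ltW // (lt_le_trans (hM _ iM)) //.
  by rewrite ge_min lexx.
apply: le_lt_trans (le_normcD _ _) _; rewrite [e]splitr ltr_leD //.
  apply: le_lt_trans (cauchy_schwarz _ _) _.
  apply: (@le_lt_trans _ _ (nrm (u i - x) * (nrm y + 1))).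
    by rewrite ler_wpM2l ?nrm_ge0.
  apply: (@le_lt_trans _ _ (nrm (u i - x) * (nrm y + 1 + 1))).
    by rewrite ler_wpM2l ?nrm_ge0 // lerDl.
  by rewrite -ltr_pdivlMr ?hN // ltr_wpDl // ltW.
apply: le_trans (cauchy_schwarz _ _) _.
have h2 : nrm (v i - y) <= e / 2 / (nrm x + 1).
  by rewrite ltW // (lt_le_trans (hM _ iM)) // ge_min lexx orbT.
apply: (@le_trans _ _ ((nrm x + 1) * nrm (v i - y))).
  by rewrite ler_wpM2r ?nrm_ge0 // lerDl.
by rewrite mulrC -ler_pdivlMr.
Qed.

Lemma cconv_unique (z : nat -> R[i]) a b : cconv z a -> cconv z b -> a = b.
Proof.
move=> ha hb; apply/eqP; rewrite -subr_eq0; apply/eqP/Normc.eq0_normc.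
apply/eqP; rewrite eq_le normc_ge0 andbT; apply/ler_addgt0Pr => e e0; rewrite add0r.
have [N hN] := ha _ (half_gt0 e0); have [M hM] := hb _ (half_gt0 e0).
have := hN _ (leq_maxl N M); have := hM _ (leq_maxr N M); set i := maxn N M => h1 h2.
rewrite -[a - b](subrKA (z i)) (le_trans (le_normcD _ _)) // [leRHS]splitr lerD //.
  by rewrite normcBC ltW.
exact: ltW.
Qed.

Lemma cconv_cst a : cconv (fun=> a) a.
Proof. by move=> e e0; exists 0%N => i _; rewrite subrr Normc.normc0. Qed.

(** Only pointwise convergence is asked for, with a uniform bound. The square root below and, at the
    end, both operators whose traces are computed are obtained as such strong limits. *)
Lemma op_lim (Y : nat -> V -> V) (c : R) :
  (forall n, islin (Y n)) -> (forall n, obound (Y n) c) ->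
  (forall x, vcauchy (fun n => Y n x)) ->
  exists S, [/\ islin S, obound S c & forall x, vconv (fun n => Y n x) (S x)].
Proof.
move=> lY bY cY.
have /choice[S hS] : forall x, exists y, vconv (fun n => Y n x) y.
  by move=> x; apply: vcauchyP.
exists S; split => //.
  move=> a x y; apply: vconv_unique (hS _) _.
  have -> : (fun n => Y n (a *: x + y)) = (fun n => a *: Y n x + Y n y).
    by apply/funext => n; rewrite lY.
  by apply: vconvD => //; exact: vconvZ.
by move=> x; apply: vconv_le (hS x) _ => n; exact: bY.
Qed.

End limits.

Section positive.
Context {R : realType} {V : hspace R}.
Implicit Types (u v w : V) (a : R[i]) (T S A : V -> V).

Definition pos T := forall u, 0 <= ip (T u) u.
Definition selfadj T := forall u v, ip (T u) v = ip u (T v).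

(** The quadratic form of [T] is real; its values at u + v and at u + 'i v give the imaginary and
    the real part of the symmetry. *)
Lemma pos_selfadj T : islin T -> pos T -> selfadj T.
Proof.
move=> lT pT u v; rewrite [RHS]ipC.
have h1 : Im (ip (T u) v) = - Im (ip (T v) u).
  have [_] := ge0_ReIm (pT (u + v)); rewrite islinD // ipDl !ipDr !ImD.
  have [_ ->] := ge0_ReIm (pT u); have [_ ->] := ge0_ReIm (pT v); lra.
have h2 : Re (ip (T u) v) = Re (ip (T v) u).
  have [_] := ge0_ReIm (pT (u + 'i *: v)); rewrite islinD // islinZ // ipDl !ipDr !ipZl !ipZr !ImD.
  rewrite !(ImM, ReM) /=; have [_ ->] := ge0_ReIm (pT u); have [_ ->] := ge0_ReIm (pT v); lra.
by apply: complex_ext; rewrite ?ReJ ?ImJ.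
Qed.

Lemma ip_pos_real T u : pos T -> ip (T u) u = (Re (ip (T u) u))%:C.
Proof. by move=> pT; apply: complex_ext => //=; case/ge0_ReIm: (pT u). Qed.

Lemma pos_cs T u v : islin T -> pos T ->
  Re (ip (T u) v) ^+ 2 <= Re (ip (T u) u) * Re (ip (T v) v).
Proof.
move=> lT pT; have sT := pos_selfadj lT pT.
set r := Re (ip (T u) v); set a := Re (ip (T u) u); set b := Re (ip (T v) v).
have h (t : R) : 0 <= a - 2 * t * r + t ^+ 2 * b.
  have [+ _] := ge0_ReIm (pT (u - t%:C *: v)).
  rewrite islinB // islinZ // ipBl !ipBr !ipZl !ipZr !ReB conjc_rc !ReM !Re_rc /= !mul0r.
  by rewrite [ip (T v) u]sT [ip v _]ipC ReJ -/r -/a -/b; lra.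
have a0 : 0 <= a by case/ge0_ReIm: (pT u).
have b0 : 0 <= b by case/ge0_ReIm: (pT v).
have [bz|bn] := eqVneq b 0.
  have [->|rn] := eqVneq r 0; first by rewrite expr0n /= mulr_ge0.
  (* With b = 0 the polynomial is affine in [t], and at this point it takes the value -1. *)
  have := h ((a + 1) / (2 * r)); rewrite bz mulr0 addr0.
  have -> : 2 * ((a + 1) / (2 * r)) * r = a + 1 by field.
  lra.
have bp : 0 < b by rewrite lt_def bn.
have := h (r / b).
have -> : a - 2 * (r / b) * r + (r / b) ^+ 2 * b = (a * b - r ^+ 2) / b by field.
by rewrite pmulr_lge0 ?invr_gt0 // subr_ge0.
Qed.

(** Cauchy-Schwarz for the form <T u, v>, at [u] and [T u], bounds |T u|^4 by <T u, u> <T (T u), T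
    u>, hence by k^2 |u|^2 |T u|^2. *)
Lemma pos_obound T (k : R) : islin T -> pos T -> 0 <= k ->
  (forall u, Re (ip (T u) u) <= k * nrm u ^+ 2) -> obound T k.
Proof.
move=> lT pT k0 h u.
have [->|n0] := eqVneq (nrm (T u)) 0; first by rewrite mulr_ge0 ?nrm_ge0.
have p : 0 < nrm (T u) by rewrite lt_def n0 nrm_ge0.
rewrite -(@ler_pXn2r _ 2) ?nnegrE ?mulr_ge0 ?nrm_ge0 //.
rewrite -(ler_pM2r (exprn_gt0 2 p)).
have := pos_cs u (T u) lT pT; rewrite -[Re (ip (T u) (T u))]nrm_sq => h1.
rewrite -expr2 (le_trans h1) // exprMn.
have := h u; have := h (T u).
have [+ _] := ge0_ReIm (pT u); have [+ _] := ge0_ReIm (pT (T u)).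
have := sqr_ge0 (nrm u); set x := Re _; set y := Re _; set s := _ ^+ 2; set t := _ ^+ 2.
move=> s0 x0 y0 xk yk.
have -> : k ^+ 2 * s * t = (k * s) * (k * t) by ring.
by apply: ler_pM.
Qed.

Lemma pos_eq0 T u : islin T -> pos T -> Re (ip (T u) u) = 0 -> T u = 0.
Proof.
move=> lT pT h; have := pos_cs u (T u) lT pT; rewrite h mul0r -nrm_sq => h1.
apply: nrm_eq0; apply/eqP.
by move: h1; rewrite le_eqVlt ltNge sqr_ge0 orbF !sqrf_eq0.
Qed.

Lemma selfadj_comp_pos S : selfadj S -> pos (S \o S).
Proof. by move=> sS u /=; rewrite sS ipuu_ge0. Qed.

(* The binomial series of the square root of 1 - D, as the limit of
   Y' = (D + Y^2) / 2; norms are dominated by the same recursion at D = 1. *)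
Section sqrt_iteration.
Variable D : V -> V.
Hypotheses (lD : islin D) (sD : selfadj D) (D1 : obound D 1).

Fixpoint sqY n : V -> V :=
  if n is m.+1 then fun u => (2^-1)%:C *: (D u + sqY m (sqY m u)) else fun=> 0.
Fixpoint sqy n : R := if n is m.+1 then (1 + sqy m ^+ 2) / 2 else 0.

Let sqY_lin n : islin (sqY n).
Proof.
elim: n => [|n IH] a u v /=; first by rewrite scaler0 addr0.
rewrite lD !IH scalerA mulrC -scalerA -scalerDr; congr (_ *: _).
by rewrite scalerDr addrACA.
Qed.

Let sqy01 n : 0 <= sqy n <= 1.
Proof.
elim: n => [|n /andP[h1 h2]] /=; first by rewrite lexx ler01.
by apply/andP; split; nra.
Qed.

Let sqyS n : sqy n <= sqy n.+1.
Proof. by rewrite /=; have /andP[h1 h2] := sqy01 n; nra. Qed.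

Let sqY_obound n : obound (sqY n) (sqy n).
Proof.
elim: n => [|n IH] u /=; first by rewrite nrm0 mul0r.
have /andP[h1 h2] := sqy01 n.
rewrite nrmZ normc_rc ger0_norm ?invr_ge0 //.
have := nrmD (D u) (sqY n (sqY n u)); have := D1 u.
have : nrm (sqY n (sqY n u)) <= sqy n ^+ 2 * nrm u.
  apply: le_trans (IH _) _; rewrite expr2 -mulrA ler_wpM2l //; lra.
lra.
Qed.

Let sqY_self n : selfadj (sqY n).
Proof.
elim: n => [|n IH] u v /=; first by rewrite ip0l ip0r.
by rewrite ipZl ipZr conjc_rc ipDl ipDr sD !IH.
Qed.

Let sqY_comm T : islin T -> (forall u, T (D u) = D (T u)) ->
  forall n u, T (sqY n u) = sqY n (T u).
Proof.
move=> lT hT; elim=> [|n IH] u /=; first by rewrite islin0.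
by rewrite islinZ // islinD // hT !IH.
Qed.

Let sqY_dif1 n u : nrm (sqY n.+1 u - sqY n u) <= (sqy n.+1 - sqy n) * nrm u.
Proof.
elim: n u => [|n IH] u.
  by rewrite /= !subr0 addr0 expr0n /= addr0 nrmZ normc_rc ger0_norm ?invr_ge0 // div1r
    ler_wpM2l ?invr_ge0 // -[leRHS]mul1r.
rewrite [sqY n.+2]/= [X in nrm (_ - X)]/= -scalerBr nrmZ normc_rc ger0_norm ?invr_ge0 //.
rewrite opprD addrACA subrr add0r.
(* Y'^2 - Y^2 = Y' (Y' - Y) + (Y' - Y) Y holds without commutation, and the bounds on the two terms
   add up to y'^2 - y^2 = (y' + y) (y' - y), the increment of the scalar recursion. *)
rewrite -[sqY n.+1 (sqY n.+1 u) - _](subrKA (sqY n.+1 (sqY n u))) -islinB //.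
have := nrmD (sqY n.+1 (sqY n.+1 u - sqY n u)) (sqY n.+1 (sqY n u) - sqY n (sqY n u)).
have := sqY_obound n.+1 (sqY n.+1 u - sqY n u); have := IH (sqY n u); have := IH u.
have := sqY_obound n u; have /andP[a1 a2] := sqy01 n; have /andP[b1 b2] := sqy01 n.+1.
have := sqyS n; have -> : sqy n.+2 - sqy n.+1 = (sqy n.+1 ^+ 2 - sqy n ^+ 2) / 2.
  by rewrite /=; ring.
have := nrm_ge0 u; have := nrm_ge0 (sqY n u).
move: (nrm (sqY n.+1 (sqY n.+1 u - sqY n u) + (sqY n.+1 (sqY n u) - sqY n (sqY n u)))) => s.
move: (nrm (sqY n.+1 (sqY n.+1 u - sqY n u))) (nrm (sqY n.+1 (sqY n u) - sqY n (sqY n u))) => p q.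
move: (nrm (sqY n.+1 u - sqY n u)) (nrm (sqY n u)) => t r.
move: (sqy n.+1) (sqy n) a1 a2 b1 b2 => y x a1 a2 b1 b2 h1 h2 h3 h4 h5 h6 h7 h8.
have k1 : (y - x) * r <= (y - x) * (x * nrm u) by rewrite ler_wpM2l // subr_ge0.
have k2 : y * t <= y * ((y - x) * nrm u) by rewrite ler_wpM2l.
have -> : (y ^+ 2 - x ^+ 2) / 2 * nrm u = 2^-1 * (y * ((y - x) * nrm u) + (y - x) * (x * nrm u)) by field.
rewrite ler_wpM2l ?invr_ge0 //; lra.
Qed.

Let sqY_dif n k u : nrm (sqY (n + k) u - sqY n u) <= (sqy (n + k) - sqy n) * nrm u.
Proof.
elim: k => [|k IH]; first by rewrite addn0 !subrr nrm0 mul0r.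
rewrite addnS (le_trans (nrm_dist _ (sqY (n + k) u) _)) //.
by rewrite -[sqy (n + k).+1 - _](subrKA (sqy (n + k))) mulrDl lerD // sqY_dif1.
Qed.

Let sqy_mono n k : sqy n <= sqy (n + k).
Proof. by elim: k => [|k IH]; rewrite ?addn0 ?lexx // addnS (le_trans IH). Qed.

(** The scalars [sqy] increase and are bounded by 1: once one of them is close to their supremum,
    [sqY_dif] controls all later differences. *)
Let sqY_cauchy u : vcauchy (fun n => sqY n u).
Proof.
pose E := range sqy.
have hE : has_sup E.
  split; first by exists (sqy 0), 0%N.
  by exists 1 => _ [n _ <-]; case/andP: (sqy01 n).
move=> e e0; have n1 : 0 < 2 * (nrm u + 1) by rewrite mulr_gt0 // ltr_wpDl ?nrm_ge0.
have [_ [N _ <-] hN] := sup_adherent (divr_gt0 e0 n1) hE.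
have ub n : sqy n <= sup E by apply: ub_le_sup; [case: hE | exists n].
have h i : (N <= i)%N -> nrm (sqY i u - sqY N u) < e / 2.
  move=> iN; rewrite -(subnKC iN); apply: le_lt_trans (sqY_dif _ _ _) _.
  set k := (i - N)%N.
  apply: (@le_lt_trans _ _ ((sqy (N + k) - sqy N) * (nrm u + 1))).
    by rewrite ler_wpM2l ?lerDl // subr_ge0 sqy_mono.
  rewrite -ltr_pdivlMr ?ltr_wpDl ?nrm_ge0 //.
  have := ub (N + k)%N; rewrite -mulrA -invfM => h1.
  by rewrite ltrBlDr (le_lt_trans h1) // addrC -ltrBlDr.
exists N => i j iN jN; rewrite (le_lt_trans (nrm_dist _ (sqY N u) _)) // [e]splitr ltrD ?h //.
by rewrite nrmBC h.
Qed.

(** The limit [Y] satisfies 2 Y = D + Y^2, so that (1 - Y)^2 = 1 - D; positivity comes from |Y| <=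
    1. The commutation clause is kept for the uniqueness of the root, which is proved for commuting
    roots. *)
Lemma sqrt_one_minus : exists S, [/\ bop S, pos S,
  forall u, S (S u) = u - D u
  & forall T, bop T -> (forall u, T (D u) = D (T u)) -> forall u, T (S u) = S (T u)].
Proof.
have [|Y [lY bY hY]] := @op_lim _ _ sqY 1 sqY_lin _ sqY_cauchy.
  move=> n u; apply: le_trans (sqY_obound n u) _.
  by rewrite ler_wpM2r ?nrm_ge0 //; case/andP: (sqy01 n).
have YE u : Y u = (2^-1)%:C *: (D u + Y (Y u)).
  apply: vconv_unique (vconvS (hY u)) _ => /=; apply: vconvZ; apply: vconvD.
    exact: vconv_cst.
  move=> e e0; have [N hN] := hY u _ (half_gt0 e0); have [M hM] := hY (Y u) _ (half_gt0 e0).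
  exists (maxn N M) => i; rewrite geq_max => /andP[iN iM].
  rewrite (le_lt_trans (nrm_dist _ (sqY i (Y u)) _)) // [e]splitr ltrD ?hM // -islinB //.
  apply: le_lt_trans (sqY_obound _ _) _; apply: le_lt_trans (hN _ iN).
  by rewrite -[leRHS]mul1r ler_wpM2r ?nrm_ge0 //; case/andP: (sqy01 i).
have sY : selfadj Y.
  move=> u v; apply: cconv_unique (cconv_ip (hY u) (vconv_cst v)) _.
  have -> : (fun n => ip (sqY n u) v) = (fun n => ip u (sqY n v)).
    by apply/funext => n; rewrite sqY_self.
  exact: cconv_ip (vconv_cst u) (hY v).
exists (fun u => u - Y u); split.
- by apply: bopB; [exact: bop_id|split => //; exists 1].
- move=> u; rewrite ipBl; apply: ReIm_ge0; rewrite ?ReB ?ImB.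
    rewrite subr_ge0 -nrm_sq (le_trans (Re_le_normc _)) // (le_trans (cauchy_schwarz _ _)) //.
    by rewrite expr2 ler_wpM2r ?nrm_ge0 // -[leRHS]mul1r.
  case/ge0_ReIm: (ipuu_ge0 u) => _ ->; have := congr1 (@Im R) (ipC (Y u) u).
  by rewrite ImJ -sY; lra.
- move=> u; rewrite islinB //.
  have h : Y u + Y u = D u + Y (Y u).
    rewrite {1 2}YE -scalerDl -rcD.
    have -> : (2^-1 + 2^-1 : R) = 1 by lra.
    by rewrite scale1r.
  transitivity (u - (Y u + Y u) + Y (Y u)).
    by rewrite opprB opprD !addrA addrAC.
  by rewrite h opprD addrA subrK.
- move=> T bT hT u; have lT := bop_lin bT; rewrite islinB //; congr (_ - _).
  apply: vconv_unique (bop_conv bT (hY u)) _.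
  have -> : T \o (fun n => sqY n u) = (fun n => sqY n (T u)).
    by apply/funext => n /=; rewrite sqY_comm.
  exact: hY.
Qed.
End sqrt_iteration.

Lemma scaled_complement T (c : R) : islin T -> pos T -> 0 < c -> obound T c ->
  let D := fun u => u - (c^-1)%:C *: T u in
  [/\ islin D, selfadj D, pos D & obound D 1].
Proof.
move=> lT pT c0 bT D; have sT := pos_selfadj lT pT.
have lD : islin D.
  by move=> a u v; rewrite /D lT scalerDr opprD addrACA scalerBr scalerA mulrC -scalerA.
have sD : selfadj D.
  by move=> u v; rewrite /D ipBl ipBr ipZl ipZr conjc_rc sT.
have ED u : ip (D u) u = ip u u - (c^-1)%:C * ip (T u) u by rewrite ipBl ipZl.
have pD : pos D.
  move=> u; rewrite ED (ip_pos_real u pT) ipuu -rcM -rcB ler0c subr_ge0.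
  rewrite -(ler_pM2l c0) mulVKf ?gt_eqF // (le_trans (Re_le_normc _)) //.
  by rewrite (le_trans (cauchy_schwarz _ _)) // expr2 mulrA ler_wpM2r ?nrm_ge0.
split => //; apply: pos_obound => // u; rewrite mul1r nrm_sq ED ReB gerBl.
by rewrite (ip_pos_real u pT) -rcM Re_rc mulr_ge0 //; [rewrite invr_ge0 ltW|case/ge0_ReIm: (pT u)].
Qed.

Lemma bop_pos_bound T : bop T -> exists c : R, 0 < c /\ obound T c.
Proof.
move=> [lT [c [c0 hc]]]; exists (c + 1); split; first by rewrite ltr_wpDl.
by move=> u; rewrite (le_trans (hc u)) // ler_wpM2r ?nrm_ge0 // lerDl.
Qed.

Lemma sqrt_ex B : bop B -> pos B -> exists S, [/\ bop S, pos S, S \o S = B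
  & forall T, bop T -> T \o B = B \o T -> T \o S = S \o T].
Proof.
move=> bB pB; have lB := bop_lin bB; have [c [c0 hc]] := bop_pos_bound bB.
have [lD sD pD D1] := scaled_complement lB pB c0 hc.
have [S [bS pS SE SC]] := sqrt_one_minus lD sD D1.
have lS := bop_lin bS.
exists (fun u => (Num.sqrt c)%:C *: S u); split.
- exact: bopZ.
- by move=> u; rewrite ipZl mulr_ge0 ?ler0c ?sqrtr_ge0.
- apply/funext => u /=; rewrite islinZ // SE subKr !scalerA -!rcM ?mulrA -expr2.
  by rewrite sqr_sqrtr ?ltW // divff ?gt_eqF // scale1r.
- move=> T bT hT.
  apply/funext => u /=; have lT := bop_lin bT; rewrite islinZ // SC // => v.
  by rewrite islinB // islinZ //; have := congr1 (@^~ v) hT => /= ->.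
Qed.

(** For w = (A - S) u, commutation gives (A + S) w = 0, so both positive forms vanish at w and A w =
    S w = 0; then |w|^2 = <u, (A - S) w> = 0. *)
Lemma sqrt_uniq A S : bop A -> pos A -> bop S -> pos S ->
  A \o A = S \o S -> A \o S = S \o A -> A = S.
Proof.
move=> bA pA bS pS hAS hc; have lA := bop_lin bA; have lS := bop_lin bS.
have sA := pos_selfadj lA pA; have sS := pos_selfadj lS pS.
apply/funext => u; set w := A u - S u.
have h : ip (A w) w + ip (S w) w = 0.
  rewrite -ipDl /w (islinB lA) (islinB lS); have <- : A (A u) = S (S u) by have := congr1 (@^~ u) hAS.
  have -> : A (S u) = S (A u) by have := congr1 (@^~ u) hc.
  by rewrite subrKA subrr ip0l.
have [a0 _] := ge0_ReIm (pA w); have [s0 _] := ge0_ReIm (pS w).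
have : Re (ip (A w) w) + Re (ip (S w) w) = 0 by rewrite -ReD h.
move=> h1; have hA : A w = 0 by apply: pos_eq0 => //; lra.
have hS : S w = 0 by apply: pos_eq0 => //; lra.
apply/eqP; rewrite -subr_eq0 -/w; apply/eqP/ipuu_eq0.
by rewrite {1}/w ipBl sA sS hA hS ip0r subrr.
Qed.

Definition absV T : V -> V :=
  xget T [set A | [/\ bop A, pos A & A \o A = adjV T \o T]].

Lemma adj_comp_pos T : bop T -> pos (adjV T \o T).
Proof. by move=> bT u /=; rewrite ip_adjl // ipuu_ge0. Qed.

Lemma absVP T : bop T -> [/\ bop (absV T), pos (absV T) & absV T \o absV T = adjV T \o T].
Proof.
move=> bT; have [S [h1 h2 h3 h4]] := sqrt_ex (bop_comp (adjV_bop bT) bT) (adj_comp_pos bT).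
by rewrite /absV; case: xgetP => [? _ //|/(_ S)[]].
Qed.

(** Any positive root [A] commutes with B = A^2, hence with the root given by [sqrt_ex]; the two are
    therefore equal, and [A] inherits the commutation property of the latter. *)
Lemma pos_sqrt_comm A B T : bop A -> pos A -> A \o A = B -> bop T ->
  T \o B = B \o T -> T \o A = A \o T.
Proof.
move=> bA pA AB bT hT.
have bB : bop B by rewrite -AB; exact: bop_comp.
have pB : pos B by rewrite -AB; apply/selfadj_comp_pos/pos_selfadj => //; exact: bop_lin.
have [S [bS pS SB SC]] := sqrt_ex bB pB.
suff -> : A = S by exact: SC.
apply: sqrt_uniq => //; first by rewrite AB SB.
by apply: SC => //; rewrite -AB.
Qed.

Lemma absV_uniq T A : bop T -> bop A -> pos A -> A \o A = adjV T \o T -> A = absV T.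
Proof.
move=> bT bA pA h; have [bS pS hS] := absVP bT.
apply: sqrt_uniq => //; first by rewrite h.
by apply: (pos_sqrt_comm bS pS hS) => //; rewrite -h.
Qed.

Lemma nrm_absV T u : bop T -> nrm (absV T u) = nrm (T u).
Proof.
move=> bT; have [bA pA hA] := absVP bT.
congr Num.sqrt; rewrite -(pos_selfadj (bop_lin bA) pA) -ip_adjl //.
by congr (Re (ip _ _)); have := congr1 (@^~ u) hA.
Qed.

(* With C = 1 - A / c one has A h_N = 1 - C^N for h_N = c^-1 sum_(j < N) C^j:
   h_N plays the role of the (unbounded) inverse of A. *)
Section approximate_inverse.
Variables (A : V -> V) (c : R).
Hypotheses (bA : bop A) (pA : pos A) (c0 : 0 < c) (Ac : obound A c).

Definition cplt u := u - (c^-1)%:C *: A u.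
Definition happ N u := \sum_(0 <= j < N) (c^-1)%:C *: iter j cplt u.

Let lA := bop_lin bA.
Let sA := pos_selfadj lA pA.

Lemma cpltP : [/\ islin cplt, selfadj cplt, pos cplt & obound cplt 1].
Proof. exact: scaled_complement. Qed.

Lemma cplt_bop : bop cplt.
Proof. by have [h _ _ h1] := cpltP; split => //; exists 1. Qed.

Lemma iter_cplt_bound N u : nrm (iter N cplt u) <= nrm u.
Proof.
elim: N => //= N IH; have [_ _ _ h1] := cpltP.
by rewrite (le_trans _ IH) // -[leRHS]mul1r.
Qed.

Lemma iter_cplt_self N : selfadj (iter N cplt).
Proof.
elim: N => [|N IH] u v //; have [_ h _ _] := cpltP.
by rewrite iterS h IH -iterSr.
Qed.

Lemma happ_bop N : bop (happ N).
Proof.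
rewrite /happ; apply: bop_sum => j; apply: bopZ; apply: bop_iter; exact: cplt_bop.
Qed.

Lemma cplt_comm T : islin T -> (forall u, T (A u) = A (T u)) ->
  forall u, T (cplt u) = cplt (T u).
Proof. by move=> lT h u; rewrite /cplt islinB // islinZ // h. Qed.

Lemma iter_cplt_comm T : islin T -> (forall u, T (A u) = A (T u)) ->
  forall N u, T (iter N cplt u) = iter N cplt (T u).
Proof. by move=> lT h; elim=> //= N IH u; rewrite cplt_comm // IH. Qed.

Lemma happ_comm T : islin T -> (forall u, T (A u) = A (T u)) ->
  forall N u, T (happ N u) = happ N (T u).
Proof.
move=> lT h N u; rewrite /happ islin_sum //; apply: eq_bigr => j _.
by rewrite islinZ // iter_cplt_comm.
Qed.

Lemma A_happ N u : A (happ N u) = u - iter N cplt u.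
Proof.
elim: N => [|N IH]; first by rewrite /happ big_geq //= subrr islin0.
rewrite /happ big_nat_recr //= islinD // -/(happ N u) IH islinZ // /cplt.
by rewrite opprD opprK addrA.
Qed.

Lemma happ_self N : selfadj (happ N).
Proof.
move=> u v; rewrite /happ ip_suml ip_sumr; apply: eq_bigr => j _.
by rewrite ipZl ipZr conjc_rc iter_cplt_self.
Qed.

(** Operator form of x (1 - x / c)^N <= c / (N + 1) on [0, c]. With C = [cplt], the numbers g_j = <A
    C^j u, u> are nonincreasing, and g_0 + ... + g_N = c (|u|^2 - <C^(N+1) u, u>) is at most c
    |u|^2. *)
Lemma A_cplt_bound N : obound (A \o iter N cplt) (c / N.+1%:R).
Proof.
have [lC sC pC C1] := cpltP.
(* The roots [q] of [cplt] and [r] of [A] turn g_n into |q^n (r u)|^2, whose monotonicity follows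
   from |q| <= 1. *)
have [q [bq pq qC qcomm]] := sqrt_ex cplt_bop pC.
have [r [br pr rA rcomm]] := sqrt_ex bA pA.
have sq := pos_selfadj (bop_lin bq) pq; have sr := pos_selfadj (bop_lin br) pr.
have lr := bop_lin br.
have q1 u : nrm (q u) <= nrm u.
  rewrite -(@ler_pXn2r _ 2) ?nnegrE ?nrm_ge0 // nrm_sq sq.
  rewrite -[q (q u)]/((q \o q) u) qC (le_trans (Re_le_normc _)) //.
  by rewrite (le_trans (cauchy_schwarz _ _)) // expr2 ler_wpM2l ?nrm_ge0 // -[leRHS]mul1r.
have rC u : r (cplt u) = cplt (r u).
  have hr : r \o A = A \o r by rewrite -rA.
  by apply: cplt_comm => // v; exact: (congr1 (@^~ v) hr).
have ipCN n w : ip (iter n cplt w) w = ip (iter n q w) (iter n q w).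
  have -> : iter n cplt w = iter n q (iter n q w).
    elim: n w => // n IH w; rewrite iterSr IH -qC /=.
    have qn x : q (iter n q x) = iter n q (q x) by rewrite -iterS iterSr.
    by rewrite !qn.
  have qs k x y : ip (iter k q x) y = ip x (iter k q y).
    by elim: k x y => // k IH x y; rewrite iterS sq IH -iterSr.
  exact: qs.
have AN n u : ip (A (iter n cplt u)) u = ip (iter n cplt (r u)) (r u).
  rewrite -rA /= sr; congr (ip _ _).
  by elim: n => //= k <-; rewrite rC.
have pAN : pos (A \o iter N cplt) by move=> u; rewrite /= AN ipCN ipuu_ge0.
have lAN : islin (A \o iter N cplt).
  by apply/bop_lin/bop_comp => //; apply/bop_iter/cplt_bop.
apply: pos_obound => //; first by rewrite divr_ge0 // ltW.
move=> u; set g := fun n => Re (ip (A (iter n cplt u)) u).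
have gE n : g n = nrm (iter n q (r u)) ^+ 2 by rewrite /g AN ipCN -nrm_sq.
have gS n : g n.+1 <= g n.
  by rewrite !gE /= ler_pXn2r ?nnegrE ?nrm_ge0.
have gmono n k : g (n + k)%N <= g n.
  by elim: k => [|k IH]; rewrite ?addn0 // addnS (le_trans (gS _)).
have gsum : \sum_(0 <= j < N.+1) g j <= c * nrm u ^+ 2.
  have -> : \sum_(0 <= j < N.+1) g j = c * Re (ip (A (happ N.+1 u)) u).
    rewrite /happ islin_sum // ip_suml Re_sum mulr_sumr; apply: eq_bigr => j _.
    by rewrite islinZ // ipZl ReM Re_rc /= mul0r subr0 mulVKf ?gt_eqF.
  rewrite A_happ ipBl ReB -nrm_sq ler_pM2l // gerBl ipCN.
  by case/ge0_ReIm: (ipuu_ge0 (iter N.+1 q u)).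
rewrite /= -/(g N) mulrAC ler_pdivlMr //; apply: le_trans gsum.
have -> : g N * N.+1%:R = \sum_(0 <= j < N.+1) g N.
  by rewrite big_const_nat subn0 iter_addr addr0 mulr_natr.
rewrite big_nat [leRHS]big_nat; apply: ler_sum => j /andP[_ jN].
by rewrite -(subnKC (jN : (j <= N)%N)).
Qed.

End approximate_inverse.
End positive.

(** * Summable families and orthonormal bases *)

Section finite_sums.
Context {R : realType}.

Lemma big_fset_split (I : choiceType) (W : zmodType) (A B : {fset I}) (F : I -> W) :
  fsubset A B -> \sum_(i <- B) F i = \sum_(i <- A) F i + \sum_(i <- (B `\` A)%fset) F i.
Proof.
move=> AB; rewrite -big_cat /=; apply: perm_big; apply: uniq_perm.
- exact: fset_uniq.
- rewrite cat_uniq !fset_uniq /= andbT; apply/hasPn => i /=.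
  by rewrite in_fsetD => /andP[].
- move=> i; rewrite mem_cat in_fsetD; case iA : (i \in A) => //=.
  by rewrite (fsubsetP AB).
Qed.

Lemma quad_disc (a r b : R) : (forall t : R, 0 <= a - 2 * t * r + t ^+ 2 * b) ->
  0 <= b -> r ^+ 2 <= a * b.
Proof.
move=> h b0.
have a0 : 0 <= a by have := h 0; rewrite expr0n /=; lra.
have [bz|bn] := eqVneq b 0.
  have [->|rn] := eqVneq r 0; first by rewrite expr0n /= mulr_ge0.
  have := h ((a + 1) / (2 * r)); rewrite bz mulr0 addr0.
  have -> : 2 * ((a + 1) / (2 * r)) * r = a + 1 by field.
  lra.
have bp : 0 < b by rewrite lt_def bn.
have := h (r / b).
have -> : a - 2 * (r / b) * r + (r / b) ^+ 2 * b = (a * b - r ^+ 2) / b by field.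
by rewrite pmulr_lge0 ?invr_gt0 // subr_ge0.
Qed.

Lemma sum_cs (I : Type) (r : seq I) (a b : I -> R) :
  (\sum_(i <- r) a i * b i) ^+ 2 <= (\sum_(i <- r) a i ^+ 2) * (\sum_(i <- r) b i ^+ 2).
Proof.
apply: quad_disc; last by apply: sumr_ge0 => i _; exact: sqr_ge0.
move=> t; apply: (@le_trans _ _ (\sum_(i <- r) (a i - t * b i) ^+ 2)).
  by apply: sumr_ge0 => i _; exact: sqr_ge0.
rewrite le_eqVlt; apply/orP; left; apply/eqP.
rewrite mulr_sumr mulr_sumr -sumrB -big_split /=; apply: eq_bigr => i _; ring.
Qed.

Lemma sum_cs_le (I : Type) (r : seq I) (a b : I -> R) (x y : R) :
  0 <= x -> 0 <= y ->
  \sum_(i <- r) a i ^+ 2 <= x ^+ 2 -> \sum_(i <- r) b i ^+ 2 <= y ^+ 2 ->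
  \sum_(i <- r) a i * b i <= x * y.
Proof.
move=> x0 y0 ha hb; apply: le_trans (ler_norm _) _.
rewrite -(@ler_pXn2r _ 2) ?nnegrE ?mulr_ge0 // real_normK ?num_real // exprMn.
apply: le_trans (sum_cs _ _ _) _; apply: ler_pM => //; apply: sumr_ge0 => i _; exact: sqr_ge0.
Qed.

(** Shares an error [d] among the terms of [s]; the successor keeps the denominator positive when
    [s] is empty. *)
Lemma sum_avg (I : Type) (s : seq I) (d : R) : 0 < d ->
  \sum_(i <- s) d / (size s).+1%:R <= d.
Proof.
move=> d0; rewrite big_const_seq count_predT iter_addr addr0 -[leLHS]mulr_natr.
rewrite mulrAC ler_pdivrMr ?ltr0n // ler_wpM2l ?(ltW d0) // ler_nat leqnSn //.
Qed.

Lemma frac_le (x y : R) : 0 <= x -> 0 <= y -> x / (y + 1) * y <= x.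
Proof.
move=> x0 y0; rewrite mulrAC ler_pdivrMr ?ltr_wpDl // ler_wpM2l // lerDl //.
Qed.

(** [A] nearly attains the supremum of the finite sums, so a finite set disjoint from [A] can add
    little to it. *)
Lemma sum_tail (I : choiceType) (a : I -> R) (M : R) : (forall i, 0 <= a i) ->
  (forall B : {fset I}, \sum_(i <- B) a i <= M) ->
  forall e : R, 0 < e -> exists A : {fset I}, forall B : {fset I},
    (forall i, i \in B -> i \notin A) -> \sum_(i <- B) a i < e.
Proof.
move=> a0 aM e e0; pose E := range (fun B : {fset I} => \sum_(i <- B) a i).
have hE : has_sup E.
  split; first by exists (\sum_(i <- (fset0 : {fset I})) a i); exists fset0.
  by exists M => _ [B _ <-].
have [_ [A _ <-] hA] := sup_adherent e0 hE; exists A => B dB.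
have : \sum_(i <- (A `|` B)%fset) a i <= sup E by apply: ub_le_sup; [case: hE | exists (A `|` B)%fset].
rewrite (big_fset_split _ (fsubsetUl A B)).
have -> : ((A `|` B) `\` A)%fset = B.
  apply/fsetP => i; rewrite in_fsetD in_fsetU; case iB : (i \in B).
    by rewrite (dB _ iB) orbT.
  by rewrite orbF; case: (i \in A).
move: hA; set x := \sum_(i <- A) a i; set y := \sum_(i <- B) a i; lra.
Qed.

Lemma common_net (I : choiceType) (J : eqType) (P : J -> {fset I} -> Prop) :
  (forall j, exists A : {fset I}, forall B, fsubset A B -> P j B) ->
  forall r : seq J, exists A : {fset I}, forall B, fsubset A B -> forall j, j \in r -> P j B.
Proof.
move=> h; elim=> [|j r [A hA]]; first by exists fset0.
have [A' hA'] := h j; exists (A `|` A')%fset => B sB k; rewrite inE => /orP[/eqP ->|kr].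
  by apply: hA'; apply: fsubset_trans sB; exact: fsubsetUr.
by apply: hA => //; apply: fsubset_trans sB; exact: fsubsetUl.
Qed.

Lemma real_cauchy (x : nat -> R) :
  (forall e : R, 0 < e -> exists N, forall i j, (N <= i)%N -> (N <= j)%N -> `|x i - x j| < e) ->
  exists l, forall e : R, 0 < e -> exists N, forall i, (N <= i)%N -> `|x i - l| < e.
Proof.
(* [E] is the set of eventual lower bounds of the sequence, so the limit is produced as a limit
   inferior. *)
move=> hx; pose E := [set y | exists N, forall i, (N <= i)%N -> y <= x i]%classic.
have ub e : 0 < e -> exists N, (x N - e \in E) /\ (forall y, E y -> y <= x N + e) /\
    forall i, (N <= i)%N -> `|x i - x N| < e.
  move=> e0; have [N hN] := hx e e0; exists N; split; last split.
  - rewrite inE; exists N => i iN; have := hN i N iN (leqnn N); rewrite ltr_norml; lra.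
  - move=> y [M hM]; have := hM _ (leq_maxl M N); have := hN _ N (leq_maxr M N) (leqnn N).
    rewrite ltr_norml; lra.
  - by move=> i iN; apply: hN.
have hE : has_sup E.
  have [N [h1 [h2 _]]] := ub 1 ltr01.
  by split; [exists (x N - 1); rewrite inE in h1 | exists (x N + 1)].
exists (sup E) => e e0; have [N [h1 [h2 h3]]] := ub _ (half_gt0 (half_gt0 e0)).
rewrite inE in h1; have k1 : x N - e / 2 / 2 <= sup E by apply: ub_le_sup; [case: hE|].
have k2 : sup E <= x N + e / 2 / 2 by apply: sup_le_ub; [case: hE|exact: h2].
exists N => i iN; have := h3 i iN; rewrite !ltr_norml; lra.
Qed.

Lemma ccauchy (z : nat -> R[i]) :
  (forall e : R, 0 < e -> exists N, forall i j, (N <= i)%N -> (N <= j)%N -> normc (z i - z j) < e) ->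
  exists l, cconv z l.
Proof.
move=> hz.
have [a ha] : exists a, forall e : R, 0 < e -> exists N, forall i, (N <= i)%N -> `|Re (z i) - a| < e.
  apply: real_cauchy => e e0; have [N hN] := hz e e0; exists N => i j iN jN.
  by rewrite -ReB (le_lt_trans (absRe_le_normc _)) // hN.
have [b hb] : exists b, forall e : R, 0 < e -> exists N, forall i, (N <= i)%N -> `|Im (z i) - b| < e.
  apply: real_cauchy => e e0; have [N hN] := hz e e0; exists N => i j iN jN.
  by rewrite -ImB (le_lt_trans (Im_le_normc _)) // hN.
exists (a +i* b) => e e0; have [N hN] := ha _ (half_gt0 e0); have [M hM] := hb _ (half_gt0 e0).
exists (maxn N M) => i; rewrite geq_max => /andP[iN iM].
rewrite (le_lt_trans (normc_le_ReIm _)) // [e]splitr ReB ImB ltrD //; first exact: hN.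
exact: hM.
Qed.

End finite_sums.

(** * Unconditional summation of vectors *)

Section summable_families.
Context {R : realType} {V : hspace R}.
Implicit Types (u v w : V) (T : V -> V).

Definition vsums (I : choiceType) (f : I -> V) (s : V) : Prop :=
  forall e : R, 0 < e -> exists A : {fset I}, forall B : {fset I}, fsubset A B ->
    nrm (\sum_(i <- B) f i - s) < e.

Definition csums (I : choiceType) (f : I -> R[i]) (s : R[i]) : Prop :=
  forall e : R, 0 < e -> exists A : {fset I}, forall B : {fset I}, fsubset A B ->
    normc (\sum_(i <- B) f i - s) < e.

(** Completeness is stated for sequences. The finite sets associated with the precisions 1 / (n + 1)
    are accumulated into an increasing sequence [C], whose limit is that of the whole net. *)
Lemma vnet (I : choiceType) (F : {fset I} -> V) :
  (forall e : R, 0 < e -> exists A, forall B, fsubset A B -> nrm (F B - F A) < e) ->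
  exists l, forall e : R, 0 < e -> exists A, forall B, fsubset A B -> nrm (F B - l) < e.
Proof.
move=> hF.
have /choice[A hA] : forall n, exists A, forall B, fsubset A B -> nrm (F B - F A) < n.+1%:R^-1.
  by move=> n; apply: hF; rewrite invr_gt0.
pose C := fix C n := if n is m.+1 then (C m `|` A n)%fset else A 0%N.
have CS n k : fsubset (C n) (C (n + k)%N).
  elim: k => [|k IH]; first by rewrite addn0 fsubset_refl.
  by rewrite addnS (fsubset_trans IH) //= fsubsetUl.
have AC n : fsubset (A n) (C n) by case: n => [|n] /=; rewrite ?fsubset_refl ?fsubsetUr.
have near n B : fsubset (C n) B -> nrm (F B - F (C n)) < 2 * n.+1%:R^-1.
  move=> CB; rewrite (le_lt_trans (nrm_dist _ (F (A n)) _)) // mulr_natl mulr2n ltrD //.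
    by apply: hA; apply: fsubset_trans CB.
  by rewrite nrmBC; apply: hA.
have sm (e : R) : 0 < e -> exists n, 2 * n.+1%:R^-1 < e.
  move=> e0; have [N hN] := inv_small (half_gt0 e0); exists N.
  by have := hN N (leqnn N); rewrite ltr_pdivlMr // mulrC.
have cC : vcauchy (fun n => F (C n)).
  move=> e e0; have [n hn] := sm _ (half_gt0 e0); exists n => i j ni nj.
  rewrite (le_lt_trans (nrm_dist _ (F (C n)) _)) // [e]splitr ltrD ?(lt_trans _ hn) //.
    by apply: near; rewrite -(subnKC ni).
  by rewrite nrmBC; apply: near; rewrite -(subnKC nj).
have [l hl] := vcauchyP cC; exists l => e e0.
have [n hn] := sm _ (half_gt0 (half_gt0 e0)); have [N hN] := hl _ (half_gt0 e0).
exists (C n) => B CB; pose i := maxn n N.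
have h1 := near n B CB; have h2 := hN i (leq_maxr _ _).
have h3 : nrm (F (C i) - F (C n)) < 2 * n.+1%:R^-1.
  by apply: near; rewrite -(subnKC (leq_maxl n N : (n <= i)%N)).
have := nrm_dist (F B) (F (C n)) l; have := nrm_dist (F (C n)) (F (C i)) l.
rewrite (nrmBC (F (C n)) (F (C i))); have := lt_trans h1 hn; have := lt_trans h3 hn; lra.
Qed.

Lemma vsums_net (I : choiceType) (f : I -> V) :
  (forall e : R, 0 < e -> exists A : {fset I}, forall B : {fset I},
     (forall i, i \in B -> i \notin A) -> nrm (\sum_(i <- B) f i) < e) ->
  exists s, vsums f s.
Proof.
move=> h; have [|l hl] := @vnet I (fun B => \sum_(i <- B) f i); last by exists l.
move=> e e0; have [A hA] := h e e0; exists A => B AB.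
rewrite (big_fset_split _ AB) addrAC subrr add0r; apply: hA => i.
by rewrite in_fsetD => /andP[].
Qed.

Lemma vsums_abs (I : choiceType) (f : I -> V) (a : I -> R) (M : R) :
  (forall i, nrm (f i) <= a i) ->
  (forall B : {fset I}, \sum_(i <- B) a i <= M) -> exists s, vsums f s.
Proof.
move=> fa h; apply: vsums_net => e e0.
have a0 i : 0 <= a i by apply: le_trans (fa i); exact: nrm_ge0.
have [A hA] := sum_tail a0 h e0; exists A => B /hA; apply: le_lt_trans.
by apply: le_trans (nrm_sum _ _ _) _; apply: ler_sum.
Qed.

Lemma vsums_unique (I : choiceType) (f : I -> V) s t : vsums f s -> vsums f t -> s = t.
Proof.
move=> hs ht; apply/eqP; rewrite -subr_eq0; apply/eqP/nrm_small => e e0.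
have [A hA] := hs _ (half_gt0 e0); have [B hB] := ht _ (half_gt0 e0).
have := hA _ (fsubsetUl A B); have := hB _ (fsubsetUr A B).
set x := \sum_(i <- _) f i => h1 h2.
rewrite (le_trans (nrm_dist _ x _)) // [leRHS]splitr lerD // ltW //.
by rewrite nrmBC.
Qed.

Lemma csums_unique (I : choiceType) (f : I -> R[i]) s t : csums f s -> csums f t -> s = t.
Proof.
move=> hs ht; apply/eqP; rewrite -subr_eq0; apply/eqP/Normc.eq0_normc.
apply/eqP; rewrite eq_le normc_ge0 andbT; apply/ler_addgt0Pr => e e0; rewrite add0r.
have [A hA] := hs _ (half_gt0 e0); have [B hB] := ht _ (half_gt0 e0).
have := hA _ (fsubsetUl A B); have := hB _ (fsubsetUr A B).
set x := \sum_(i <- _) f i => h1 h2.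
rewrite -[s - t](subrKA x) (le_trans (le_normcD _ _)) // [leRHS]splitr lerD // ltW //.
by rewrite normcBC.
Qed.

Lemma vsums_bop (I : choiceType) (f : I -> V) s T : bop T -> vsums f s -> vsums (T \o f) (T s).
Proof.
move=> bT hs e e0; have [c [c0 hc]] := bop_pos_bound bT; have lT := bop_lin bT.
have [A hA] := hs _ (divr_gt0 e0 c0); exists A => B AB.
rewrite -islin_sum // -islinB // (le_lt_trans (hc _)) // mulrC -ltr_pdivlMr // hA //.
Qed.

Lemma csums_ipl (I : choiceType) (f : I -> V) s w : vsums f s -> csums (fun i => ip (f i) w) (ip s w).
Proof.
move=> hs e e0.
have K : 0 < nrm w + 1 by rewrite ltr_wpDl // nrm_ge0.
have [A hA] := hs _ (divr_gt0 e0 K); exists A => B AB.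
rewrite -ip_suml -ipBl (le_lt_trans (cauchy_schwarz _ _)) //.
apply: (@le_lt_trans _ _ (nrm (\sum_(i <- B) f i - s) * (nrm w + 1))).
  by rewrite ler_wpM2l ?nrm_ge0 // lerDl.
by rewrite -ltr_pdivlMr // hA.
Qed.

Lemma vsums_le (I : choiceType) (f : I -> V) s (c : R) : vsums f s ->
  (forall B : {fset I}, nrm (\sum_(i <- B) f i) <= c) -> nrm s <= c.
Proof.
move=> hs hc; apply/ler_addgt0Pr => e e0; have [A hA] := hs e e0.
apply: le_trans (nrm_leD s (\sum_(i <- A) f i)) _; rewrite lerD // nrmBC ltW // hA // fsubset_refl.
Qed.

Lemma vsums_lin (I : choiceType) (f g : I -> V) s t (a : R[i]) :
  vsums f s -> vsums g t -> vsums (fun i => a *: f i + g i) (a *: s + t).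
Proof.
move=> hf hg e e0; have K : 0 < normc a + 1 by rewrite ltr_wpDl // normc_ge0.
have [A hA] := hf _ (divr_gt0 (half_gt0 e0) K); have [B hB] := hg _ (half_gt0 e0).
exists (A `|` B)%fset => C AC.
rewrite big_split /= -scaler_sumr opprD addrACA -scalerBr (le_lt_trans (nrmD _ _)) // [e]splitr ltrD //.
  rewrite nrmZ; have := hA C (fsubset_trans (fsubsetUl _ _) AC); rewrite ltr_pdivlMr //.
  apply: le_lt_trans; rewrite mulrC ler_wpM2l ?nrm_ge0 // lerDl //.
by apply: hB; exact: fsubset_trans (fsubsetUr _ _) AC.
Qed.

Lemma vsums_sq_le (I : choiceType) (f : I -> V) s : vsums f s ->
  forall e : R, 0 < e -> exists A : {fset I}, forall B, fsubset A B ->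
    nrm s ^+ 2 <= nrm (\sum_(i <- B) f i) ^+ 2 + e.
Proof.
move=> hs e e0; have K : 0 < 2 * (nrm s + 1) by rewrite mulr_gt0 // ltr_wpDl // nrm_ge0.
have [A hA] := hs _ (divr_gt0 e0 K); exists A => B AB.
have := hA B AB; have := nrm_leD s (\sum_(i <- B) f i); rewrite (nrmBC s) ltr_pdivlMr //.
have := nrm_ge0 (\sum_(i <- B) f i); have := nrm_ge0 s; have := nrm_ge0 (\sum_(i <- B) f i - s).
move: (nrm _) (nrm s) (nrm (_ - s)) => y x d d0 x0 y0 h1 h2.
have [xy|yx] := leP x y; first by rewrite -[leLHS]addr0 lerD ?(ltW e0) // lerXn2r.
have h3 : x ^+ 2 - y ^+ 2 = (x - y) * (x + y) by ring.
have h4 : (x - y) * (x + y) <= d * (2 * (x + 1)).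
  apply: ler_pM; lra.
lra.
Qed.

End summable_families.

(** * Orthonormal bases, Bessel families, Hilbert-Schmidt estimates *)

Section orthonormal.
Context {R : realType} {V : hspace R}.
Implicit Types (u v w : V) (T : V -> V).

Definition ons (I : choiceType) (e : I -> V) := forall i j, ip (e i) (e j) = (i == j)%:R.
Definition onb (I : choiceType) (e : I -> V) :=
  ons e /\ forall u, (forall i, ip u (e i) = 0) -> u = 0.

Section families.
Variables (I : choiceType) (e : I -> V).
Hypothesis oe : ons e.

Lemma ip_sum_ons (r : seq I) (c : I -> R[i]) j : uniq r ->
  ip (\sum_(i <- r) c i *: e i) (e j) = if j \in r then c j else 0.
Proof.
move=> ur; rewrite ip_suml.
rewrite (eq_bigr (fun i => if i == j then c i else 0)); last first.
  by move=> i _; rewrite ipZl oe; case: eqP => _; rewrite ?mulr1 ?mulr0.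
case: ifP => jr.
  rewrite (bigD1_seq j) //= eqxx big1 ?addr0 // => i /negbTE ->.
  by [].
by rewrite big1_seq // => i /= ir; case: eqP => // ij; rewrite -ij ir in jr.
Qed.

Lemma nrm_sum_ons (r : seq I) (c : I -> R[i]) : uniq r ->
  nrm (\sum_(i <- r) c i *: e i) ^+ 2 = \sum_(i <- r) normc (c i) ^+ 2.
Proof.
move=> ur; rewrite nrm_sq ip_sumr Re_sum; apply: eq_big_seq => i ir.
by rewrite ipZr ip_sum_ons // ir mulrC mulcJ.
Qed.

Lemma nrm_ons i : nrm (e i) = 1.
Proof. by rewrite /nrm oe eqxx /= sqrtr1. Qed.

Lemma nrm_proj (r : seq I) u : uniq r ->
  nrm (u - \sum_(i <- r) ip u (e i) *: e i) ^+ 2 =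
  nrm u ^+ 2 - \sum_(i <- r) normc (ip u (e i)) ^+ 2.
Proof.
move=> ur; rewrite nrmB_sq nrm_sum_ons //.
have -> : Re (ip u (\sum_(i <- r) ip u (e i) *: e i)) = \sum_(i <- r) normc (ip u (e i)) ^+ 2.
  by rewrite ip_sumr Re_sum; apply: eq_bigr => i _; rewrite ipZr mulrC mulcJ.
ring.
Qed.

Lemma bessel_ineq (r : seq I) u : uniq r ->
  \sum_(i <- r) normc (ip u (e i)) ^+ 2 <= nrm u ^+ 2.
Proof. by move=> ur; rewrite -subr_ge0 -nrm_proj // sqr_ge0. Qed.

Lemma ons_sum_ex (c : I -> R[i]) (M : R) :
  (forall B : {fset I}, \sum_(i <- B) normc (c i) ^+ 2 <= M) ->
  exists s, vsums (fun i => c i *: e i) s.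
Proof.
move=> hM; apply: vsums_net => d d0.
have [A hA] := sum_tail (fun i => sqr_ge0 (normc (c i))) hM (exprn_gt0 2 d0).
exists A => B /hA; rewrite -nrm_sum_ons ?fset_uniq //.
by rewrite ltr_pXn2r ?nnegrE ?nrm_ge0 // ltW.
Qed.

Lemma ip_vsums_ons (c : I -> R[i]) s j : vsums (fun i => c i *: e i) s -> ip s (e j) = c j.
Proof.
move=> hs; have h := csums_ipl (e j) hs; apply: csums_unique h _ => d d0.
exists [fset j]%fset => B jB; rewrite -ip_suml ip_sum_ons ?fset_uniq //.
have -> : j \in (B : seq I) by apply: (fsubsetP jB); rewrite in_fset1.
by rewrite subrr Normc.normc0.
Qed.

End families.

Lemma parseval (I : choiceType) (e : I -> V) u : onb e ->
  vsums (fun i => ip u (e i) *: e i) u.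
Proof.
move=> [oe te]; have [B|s hs] := @ons_sum_ex I e oe (fun i => ip u (e i)) (nrm u ^+ 2).
  exact: bessel_ineq.
suff E : u = s by rewrite {2}E.
apply/eqP; rewrite -subr_eq0; apply/eqP/te => i.
by rewrite ipBl (ip_vsums_ons oe _ hs) subrr.
Qed.

Lemma parseval_ip (I : choiceType) (e : I -> V) u v : onb e ->
  csums (fun i => ip u (e i) * ip (e i) v) (ip u v).
Proof.
move=> oe; have := csums_ipl v (parseval u oe).
by congr csums; apply/funext => i; rewrite ipZl.
Qed.

(** Finite families for which Bessel's inequality holds. They generalize finite orthonormal families
    and, unlike these, survive the application of a contraction, by [bessel_gram]. *)
Definition bessel (s : seq V) :=
  forall w, \sum_(v <- s) normc (ip w v) ^+ 2 <= nrm w ^+ 2.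

Lemma bessel_ons (I : choiceType) (e : I -> V) (B : {fset I}) : ons e -> bessel [seq e i | i <- B].
Proof. by move=> oe w; rewrite big_map bessel_ineq // fset_uniq. Qed.

(** If the map from coefficients c to the sum of the c_i f_i is a contraction, so is its adjoint,
    which sends w to the coefficients <w, f_i>. *)
Lemma bessel_gram (I : eqType) (r : seq I) (f : I -> V) :
  (forall c : I -> R[i], nrm (\sum_(i <- r) c i *: f i) ^+ 2 <= \sum_(i <- r) normc (c i) ^+ 2) ->
  bessel [seq f i | i <- r].
Proof.
move=> h w; rewrite big_map; set S := \sum_(i <- r) _.
pose x := \sum_(i <- r) ip w (f i) *: f i.
have hS : S = Re (ip w x).
  by rewrite ip_sumr Re_sum; apply: eq_bigr => i _; rewrite ipZr mulrC mulcJ.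
have S0 : 0 <= S by apply: sumr_ge0 => i _; exact: sqr_ge0.
have hx : nrm x ^+ 2 <= S by exact: h.
have h1 : S <= nrm w * nrm x.
  by rewrite {1}hS (le_trans (Re_le_normc _)) // cauchy_schwarz.
have [->|Sn] := eqVneq S 0; first exact: sqr_ge0.
have Sp : 0 < S by rewrite lt_def Sn.
rewrite -(ler_pM2r Sp) -expr2.
apply: (@le_trans _ _ ((nrm w * nrm x) ^+ 2)).
  by rewrite ler_pXn2r ?nnegrE ?mulr_ge0 ?nrm_ge0.
by rewrite exprMn ler_wpM2l ?sqr_ge0.
Qed.

(** The rank one operator u |-> <u, a> b has trace norm at most |a| |b|, when tested on pairs of
    Bessel families. *)
Lemma bessel_pair (r : seq (V * V)) a b : bessel (map fst r) -> bessel (map snd r) ->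
  \sum_(p <- r) normc (ip p.1 a * ip b p.2) <= nrm a * nrm b.
Proof.
move=> h1 h2; under eq_bigr do rewrite Normc.normcM.
apply: sum_cs_le; rewrite ?nrm_ge0 //; last by have := h2 b; rewrite big_map.
have := h1 a; rewrite big_map; apply: le_trans; apply: ler_sum => p _.
by rewrite ipC normcJ.
Qed.

(** The Hilbert-Schmidt norm can be tested on any Bessel family. Truncating in the basis, both
    before and after [T], leaves finite sums only; exchanging them amounts to passing to T^* and
    back. *)
Lemma hilbert_schmidt (J : choiceType) (e : J -> V) T (M : R) (s : seq V) :
  onb e -> bop T -> (forall B : {fset J}, \sum_(k <- B) nrm (T (e k)) ^+ 2 <= M) ->
  bessel s -> \sum_(v <- s) nrm (T v) ^+ 2 <= M.
Proof.
move=> oe bT hM bs; have [oe1 _] := oe.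
have fin (B : {fset J}) : \sum_(v <- s) nrm (\sum_(k <- B) ip v (e k) *: T (e k)) ^+ 2 <= M.
  apply: le_trans (hM B); pose w v := \sum_(k <- B) ip v (e k) *: T (e k).
  rewrite -/(\sum_(v <- s) nrm (w v) ^+ 2).
  apply/ler_addgt0Pr => d d0.
  have sz : 0 < (size s).+1%:R :> R by [].
  have hw v : exists A : {fset J}, forall D, fsubset A D ->
      nrm (w v) ^+ 2 <= nrm (\sum_(j <- D) ip (w v) (e j) *: e j) ^+ 2 + d / (size s).+1%:R.
    by apply: vsums_sq_le (parseval _ oe) _ _; rewrite divr_gt0.
  have [D hD] := common_net hw s.
  apply: (@le_trans _ _ (\sum_(v <- s) (nrm (\sum_(j <- D) ip (w v) (e j) *: e j) ^+ 2 + d / (size s).+1%:R))).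
    rewrite big_seq [leRHS]big_seq; apply: ler_sum => v vs; apply: hD => //; exact: fsubset_refl.
  rewrite big_split /= lerD //; last first.
    exact: sum_avg.
  rewrite (eq_bigr (fun v => \sum_(j <- D) normc (ip (w v) (e j)) ^+ 2)); last first.
    by move=> v _; rewrite nrm_sum_ons // fset_uniq.
  rewrite exchange_big /=.
  apply: (@le_trans _ _ (\sum_(j <- D) \sum_(k <- B) normc (ip (T (e k)) (e j)) ^+ 2)).
    apply: ler_sum => j _.
    (* [x] is T^* e_j projected on the span of the e_k with k in [B], so that <w v, e_j> = <v,
       x>. *)
    pose x := \sum_(k <- B) (ip (T (e k)) (e j))^* *: e k.
    have -> : \sum_(v <- s) normc (ip (w v) (e j)) ^+ 2 = \sum_(v <- s) normc (ip x v) ^+ 2.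
      apply: eq_bigr => v _; rewrite [ip x v]ipC normcJ; congr (normc _ ^+ 2).
      rewrite ip_suml ip_sumr; apply: eq_bigr => k _.
      by rewrite ipZl ipZr conjJK mulrC.
    apply: le_trans (bs x) _; rewrite nrm_sum_ons ?fset_uniq //.
    by rewrite le_eqVlt; apply/orP; left; apply/eqP; apply: eq_bigr => k _; rewrite normcJ.
  rewrite exchange_big /=; apply: ler_sum => k _; apply: bessel_ineq => //; exact: fset_uniq.
apply/ler_addgt0Pr => d d0.
have sz : 0 < (size s).+1%:R :> R by [].
have hT v : exists A : {fset J}, forall B, fsubset A B ->
    nrm (T v) ^+ 2 <= nrm (\sum_(k <- B) ip v (e k) *: T (e k)) ^+ 2 + d / (size s).+1%:R.
  have := vsums_bop bT (parseval v oe).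
  have -> : T \o (fun i => ip v (e i) *: e i) = fun i => ip v (e i) *: T (e i).
    by apply/funext => i /=; rewrite islinZ //; exact: bop_lin.
  by move=> h; apply: vsums_sq_le h _ _; rewrite divr_gt0.
have [D hD] := common_net hT s.
apply: (@le_trans _ _ (\sum_(v <- s) (nrm (\sum_(k <- D) ip v (e k) *: T (e k)) ^+ 2 + d / (size s).+1%:R))).
  rewrite big_seq [leRHS]big_seq; apply: ler_sum => v vs; apply: hD => //; exact: fsubset_refl.
by rewrite big_split /= lerD // sum_avg.
Qed.

End orthonormal.

(** * A criterion for the trace *)

Section trace_criterion.
Context {R : realType} {V : hspace R} {J : choiceType} (e : J -> V).
Implicit Types (u v w : V) (T A : V -> V) (K : {fset J}).
Hypothesis oe : onb e.

Definition proj K u := \sum_(k <- K) ip u (e k) *: e k.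

(* T is approximated by the finite rank operators T P_K for the trace norm,
   which is tested on pairs of Bessel families. *)
Definition trace_approx T := forall d : R, 0 < d -> exists K, forall r : seq (V * V),
  bessel (map fst r) -> bessel (map snd r) ->
  \sum_(p <- r) normc (ip (T (p.1 - proj K p.1)) p.2) <= d.

Lemma ip_T_proj T K u v : islin T ->
  ip (T (proj K u)) v = \sum_(k <- K) ip u (e k) * ip (T (e k)) v.
Proof.
move=> lT; rewrite /proj islin_sum // ip_suml; apply: eq_bigr => k _.
by rewrite islinZ // ipZl.
Qed.

(** [T \o proj K] is a finite sum of rank one operators u |-> <u, e_k> T e_k, and the trace of each
    of them in the basis [f] is Parseval's formula for <T e_k, e_k>. *)
Lemma csums_finite_rank T K (I : choiceType) (f : I -> V) : islin T -> onb f ->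
  csums (fun i => ip (T (proj K (f i))) (f i)) (\sum_(k <- K) ip (T (e k)) (e k)).
Proof.
move=> lT of_ d d0.
have h (k : J) : exists A : {fset I}, forall B, fsubset A B ->
    normc (\sum_(i <- B) ip (f i) (e k) * ip (T (e k)) (f i) - ip (T (e k)) (e k)) < d / (size K).+1%:R.
  have dp : 0 < d / (size K).+1%:R by rewrite divr_gt0.
  have [A hA] := parseval_ip (T (e k)) (e k) of_ dp.
  exists A => B /hA; congr (_ < _); congr (normc (_ - _)).
  by apply: eq_bigr => i _; rewrite mulrC.
have [A hA] := common_net h (K : seq J); exists A => B AB.
have -> : \sum_(i <- B) ip (T (proj K (f i))) (f i) - \sum_(k <- K) ip (T (e k)) (e k) =
    \sum_(k <- K) (\sum_(i <- B) ip (f i) (e k) * ip (T (e k)) (f i) - ip (T (e k)) (e k)).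
  rewrite sumrB exchange_big /=; congr (_ - _); apply: eq_bigr => i _.
  by rewrite ip_T_proj.
apply: le_lt_trans (normc_sum _ _ _) _.
have [K0|Kn] := eqVneq (size K) 0%N.
  by rewrite (size0nil K0) big_nil.
apply: (@le_lt_trans _ _ (\sum_(k <- K) d / (size K).+1%:R)).
  rewrite big_seq [leRHS]big_seq; apply: ler_sum => k kK; rewrite ltW //; exact: hA.
rewrite big_const_seq count_predT iter_addr addr0 -[ltLHS]mulr_natr mulrAC ltr_pdivrMr ?ltr0n //.
by rewrite ltr_pM2l // ltr_nat.
Qed.

Lemma trace_approx_diff T d K (I : choiceType) (f : I -> V) (B : {fset I}) : islin T -> ons f ->
  (forall r : seq (V * V), bessel (map fst r) -> bessel (map snd r) ->
    \sum_(p <- r) normc (ip (T (p.1 - proj K p.1)) p.2) <= d) ->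
  normc (\sum_(i <- B) ip (T (f i)) (f i) - \sum_(i <- B) ip (T (proj K (f i))) (f i)) <= d.
Proof.
move=> lT of_ h; rewrite -sumrB; apply: le_trans (normc_sum _ _ _) _.
have := h [seq (f i, f i) | i <- B]; rewrite -!map_comp big_map /= => h1.
apply: le_trans (h1 _ _); try exact: (bessel_ons B of_).
by apply: ler_sum => i _; rewrite islinB // ipBl.
Qed.

(** In every basis, the partial sums are eventually within 1 / (n + 1) of the trace t_n of T
    P_(K_n), up to an arbitrary error. Comparing two such bounds in the basis [e] shows that t_n is
    Cauchy; its limit depends on no basis. *)
Lemma trace_approx_ex T : bop T -> trace_approx T ->
  exists t, forall (I : choiceType) (f : I -> V), onb f -> csums (fun i => ip (T (f i)) (f i)) t.
Proof.
move=> bT hT; have lT := bop_lin bT.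
have /choice[K hK] : forall n : nat, exists K, forall r : seq (V * V),
    bessel (map fst r) -> bessel (map snd r) ->
    \sum_(p <- r) normc (ip (T (p.1 - proj K p.1)) p.2) <= n.+1%:R^-1.
  by move=> n; apply: hT; rewrite invr_gt0.
pose t n := \sum_(k <- K n) ip (T (e k)) (e k).
have key n (I : choiceType) (f : I -> V) : onb f -> forall d : R, 0 < d ->
    exists A : {fset I}, forall B, fsubset A B ->
    normc (\sum_(i <- B) ip (T (f i)) (f i) - t n) < n.+1%:R^-1 + d.
  move=> of_ d d0; have [A hA] := csums_finite_rank (K n) lT of_ d0; exists A => B /hA h.
  have := trace_approx_diff B lT of_.1 (hK n).
  move=> h1; apply: le_lt_trans (ler_ltD h1 h).
  by rewrite -[X in normc X](subrKA (\sum_(i <- B) ip (T (proj (K n) (f i))) (f i))) le_normcD.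
have dt n m : normc (t n - t m) <= n.+1%:R^-1 + m.+1%:R^-1.
  apply/ler_addgt0Pr => d d0.
  have [A hA] := key n J e oe _ (half_gt0 d0); have [A' hA'] := key m J e oe _ (half_gt0 d0).
  have := hA _ (fsubsetUl A A'); have := hA' _ (fsubsetUr A A').
  set x := \sum_(i <- _) _ => h1 h2; rewrite -[t n - _](subrKA x).
  have := le_normcD (t n - x) (x - t m); rewrite (normcBC (t n)).
  move: (n.+1%:R^-1) (m.+1%:R^-1) h1 h2 => a b h1 h2; lra.
have [l hl] : exists l, cconv t l.
  apply: ccauchy => d d0; have [N hN] := inv_small (half_gt0 d0); exists N => i j iN jN.
  by apply: le_lt_trans (dt i j) _; rewrite [d]splitr ltrD ?hN.
have tl n : normc (t n - l) <= n.+1%:R^-1.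
  apply/ler_addgt0Pr => d d0; have [N hN] := hl _ (half_gt0 d0).
  have [M hM] := inv_small (half_gt0 d0); have h1 := hN _ (leq_maxl N M).
  have h2 := hM _ (leq_maxr N M); have := dt n (maxn N M).
  have := le_normcD (t n - t (maxn N M)) (t (maxn N M) - l); rewrite subrKA.
  move: (n.+1%:R^-1) ((maxn N M).+1%:R^-1) h1 h2 => a b h1 h2; lra.
exists l => I f of_ d d0.
have [N hN] := inv_small (half_gt0 (half_gt0 d0)); have hN' := hN _ (leqnn N).
have [A hA] := key N I f of_ _ (half_gt0 d0); exists A => B /hA h.
have := le_normcD (\sum_(i <- B) ip (T (f i)) (f i) - t N) (t N - l); rewrite subrKA.
have := tl N; move: (N.+1%:R^-1) hN' h => a h1 h2; lra.
Qed.

Lemma bop_proj K : bop (proj K).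
Proof.
apply: (@bop_sum R V J K (fun k u => ip u (e k) *: e k)) => k; split.
  by move=> a u v; rewrite ip_linear scalerDl scalerA.
exists 1; split => // u; rewrite nrmZ (nrm_ons oe.1) mulr1 mul1r.
by rewrite (le_trans (cauchy_schwarz _ _)) // (nrm_ons oe.1) mulr1.
Qed.

(** <A e_k, e_k> = <T e_k, T h e_k> + <A e_k, C^N e_k>, where [h] is the approximate inverse of [A].
    As |T h x| = |A h x| <= 2 |x|, the vectors T h e_k / 2 form a Bessel family, on which the
    approximation of [T] can be tested. *)
Lemma trace_approx_abs T A : bop T -> trace_approx T -> bop A -> pos A ->
  A \o A = adjV T \o T ->
  exists M : R, forall B : {fset J}, \sum_(k <- B) Re (ip (A (e k)) (e k)) <= M.
Proof.
move=> bT hT bA pA hA; have lT := bop_lin bT; have lA := bop_lin bA.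
have sA := pos_selfadj lA pA.
have AT u v : ip (A u) (A v) = ip (T u) (T v).
  by rewrite -sA -ip_adjl //; congr ip; exact: (congr1 (@^~ u) hA).
have nAT u : nrm (T u) = nrm (A u) by rewrite /nrm AT.
have [c [c0 Ac]] := bop_pos_bound bA.
have [K hK] := hT 1 ltr01.
(* The first 1 pays for the terms with C^N, the factor 2 undoes the halving in [r], the second 1 is
   the precision chosen for [K], and the sum bounds the finite rank part T P_K. *)
pose M := 1 + 2 * (1 + \sum_(k <- K) nrm (T (e k))).
exists M => B.
(* [N] may depend on [B], since [M] does not involve it. *)
have [N [hN _]] : exists N, (#|` B|)%:R * (c / N.+1%:R) < 1 /\ True.
  have p : 0 < (#|` B|%:R * c + 1)^-1 by rewrite invr_gt0 ltr_wpDl // mulr_ge0 // ltW.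
  have [N hN] := inv_small p; exists N; split => //; rewrite mulrA.
  have := hN N (leqnn N); rewrite ltf_pV2 ?posrE // => [h|]; last first.
    by rewrite ltr_wpDl // mulr_ge0 // ltW.
  rewrite ltr_pdivrMr // mul1r; lra.
pose h := happ A c N.
have bh : bop h by exact: happ_bop.
pose r := [seq (e k, (2^-1)%:C *: T (h (e k))) | k <- B].
have b1 : bessel (map fst r) by rewrite -map_comp /=; exact: (bessel_ons B oe.1).
have b2 : bessel (map snd r).
  rewrite -map_comp /=; apply: bessel_gram => d.
  set x := \sum_(k <- B) d k *: e k.
  have -> : \sum_(k <- B) d k *: ((snd \o (fun k => (e k, (2^-1)%:C *: T (h (e k))))) k) = (2^-1)%:C *: T (h x).
    rewrite /x (islin_sum (bop_lin bh)) (islin_sum lT) scaler_sumr; apply: eq_bigr => k _ /=.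
    by rewrite (islinZ (bop_lin bh)) (islinZ lT) !scalerA mulrC.
  rewrite -(nrm_sum_ons oe.1) ?fset_uniq // -/x nrmZ normc_rc ger0_norm ?invr_ge0 // nAT.
  rewrite ler_pXn2r ?nnegrE ?mulr_ge0 ?invr_ge0 ?nrm_ge0 // A_happ //.
  have := nrmB x (iter N (cplt A c) x); have := iter_cplt_bound bA pA c0 Ac N x; lra.
have hB k : Re (ip (A (e k)) (e k)) <= c / N.+1%:R + normc (ip (T (e k)) (T (h (e k)))).
  have -> : ip (A (e k)) (e k) = ip (T (e k)) (T (h (e k))) + ip (A (e k)) (iter N (cplt A c) (e k)).
    by rewrite -AT A_happ // ipBr subrK.
  rewrite ReD addrC lerD // ?Re_le_normc //.
  rewrite (le_trans (Re_le_normc _)) // sA (le_trans (cauchy_schwarz _ _)) //.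
  rewrite (nrm_ons oe.1) mul1r; apply: le_trans (A_cplt_bound bA pA c0 Ac N (e k)) _.
  by rewrite (nrm_ons oe.1) mulr1.
apply: (@le_trans _ _ (\sum_(k <- B) (c / N.+1%:R + normc (ip (T (e k)) (T (h (e k))))))).
  by apply: ler_sum => k _.
rewrite big_split /= lerD //.
  rewrite big_const_seq count_predT iter_addr addr0 -[leLHS]mulr_natr mulrC; exact: ltW.
have -> : \sum_(k <- B) normc (ip (T (e k)) (T (h (e k)))) = 2 * \sum_(p <- r) normc (ip (T p.1) p.2).
  rewrite big_map mulr_sumr; apply: eq_bigr => k _ /=.
  by rewrite ipZr conjc_rc Normc.normcM normc_rc ger0_norm ?invr_ge0 // mulVKf.
rewrite ler_pM2l //.
apply: (@le_trans _ _ (\sum_(p <- r) (normc (ip (T (p.1 - proj K p.1)) p.2) + normc (ip (T (proj K p.1)) p.2)))).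
  by apply: ler_sum => p _; apply: le_trans (le_normcD _ _); rewrite -ipDl -islinD // subrK.
rewrite big_split /= lerD //; first exact: hK.
apply: (@le_trans _ _ (\sum_(p <- r) \sum_(k <- K) normc (ip p.1 (e k) * ip (T (e k)) p.2))).
  by apply: ler_sum => p _; rewrite ip_T_proj // normc_sum.
rewrite exchange_big /=; apply: ler_sum => k _.
by rewrite (le_trans (bessel_pair _ _ b1 b2)) // (nrm_ons oe.1) mul1r.
Qed.

(** [T] is the sum of the rank one operators u |-> <u, e_k> T e_k, with trace norms at most |T e_k|;
    [K] leaves out a small tail of this series. *)
Lemma trace_approx_summable T (M : R) : bop T ->
  (forall B : {fset J}, \sum_(k <- B) nrm (T (e k)) <= M) -> trace_approx T.
Proof.
move=> bT hM d d0; have lT := bop_lin bT.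
have [K hK] := sum_tail (fun k => nrm_ge0 (T (e k))) hM (half_gt0 d0); exists K => r b1 b2.
have hr (p : V * V) : exists A : {fset J}, forall B, fsubset A B ->
    normc (ip (T p.1) p.2 - \sum_(k <- B) ip p.1 (e k) * ip (T (e k)) p.2) <= d / 2 / (size r).+1%:R.
  have [|A hA] := csums_ipl p.2 (vsums_bop bT (parseval p.1 oe)) (e := d / 2 / (size r).+1%:R).
    by rewrite divr_gt0 // half_gt0.
  exists A => B /hA /ltW; rewrite normcBC; congr (normc (_ - _) <= _).
  by apply: eq_bigr => k _ /=; rewrite islinZ // ipZl.
have [A hA] := common_net hr r; have {}hA := hA _ (fsubsetUl A K).
set B := (A `|` K)%fset in hA.
apply: (@le_trans _ _ (\sum_(p <- r) (d / 2 / (size r).+1%:R +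
   \sum_(k <- (B `\` K)%fset) normc (ip p.1 (e k) * ip (T (e k)) p.2)))).
  rewrite big_seq [leRHS]big_seq; apply: ler_sum => p pr.
  rewrite islinB // ipBl ip_T_proj //.
  have -> : ip (T p.1) p.2 - \sum_(k <- K) ip p.1 (e k) * ip (T (e k)) p.2 =
     (ip (T p.1) p.2 - \sum_(k <- B) ip p.1 (e k) * ip (T (e k)) p.2) +
     \sum_(k <- (B `\` K)%fset) ip p.1 (e k) * ip (T (e k)) p.2.
    rewrite (big_fset_split _ (fsubsetUr A K)) -/B opprD addrA.
    by rewrite subrK.
  apply: le_trans (le_normcD _ _) _; rewrite lerD ?normc_sum //; exact: hA.
rewrite big_split /= [leRHS]splitr lerD //; first by apply: sum_avg; exact: half_gt0.
rewrite exchange_big /=.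
apply: (@le_trans _ _ (\sum_(k <- (B `\` K)%fset) nrm (T (e k)))).
  apply: ler_sum => k _.
  by rewrite (le_trans (bessel_pair _ _ b1 b2)) // (nrm_ons oe.1) mul1r.
by rewrite ltW // hK // => k; rewrite in_fsetD => /andP[].
Qed.

(** The factors [Z] and [Y] may vary with the error [d], but their Hilbert-Schmidt bounds [a] and
    [M] may not: [K] is chosen from the tail of [a] alone, and works for all factorizations. *)
Lemma trace_approx_hs T (a : J -> R) (M M' : R) : bop T ->
  (forall k, 0 <= a k) -> 0 <= M -> (forall B : {fset J}, \sum_(k <- B) a k <= M') ->
  (forall d : R, 0 < d -> exists Z Y, [/\ bop Z, bop Y,
     forall u v, normc (ip (T u) v) <= nrm (Z u) * nrm (Y v) + d * nrm u * nrm v,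
     forall k, nrm (Z (e k)) ^+ 2 <= a k
     & forall B : {fset J}, \sum_(k <- B) nrm (Y (e k)) ^+ 2 <= M ^+ 2]) ->
  trace_approx T.
Proof.
move=> bT a0 M0 hM' h d d0.
have q0 : 0 < d / 2 / (M + 1) by rewrite divr_gt0 ?half_gt0 // ltr_wpDl.
have [K hK] := sum_tail a0 hM' (exprn_gt0 2 q0); exists K => r b1 b2.
(* With [K] and [r] fixed, a factorization is chosen with an error that is small relative to [s]. *)
pose s := \sum_(p <- r) nrm (p.1 - proj K p.1) * nrm p.2.
have s0 : 0 <= s by apply: sumr_ge0 => p _; rewrite mulr_ge0 ?nrm_ge0.
have s1 : 0 < s + 1 by rewrite ltr_wpDl.
have [Z [Y [bZ bY hT hZ hY]]] := h _ (divr_gt0 (half_gt0 d0) s1).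
apply: (@le_trans _ _ (\sum_(p <- r) (nrm (Z (p.1 - proj K p.1)) * nrm (Y p.2) +
   d / 2 / (s + 1) * (nrm (p.1 - proj K p.1) * nrm p.2)))).
  by apply: ler_sum => p _; rewrite mulrA.
rewrite big_split /= -mulr_sumr -/s [leRHS]splitr lerD //; last first.
  by apply: frac_le => //; exact/ltW/half_gt0.
apply: (@le_trans _ _ (d / 2 / (M + 1) * M)); last first.
  by apply: frac_le => //; exact/ltW/half_gt0.
apply: sum_cs_le => //; first exact: ltW.
  pose Z' u := Z (u - proj K u).
  have bZ' : bop Z' by apply: (bop_comp bZ); apply: bopB; [exact: bop_id|exact: bop_proj].
  have := hilbert_schmidt oe bZ' _ b1; rewrite big_map; apply => B.
  have E k : Z' (e k) = if k \in K then 0 else Z (e k).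
    rewrite /Z'; have -> : proj K (e k) = if k \in K then e k else 0.
      rewrite /proj; case: ifP => kK.
        rewrite (bigD1_seq k) //= ?fset_uniq // oe.1 eqxx scale1r big1 ?addr0 // => i ik.
        by rewrite oe.1 eq_sym (negbTE ik) scale0r.
      rewrite big1_seq // => i /= iK; rewrite oe.1; case: eqP => [ki|]; last by rewrite scale0r.
      by rewrite ki iK in kK.
    by case: ifP => _; rewrite ?subrr ?subr0 // islin0 //; exact: bop_lin.
  apply: (@le_trans _ _ (\sum_(k <- (B `\` K)%fset) a k)); last first.
    by rewrite ltW // hK // => k; rewrite in_fsetD => /andP[].
  rewrite (big_fset_split _ (fsubsetDl B K)).
  rewrite [X in _ + X]big1_seq ?addr0 => [|k /=].
    rewrite big_seq [leRHS]big_seq; apply: ler_sum => k; rewrite in_fsetD => /andP[/negbTE kK _].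
    by rewrite E kK hZ.
  rewrite !in_fsetD => /andP[+ kB]; rewrite kB andbT negbK => kK.
  by rewrite E kK nrm0 expr0n.
by have := hilbert_schmidt oe bY hY b2; rewrite big_map.
Qed.

End trace_criterion.

(** * Presentations of Hilbert spaces *)

Section presentation.
Context {R : realType}.

Lemma climn_cconv (z : nat -> R[i]) l : cconv z l -> climn z = l.
Proof.
move=> h; apply: complex_ext; rewrite /climn /=; apply: cvg_lim => //; apply/cvgrPdist_lt => e e0.
  have [N hN] := h e e0; exists N => // i /= Ni.
  by rewrite -ReB (le_lt_trans (absRe_le_normc _)) // normcBC hN.
have [N hN] := h e e0; exists N => // i /= Ni.
by rewrite -ImB (le_lt_trans (Im_le_normc _)) // normcBC hN.
Qed.

(** [J] realizes the quotient of [hdom] by the vectors of norm 0; outside [hdom] its values are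
    arbitrary. The same [V] can be presented in several ways, as will be the case for [L2_Tn] and
    [L2_theta]. *)
Record presents (H : hilbert R) (V : hspace R) (J : H -> V) : Prop := Presents {
  pres_lin : forall (a : R[i]) u v, hdom u -> hdom v ->
    hdom (a *: u + v) /\ J (a *: u + v) = a *: J u + J v;
  pres_ip : forall u v, hdom u -> hdom v -> hip u v = ip (J u) (J v);
  pres_surj : forall x, exists u, hdom u /\ J u = x }.

Context {H : hilbert R} {V : hspace R} (J : H -> V).
Hypothesis MJ : presents J.
Implicit Types (u v : H) (x y : V) (T S : H -> H) (A B : V -> V).

Definition sect x : H := xget 0 [set u | hdom u /\ J u = x]%classic.

Lemma sectP x : hdom (sect x) /\ J (sect x) = x.
Proof. by rewrite /sect; case: xgetP => [u _ //|h]; have [u /h] := pres_surj MJ x. Qed.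

Lemma sect_dom x : hdom (sect x). Proof. by case: (sectP x). Qed.
Lemma sectK x : J (sect x) = x. Proof. by case: (sectP x). Qed.

Lemma presB u v : hdom u -> hdom v -> hdom (u - v) /\ J (u - v) = J u - J v.
Proof.
move=> hu hv; have [h1 h2] := pres_lin MJ (-1) hv hu.
by rewrite addrC -scaleN1r; split => //; rewrite h2 scaleN1r addrC.
Qed.

Lemma pres0 : hdom (0 : H) /\ J 0 = 0.
Proof.
have [h1 h2] := presB (sect_dom 0) (sect_dom 0).
by rewrite subrr in h1 h2; rewrite h2 subrr.
Qed.

Lemma pres_nrm u : hdom u -> hnorm u = nrm (J u).
Proof. by move=> hu; rewrite /hnorm (pres_ip MJ). Qed.

Lemma pres_heq u v : hdom u -> hdom v -> heq u v <-> J u = J v.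
Proof.
move=> hu hv; have [h1 h2] := presB hu hv; rewrite /heq pres_nrm // h2; split.
  by move/nrm_eq0/eqP; rewrite subr_eq0 => /eqP.
by move=> ->; rewrite subrr nrm0.
Qed.

Definition lift_op T : V -> V := fun x => J (T (sect x)).

Lemma lift_eq T A : bop A -> (forall u, hdom u -> hdom (T u) /\ J (T u) = A (J u)) ->
  bounded_op T /\ lift_op T = A.
Proof.
move=> bA hT; split.
  have [lA [c [c0 hc]]] := bA; split.
  - by move=> u /hT[].
  - move=> a u v hu hv; have [h1 h2] := pres_lin MJ a hu hv.
    have [h3 h4] := hT _ h1; have [h5 h6] := hT _ hu; have [h7 h8] := hT _ hv.
    have [h9 h10] := pres_lin MJ a h5 h7.
    by apply/pres_heq => //; rewrite h4 h10 h2 lA h6 h8.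
  - exists c => u hu; have [h1 h2] := hT _ hu.
    by rewrite !pres_nrm // h2 hc.
apply/funext => x; rewrite /lift_op; have [_ ->] := hT _ (sect_dom x).
by rewrite sectK.
Qed.

(** Boundedness forces [T] to respect the identification: the difference of two representatives has
    norm 0, hence so has its image. *)
Lemma lift_bop T : bounded_op T ->
  bop (lift_op T) /\ forall u, hdom u -> hdom (T u) /\ J (T u) = lift_op T (J u).
Proof.
move=> [hd hl [c hc]].
have ext u v : hdom u -> hdom v -> J u = J v -> J (T u) = J (T v).
  move=> hu hv uv; have [k1 k2] := pres_lin MJ (-1) hv hu.
  have [k3 k4] := pres_lin MJ (-1) (hd _ hv) (hd _ hu).
  have e0 : J (T (-1 *: v + u)) = 0.
    apply: nrm_eq0; apply/eqP; rewrite eq_le nrm_ge0 andbT -pres_nrm; last exact: hd.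
    by apply: le_trans (hc _ k1) _; rewrite pres_nrm // k2 uv scaleN1r addNr nrm0 mulr0.
  have := hl (-1) _ _ hv hu; rewrite pres_heq ?k4 ?e0 //; last exact: hd.
  by move=> /esym; rewrite scaleN1r addrC => /eqP; rewrite subr_eq0 => /eqP.
split; last first.
  move=> u hu; split; first exact: hd.
  by rewrite /lift_op; apply: ext; rewrite ?sectK //; exact: sect_dom.
split.
  move=> a x y; rewrite /lift_op.
  have [k1 k2] := pres_lin MJ a (sect_dom x) (sect_dom y).
  have [k3 k4] := pres_lin MJ a (hd _ (sect_dom x)) (hd _ (sect_dom y)).
  have := hl a _ _ (sect_dom x) (sect_dom y); rewrite pres_heq //; last exact: hd.
  rewrite k4 => <-; apply: ext; rewrite ?k2 ?sectK //; exact: sect_dom.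
exists `|c|; split => // x; rewrite /lift_op -pres_nrm; last exact/hd/sect_dom.
apply: le_trans (hc _ (sect_dom x)) _; rewrite pres_nrm ?sectK; last exact: sect_dom.
by rewrite ler_wpM2r ?nrm_ge0 // ler_norm.
Qed.

Lemma liftE T u : bounded_op T -> hdom u -> J (T u) = lift_op T (J u).
Proof. by move=> /lift_bop[_ h] /h[]. Qed.

Lemma lift_isbop T : bounded_op T -> bop (lift_op T). Proof. by case/lift_bop. Qed.

Definition drop A : H -> H := fun u => sect (A (J u)).

Lemma dropP A : bop A -> bounded_op (drop A) /\ lift_op (drop A) = A.
Proof.
move=> bA; apply: lift_eq => // u hu; rewrite /drop sectK; split => //; exact: sect_dom.
Qed.

Lemma op_eqP S T : bounded_op S -> bounded_op T -> op_eq S T <-> lift_op S = lift_op T.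
Proof.
move=> bS bT; split.
  move=> h; apply/funext => x; have hx := sect_dom x.
  have := h _ hx; rewrite pres_heq //; first by case: bS => + _ _; exact.
  by case: bT => + _ _; exact.
move=> h u hu; apply/pres_heq; first by case: bS => + _ _; exact.
  by case: bT => + _ _; exact.
by rewrite !liftE // h.
Qed.

Lemma lift_id : bounded_op (id : H -> H) /\ lift_op id = id.
Proof. by apply: lift_eq => //; exact: bop_id. Qed.

Lemma lift_comp S T : bounded_op S -> bounded_op T ->
  bounded_op (S \o T) /\ lift_op (S \o T) = lift_op S \o lift_op T.
Proof.
move=> bS bT; apply: lift_eq; first by apply: bop_comp; exact: lift_isbop.
move=> u hu /=; have [_ /(_ _ hu)[h1 h2]] := lift_bop bT.
by have [_ /(_ _ h1)[h3 h4]] := lift_bop bS; rewrite h4 h2.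
Qed.

Lemma lift_lin (a : R[i]) S T : bounded_op S -> bounded_op T ->
  bounded_op (a *: S + T) /\ lift_op (a *: S + T) = fun x => a *: lift_op S x + lift_op T x.
Proof.
move=> bS bT; apply: lift_eq; first by apply: bop_lincomb; exact: lift_isbop.
move=> u hu; have [_ /(_ _ hu)[h1 h2]] := lift_bop bT.
have [_ /(_ _ hu)[h3 h4]] := lift_bop bS.
by have [h5 h6] := pres_lin MJ a h3 h1; rewrite h6 h4 h2.
Qed.

Lemma lift0 : bounded_op (0 : H -> H) /\ lift_op 0 = fun=> 0.
Proof.
apply: lift_eq; first exact: bop_cst0.
by move=> u hu; have [h1 h2] := pres0.
Qed.

Lemma liftB S T : bounded_op S -> bounded_op T ->
  bounded_op (S - T) /\ lift_op (S - T) = fun x => lift_op S x - lift_op T x.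
Proof.
move=> bS bT; have [h1 h2] := lift_lin (-1) bT bS.
rewrite addrC -scaleN1r; split => //; rewrite h2; apply/funext => x.
by rewrite scaleN1r addrC.
Qed.

Lemma lift_sum (I : Type) (r : seq I) (F : I -> H -> H) : (forall i, bounded_op (F i)) ->
  bounded_op (\sum_(i <- r) F i) /\ lift_op (\sum_(i <- r) F i) = fun x => \sum_(i <- r) lift_op (F i) x.
Proof.
move=> hF; elim: r => [|i r [IH1 IH2]].
  have [h1 h2] := lift0; rewrite big_nil; split => //; rewrite h2.
  by apply/funext => x; rewrite big_nil.
have [h1 h2] := lift_lin 1 (hF i) IH1; rewrite big_cons -[F i]scale1r; split => //.
by rewrite h2; apply/funext => x; rewrite big_cons IH2 scale1r.
Qed.

Lemma liftZ (a : R[i]) T : bounded_op T ->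
  bounded_op (a *: T) /\ lift_op (a *: T) = fun x => a *: lift_op T x.
Proof.
move=> bT; have [h1 h2] := lift0; have [h3 h4] := lift_lin a bT h1.
rewrite addr0 in h3 h4; split => //; rewrite h4 h2; apply/funext => x; by rewrite addr0.
Qed.

(** An adjoint found on [V] and sent back by [drop] shows that there is something to pick;
    uniqueness on [V] identifies whatever has been picked. *)
Lemma lift_adj T : bounded_op T -> bounded_op (adj T) /\ lift_op (adj T) = adjV (lift_op T).
Proof.
move=> bT; have [bl hl] := lift_bop bT.
have [d1 d2] := dropP (adjV_bop bl).
have hd : bounded_op (drop (adjV (lift_op T))) /\
    forall u v, hdom u -> hdom v -> hip (T u) v = hip u (drop (adjV (lift_op T)) v).
  split => // u v hu hv; have [h1 h2] := hl _ hu.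
  have [_ /(_ _ hv)[h3 h4]] := lift_bop d1.
  by rewrite !(pres_ip MJ) // h4 h2 d2 ip_adj.
have [b h] : bounded_op (adj T) /\ forall u v, hdom u -> hdom v -> hip (T u) v = hip u (adj T v).
  by rewrite /adj; case: xgetP => [S _ //|/(_ (drop (adjV (lift_op T))))].
split => //; apply/esym/adjV_uniq => // x y.
have hx := sect_dom x; have hy := sect_dom y; have := h _ _ hx hy.
have [h1 h2] := hl _ hx; have [_ /(_ _ hy)[h3 h4]] := lift_bop b.
by rewrite !(pres_ip MJ) // h2 h4 !sectK.
Qed.

Lemma lift_pos T : bounded_op T -> positive_op T <-> pos (lift_op T).
Proof.
move=> bT; have [bl hl] := lift_bop bT; split.
  move=> h x; have := h _ (sect_dom x); have [h1 h2] := hl _ (sect_dom x).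
  by rewrite (pres_ip MJ) //; [rewrite h2 sectK | exact: sect_dom].
by move=> h u hu; have [h1 h2] := hl _ hu; rewrite (pres_ip MJ) // h2.
Qed.

Lemma lift_abs T : bounded_op T -> bounded_op (abs_op T) /\ lift_op (abs_op T) = absV (lift_op T).
Proof.
move=> bT; have bl := lift_isbop bT; have [ba la] := lift_adj bT.
have [b1 l1] := lift_comp ba bT.
have [bA pA hA] := absVP bl.
have [d1 d2] := dropP bA.
have [b h1 h2] : [/\ bounded_op (abs_op T), positive_op (abs_op T)
    & op_eq (abs_op T \o abs_op T) (adj T \o T)].
  rewrite /abs_op; case: xgetP => [A _ //|/(_ (drop (absV (lift_op T))))]; case; split => //.
    by apply/lift_pos => //; rewrite d2.
  have [b2 l2] := lift_comp d1 d1; apply/op_eqP => //.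
  by rewrite l2 d2 l1 la hA.
split => //; apply: absV_uniq => //; first exact: lift_isbop.
  exact/lift_pos.
have [b2 l2] := lift_comp b b; have /op_eqP := h2; rewrite l2 l1 la; exact.
Qed.

Lemma opnorm_le T (c : R) : bounded_op T -> obound (lift_op T) c -> 0 <= c -> (opnorm T <= c%:E)%E.
Proof.
move=> bT hc c0; have [bl hl] := lift_bop bT; apply: ub_ereal_sup => _ [u [hu u1] <-].
have [h1 h2] := hl _ hu; rewrite lee_fin pres_nrm // h2 (le_trans (hc _)) //.
by rewrite -pres_nrm // -[leRHS]mulr1 ler_wpM2l.
Qed.

Lemma opnorm_obound T (c : R) : bounded_op T -> (opnorm T <= c%:E)%E -> obound (lift_op T) c.
Proof.
move=> bT hT x; have [bl hl] := lift_bop bT; have [lT _] := bl.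
have [/nrm_eq0 ->|x0] := eqVneq (nrm x) 0; first by rewrite islin0 // nrm0 mulr0.
have xp : 0 < nrm x by rewrite lt_def x0 nrm_ge0.
set y := ((nrm x)^-1)%:C *: x.
have ny : nrm y = 1 by rewrite nrmZ normc_rc ger0_norm ?invr_ge0 ?nrm_ge0 // mulVf.
have : ((hnorm (T (sect y)))%:E <= opnorm T)%E.
  apply: ereal_sup_ubound; exists (sect y) => //; split; first exact: sect_dom.
  by rewrite pres_nrm ?sectK ?ny //; exact: sect_dom.
move=> /le_trans /(_ hT); have [h1 h2] := hl _ (sect_dom y).
rewrite lee_fin pres_nrm // h2 sectK /y islinZ // nrmZ normc_rc ger0_norm ?invr_ge0 ?nrm_ge0 //.
by rewrite mulrC ler_pdivrMr.
Qed.

Lemma opnorm_ge0 T : (0 <= opnorm T)%E.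
Proof.
have [h1 h2] := pres0.
apply: (@le_trans _ _ (hnorm (T 0))%:E); first by rewrite lee_fin sqrtr_ge0.
by apply: ereal_sup_ubound; exists 0 => //; split => //; rewrite pres_nrm // h2 nrm0.
Qed.

Lemma pres_onb (I : choiceType) (e : I -> H) : orthonormal_basis e -> onb (J \o e).
Proof.
move=> [h1 h2 h3]; split; first by move=> i j; rewrite -h2 (pres_ip MJ).
move=> x hx; apply: nrm_eq0; rewrite -[x]sectK -pres_nrm; last exact: sect_dom.
apply: h3; first exact: sect_dom.
by move=> i; rewrite (pres_ip MJ) ?sectK //; [exact: hx|exact: sect_dom].
Qed.

Lemma onb_pres (I : choiceType) (e : I -> H) : (forall i, hdom (e i)) -> onb (J \o e) ->
  orthonormal_basis e.
Proof.
move=> h1 [h2 h3]; split => // [i j|u hu h]; first by rewrite (pres_ip MJ) // -h2.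
by rewrite pres_nrm // (h3 (J u)) ?nrm0 // => i; rewrite -(pres_ip MJ) // h.
Qed.

(** Reduces a trace formula to an approximation in one basis, after which the trace is evaluated
    term by term in that same basis. *)
Lemma presents_trace (I : choiceType) (e : I -> H) T :
  bounded_op T -> (forall i, hdom (e i)) -> onb (J \o e) ->
  trace_approx (J \o e) (lift_op T) ->
  trace_class T /\ sums_to cabs (fun i => hip (T (e i)) (e i)) (trace T).
Proof.
move=> bT he oe ht; have [bl hl] := lift_bop bT; have [ba la] := lift_abs bT.
have oeH := onb_pres he oe.
have [bA pA hA] := absVP bl.
split.
  split => //; exists I, e; split => //.
  have [M hM] := trace_approx_abs oe bl ht bA pA hA.
  apply: (@le_lt_trans _ _ M%:E); last exact: ltry.
  apply: ub_ereal_sup => _ [F [finF _] <-].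
  rewrite fsbig_finite //= sumEFin lee_fin; apply: le_trans (hM (fset_set F)).
  apply: ler_sum => i _; have [_ /(_ _ (he i))[h1 h2]] := lift_bop ba.
  by rewrite (pres_ip MJ) // h2 la.
have [t ht'] := trace_approx_ex oe bl ht.
have ex : forall (I0 : choiceType) (e0 : I0 -> H), orthonormal_basis e0 ->
    sums_to cabs (fun i => hip (T (e0 i)) (e0 i)) t.
  move=> I0 f of_ d d0; have [A hA'] := ht' I0 (J \o f) (pres_onb of_) d d0.
  exists A => B AB; rewrite /cabs lte_fin; have := hA' B AB.
  congr (normc (_ - _) < _); apply: eq_bigr => i _.
  have [hf _ _] := of_; have [h1 h2] := hl _ (hf i).
  by rewrite (pres_ip MJ) // h2.
by rewrite /trace; case: xgetP => [t' _ /(_ I e)|/(_ t)]; [exact|case].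
Qed.

End presentation.

(** * Algebras with a trace vector *)

Section operator_sums.
Context {R : realType} {V : hspace R}.
Implicit Types (u v w : V) (S T : V -> V).

Definition opsums (I : choiceType) (F : I -> V -> V) S := forall d : R, 0 < d ->
  exists A : {fset I}, forall B : {fset I}, fsubset A B ->
    obound (fun u => \sum_(i <- B) F i u - S u) d.

Lemma opsums_vsums (I : choiceType) (F : I -> V -> V) S u : opsums F S ->
  vsums (fun i => F i u) (S u).
Proof.
move=> h d d0; have p : 0 < nrm u + 1 by rewrite ltr_wpDl // nrm_ge0.
have [A hA] := h _ (divr_gt0 d0 p); exists A => B /hA /(_ u) /le_lt_trans; apply.
by rewrite mulrAC ltr_pdivrMr // ltr_pM2l // ltrDl.
Qed.

Lemma opsums_unique (I : choiceType) (F : I -> V -> V) S T : opsums F S -> opsums F T -> S = T.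
Proof.
by move=> hS hT; apply/funext => u; apply: vsums_unique (opsums_vsums u hS) (opsums_vsums u hT).
Qed.

Lemma opsums_ex (I : choiceType) (F : I -> V -> V) (a : I -> R) (M : R) :
  (forall i, islin (F i)) -> (forall i, obound (F i) (a i)) -> (forall i, 0 <= a i) ->
  (forall B : {fset I}, \sum_(i <- B) a i <= M) ->
  exists S, [/\ islin S, obound S M & opsums F S].
Proof.
move=> lF bF a0 hM.
have bs u (B : {fset I}) : nrm (\sum_(i <- B) F i u) <= (\sum_(i <- B) a i) * nrm u.
  by rewrite (le_trans (nrm_sum _ _ _)) // mulr_suml; apply: ler_sum => i _; exact: bF.
have /choice[S hS] : forall u, exists s, vsums (fun i => F i u) s.
  move=> u; apply: (@vsums_abs R V I _ (fun i => a i * nrm u) (M * nrm u)).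
    by move=> i; exact: bF.
  by move=> B; rewrite -mulr_suml ler_wpM2r ?nrm_ge0.
exists S; split.
- move=> c u v; apply: vsums_unique (hS _) _.
  have -> : (fun i => F i (c *: u + v)) = fun i => c *: F i u + F i v.
    by apply/funext => i; rewrite lF.
  exact: vsums_lin.
- move=> u; apply: vsums_le (hS u) _ => B; rewrite (le_trans (bs _ _)) //.
  by rewrite ler_wpM2r ?nrm_ge0.
move=> d d0; have [A hA] := sum_tail a0 hM d0; exists A => B AB u.
apply/ler_addgt0Pr => c c0; have [D hD] := hS u c c0.
have := hD _ (fsubsetUr B D); rewrite (big_fset_split _ (fsubsetUl B D)).
set x := \sum_(i <- B) _; set y := \sum_(i <- _) _ => h1.
have h2 : nrm y <= d * nrm u.
  apply: le_trans (bs _ _) _; rewrite ler_wpM2r ?nrm_ge0 // ltW // hA // => i.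
  rewrite in_fsetD => /andP[iB _]; apply: contra iB; exact: (fsubsetP AB).
have -> : x - S u = (x + y - S u) - y by rewrite addrAC addrK.
have := nrmB (x + y - S u) y; lra.
Qed.

Lemma opsums_lin (I : choiceType) (F G : I -> V -> V) S T (c : R[i]) :
  opsums F S -> opsums G T ->
  opsums (fun i u => c *: F i u + G i u) (fun u => c *: S u + T u).
Proof.
move=> hF hG d d0; have p : 0 < normc c + 1 by rewrite ltr_wpDl // normc_ge0.
have [A hA] := hF _ (divr_gt0 (half_gt0 d0) p); have [B hB] := hG _ (half_gt0 d0).
exists (A `|` B)%fset => D AD u.
have h1 := hA D (fsubset_trans (fsubsetUl _ _) AD) u.
have h2 := hB D (fsubset_trans (fsubsetUr _ _) AD) u.
rewrite big_split /= -scaler_sumr opprD addrACA -scalerBr [d]splitr mulrDl.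
apply: le_trans (nrmD _ _) _; rewrite lerD // nrmZ.
apply: le_trans (ler_wpM2l (normc_ge0 c) h1) _.
rewrite mulrA ler_wpM2r ?nrm_ge0 // mulrC; apply: frac_le; rewrite ?normc_ge0 //.
exact/ltW/half_gt0.
Qed.

End operator_sums.

Section tracial_algebra.
Context {R : realType} {V : hspace R} (C : (V -> V) -> Prop).
Implicit Types (u v w : V) (S T y z b : V -> V).
Hypothesis Cbop : forall S, C S -> bop S.
Hypothesis Cadj : forall S, C S -> C (adjV S).

(** The commutant of [C]. In the application [C] is itself the commutant of the U_j and their
    adjoints, so that this is a bicommutant. *)
Definition algN T := bop T /\ forall S, C S -> forall u, S (T u) = T (S u).

Lemma algN_bop T : algN T -> bop T. Proof. by case. Qed.
Hint Resolve algN_bop : core.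

Lemma algN_id : algN id. Proof. by split => //; exact: bop_id. Qed.
Lemma algN_comp S T : algN S -> algN T -> algN (S \o T).
Proof.
move=> [bS hS] [bT hT]; split; first exact: bop_comp.
by move=> P CP u /=; rewrite hS // hT.
Qed.
Lemma algN_lin (c : R[i]) S T : algN S -> algN T -> algN (fun u => c *: S u + T u).
Proof.
move=> [bS hS] [bT hT]; split; first exact: bop_lincomb.
by move=> P CP u /=; rewrite (bop_lin (Cbop CP)) hS // hT.
Qed.
Lemma algN_B S T : algN S -> algN T -> algN (fun u => S u - T u).
Proof.
move=> hS hT; have := algN_lin (-1) hT hS.
by congr algN; apply/funext => u; rewrite scaleN1r addrC.
Qed.
Lemma algN_Z (c : R[i]) S : algN S -> algN (fun u => c *: S u).
Proof.
move=> hS; have h0 := algN_B hS hS; have := algN_lin c hS h0.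
by congr algN; apply/funext => u; rewrite subrr addr0.
Qed.
Lemma algN_adj T : algN T -> algN (adjV T).
Proof.
move=> [bT hT]; split; first exact: adjV_bop.
move=> S CS u; have bS := Cbop CS; apply: ip_ext => w.
by rewrite ip_adj // !ip_adjl // ip_adj // hT //; exact: Cadj.
Qed.
Lemma algN_iter n T : algN T -> algN (iter n T).
Proof. by move=> hT; elim: n => [|n IH]; [exact: algN_id|exact: (algN_comp hT IH)]. Qed.
Lemma algN_sum (I : Type) (r : seq I) (F : I -> V -> V) :
  (forall i, algN (F i)) -> algN (fun u => \sum_(i <- r) F i u).
Proof.
move=> hF; elim: r => [|i r IH].
  have := algN_B algN_id algN_id; congr algN; apply/funext => u; by rewrite big_nil subrr.
have := algN_lin 1 (hF i) IH; congr algN; apply/funext => u.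
by rewrite big_cons scale1r.
Qed.
Lemma algN_norm_closed T : bop T ->
  (forall d : R, 0 < d -> exists2 S, algN S & obound (fun u => S u - T u) d) -> algN T.
Proof.
move=> bT h; split => // P CP u.
have bP := Cbop CP; have lP := bop_lin bP; have [c [c0 hc]] := bop_pos_bound bP.
apply/eqP; rewrite -subr_eq0; apply/eqP/nrm_small => e e0.
have k0 : 0 < 2 * c * (nrm u + 1) by rewrite !mulr_gt0 // ltr_wpDl ?nrm_ge0.
have [S [bS hS] hd] := h _ (divr_gt0 e0 k0).
set d := e / _ in hd.
have -> : P (T u) - T (P u) = (S (P u) - T (P u)) - P (S u - T u).
  by rewrite islinB // hS // opprB [RHS]addrC subrKA.
apply: le_trans (nrmB _ _) _.
have h1 : nrm (S (P u) - T (P u)) <= d * (c * nrm u).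
  by apply: le_trans (hd _) _; rewrite ler_wpM2l // divr_ge0 // ltW.
have h2 : nrm (P (S u - T u)) <= d * (c * nrm u).
  by apply: le_trans (hc _) _; rewrite mulrCA ler_wpM2l // ltW.
have h3 : d * (2 * c * (nrm u + 1)) = e by rewrite /d divfK // gt_eqF.
have d0 : 0 <= d by rewrite divr_ge0 // ltW.
have := mulr_ge0 d0 (ltW c0); lra.
Qed.
Lemma algN_sqrt B S : algN B -> bop S -> pos S -> S \o S = B -> algN S.
Proof.
move=> [bB hB] bS pS SB; split => // P CP u.
have h : P \o B = B \o P by apply/funext => w /=; exact: hB.
exact: (congr1 (@^~ u) (pos_sqrt_comm bS pS SB (Cbop CP) h)).
Qed.
Lemma algN_abs T : algN T -> algN (absV T).
Proof.
move=> hT; have [bA pA hA] := absVP (algN_bop hT).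
exact: algN_sqrt (algN_comp (algN_adj hT) hT) bA pA hA.
Qed.
Lemma algN_cplt T (c : R) : algN T -> algN (cplt T c).
Proof. by move=> hT; apply: algN_B; [exact: algN_id|exact: algN_Z]. Qed.
Lemma algN_happ T (c : R) N : algN T -> algN (happ T c N).
Proof. by move=> hT; apply: algN_sum => j; apply/algN_Z/algN_iter/algN_cplt. Qed.

(* W_k and X_k play the roles of the left and right multiplications by U^k. *)
Variables (J : choiceType) (W X : J -> V -> V) (Om : V).
Hypothesis W_N : forall k, algN (W k).
Hypothesis oW : onb (fun k => W k Om).
Hypothesis oWa : onb (fun k => adjV (W k) Om).
Hypothesis X_C : forall k, C (X k).
Hypothesis XE : forall k, X k Om = W k Om.
Hypothesis XaE : forall k, adjV (X k) Om = adjV (W k) Om.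
Hypothesis Om1 : nrm Om = 1.

Definition tr T := ip (T Om) Om.
Definition norm1 T := Re (tr (absV T)).

(** [T] commutes with the X_k, hence T W_k Om = T X_k Om = X_k T Om = 0 on a basis. *)
Lemma algN_sep T : algN T -> T Om = 0 -> T = fun=> 0.
Proof.
move=> [bT hT] T0; apply/funext => u; apply: vsums_unique (vsums_bop bT (parseval u oW)) _.
move=> d d0; exists fset0 => B _; rewrite big1 ?subrr ?nrm0 // => k _ /=.
rewrite (islinZ (bop_lin bT)) -XE -hT // T0.
by rewrite (islin0 (bop_lin (Cbop (X_C k)))) scaler0.
Qed.

Lemma algN_inj S T : algN S -> algN T -> S Om = T Om -> S = T.
Proof.
move=> hS hT h; have h0 : S Om - T Om = 0 by rewrite h subrr.
have E := algN_sep (algN_B hS hT) h0; apply/funext => u.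
by apply/eqP; rewrite -subr_eq0; apply/eqP; exact: (congr1 (@^~ u) E).
Qed.

Lemma tr_adj T : bop T -> tr (adjV T) = (tr T)^*.
Proof. by move=> bT; rewrite /tr ip_adjl // -ipC. Qed.

(** Acting on [Om], W_k can be replaced by X_k, which moves past [T]; then X_k^* Om = W_k^* Om turns
    it back into W_k. *)
Lemma trW T k : algN T -> tr (T \o W k) = tr (W k \o T).
Proof.
move=> [bT hT]; rewrite /tr /= -XE -hT //.
by rewrite !ip_adj ?XaE //; [exact: algN_bop|exact: Cbop].
Qed.

Lemma trWa T k : algN T -> tr (T \o adjV (W k)) = tr (adjV (W k) \o T).
Proof.
move=> hT; have bT := algN_bop hT; have bW := algN_bop (W_N k).
have h := trW k (algN_adj hT).
have -> : T \o adjV (W k) = adjV (W k \o adjV T) by rewrite adjV_comp ?adjVK //; exact: adjV_bop.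
have -> : adjV (W k) \o T = adjV (adjV T \o W k) by rewrite adjV_comp ?adjVK //; exact: adjV_bop.
by rewrite !tr_adj ?h //; apply: bop_comp => //; exact: adjV_bop.
Qed.

(* Both sides are expanded by Parseval's formula, over the bases W_k Om and
   W_k^* Om. *)
Lemma trC S T : algN S -> algN T -> tr (S \o T) = tr (T \o S).
Proof.
move=> hS hT; have bS := algN_bop hS; have bT := algN_bop hT.
have h1 : csums (fun k => tr (T \o W k) * tr (S \o adjV (W k))) (tr (S \o T)).
  rewrite /tr /= ip_adj //; have := parseval_ip (T Om) (adjV S Om) oWa.
  congr csums; apply/funext => k; have bW := algN_bop (W_N k).
  by rewrite -(ip_adj _ _ bW) -(ip_adj _ _ bS) -[ip (W k (T Om)) Om]/(tr (W k \o T)) -trW.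
have h2 : csums (fun k => tr (T \o W k) * tr (S \o adjV (W k))) (tr (T \o S)).
  rewrite [X in csums _ X]/tr /= ip_adj //; have := parseval_ip (S Om) (adjV T Om) oW.
  congr csums; apply/funext => k; have bW := algN_bop (W_N k).
  rewrite -(ip_adjl _ _ bW) -(ip_adj _ _ bT) -[ip (adjV (W k) (S Om)) Om]/(tr (adjV (W k) \o S)).
  by rewrite -trWa // mulrC.
exact: csums_unique h1 h2.
Qed.

Lemma nrm_adjOm T : algN T -> nrm (adjV T Om) = nrm (T Om).
Proof.
move=> hT; have bT := algN_bop hT; rewrite /nrm -ip_adj // -ip_adjl //.
by congr (Num.sqrt (Re _)); exact: (trC hT (algN_adj hT)).
Qed.

(** Right multiplication by [b] is bounded in the L_2-norm, because this norm is invariant under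
    adjoints: |T b Om| = |b^* T^* Om| <= c |T^* Om| = c |T Om|. *)
Lemma nrm_mulOm T b (c : R) : algN T -> algN b -> 0 <= c -> obound b c ->
  nrm (T (b Om)) <= c * nrm (T Om).
Proof.
move=> hT hb c0 bc; have bT := algN_bop hT; have bb := algN_bop hb.
rewrite -[T (b Om)]/((T \o b) Om) -nrm_adjOm; last exact: algN_comp.
rewrite adjV_comp //= -[in leRHS]nrm_adjOm //.
by have := obound_adj c0 bb bc; apply.
Qed.

(** With s = |T|^(1/2), take z = s and y^* = T h_N s. The error is T - T h_N |T| = T C^N, which has
    the norm of |T| C^N, at most c / (N + 1). As |T h_N s Om| = |(1 - C^N) s Om| <= 2 |s Om|,
    traciality gives the factor 4. *)
Lemma factorization T : algN T -> forall d : R, 0 < d -> exists y z, [/\ algN y, algN z,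
  obound (fun u => T u - adjV y (z u)) d, nrm (z Om) ^+ 2 = norm1 T
  & nrm (y Om) ^+ 2 <= 4 * norm1 T].
Proof.
move=> hT d d0; have bT := algN_bop hT; have [ba pa _] := absVP bT.
set a := absV T in ba pa; have ha : algN a by exact: algN_abs.
have [c [c0 hc]] := bop_pos_bound ba.
have [N hN] : exists N, c / N.+1%:R <= d.
  have [N hN] := inv_small (divr_gt0 d0 c0); exists N.
  by have := hN N (leqnn N); rewrite ltr_pdivlMr // mulrC => /ltW.
have [s [bs ps sa _]] := sqrt_ex ba pa.
have hs := algN_sqrt ha bs ps sa.
have hh : algN (happ a c N) by exact: algN_happ.
have aa u : a (happ a c N u) = happ a c N (a u).
  by apply: happ_comm => //; exact: bop_lin.
have hy : algN (T \o happ a c N \o s) by apply: algN_comp => //; exact: algN_comp.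
have n1 : nrm (s Om) ^+ 2 = norm1 T.
  rewrite nrm_sq -(pos_selfadj (bop_lin bs) ps) /norm1 /tr -/a.
  by congr (Re (ip _ _)); exact: (congr1 (@^~ Om) sa).
exists (adjV (T \o happ a c N \o s)), s; split => //; first exact: algN_adj.
  rewrite adjVK; last exact: algN_bop.
  move=> u /=; rewrite -[s (s u)]/((s \o s) u) sa -aa A_happ //.
  rewrite -(islinB (bop_lin bT)) subKr -nrm_absV //.
  apply: le_trans (A_cplt_bound ba pa c0 hc N u) _.
  by rewrite ler_wpM2r ?nrm_ge0.
rewrite nrm_adjOm // -n1 /= -nrm_absV // -/a A_happ //.
have -> : 4 * nrm (s Om) ^+ 2 = (2 * nrm (s Om)) ^+ 2 by ring.
rewrite ler_pXn2r ?nnegrE ?mulr_ge0 ?nrm_ge0 //.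
have := nrmB (s Om) (iter N (cplt a c) (s Om)).
have := iter_cplt_bound ba pa c0 hc N (s Om); lra.
Qed.

Lemma norm1_ge0 T : algN T -> 0 <= norm1 T.
Proof. by move=> hT; have [y [z [_ _ _ <- _]]] := factorization hT ltr01; exact: sqr_ge0. Qed.

Lemma factorization_form T : algN T -> forall d : R, 0 < d -> exists y z, [/\ algN y, algN z,
  forall u v, normc (ip (T u) v) <= nrm (z u) * nrm (y v) + d * nrm u * nrm v,
  nrm (z Om) ^+ 2 = norm1 T & nrm (y Om) ^+ 2 <= 4 * norm1 T].
Proof.
move=> hT d /(factorization hT)[y [z [hy hz h1 h2 h3]]]; exists y, z; split => // u v.
have -> : ip (T u) v = ip (z u) (y v) + ip (T u - adjV y (z u)) v.
  by rewrite ipBl ip_adjl ?subrKC //; exact: algN_bop.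
rewrite (le_trans (le_normcD _ _)) // lerD ?cauchy_schwarz //.
rewrite (le_trans (cauchy_schwarz _ _)) // ler_wpM2r ?nrm_ge0 //.
Qed.

(** For T close to y^* z, tr (T b) is close to <z b Om, y Om>, and |z b Om| <= c |z Om| while |y Om|
    <= 2 |z Om|. A genuine polar decomposition would give c in place of 2 c. *)
Lemma tr_bound T b (c : R) : algN T -> algN b -> 0 <= c -> obound b c ->
  normc (tr (T \o b)) <= 2 * c * norm1 T.
Proof.
move=> hT hb c0 hc; apply/ler_addgt0Pr => d d0.
have c1 : 0 < c + 1 by rewrite ltr_wpDl.
have [y [z [hy hz h1 h2 h3]]] := factorization_form hT (divr_gt0 d0 c1).
apply: le_trans (h1 _ _) _; rewrite Om1 mulr1 lerD //.
  have n0 := norm1_ge0 hT.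
  have hz' := nrm_mulOm hz hb c0 hc.
  have hy' : nrm (y Om) <= 2 * nrm (z Om).
    rewrite -(@ler_pXn2r _ 2) ?nnegrE ?mulr_ge0 ?nrm_ge0 // exprMn h2 (le_trans h3) //.
    by rewrite ler_wpM2r // ; lra.
  rewrite -h2; apply: le_trans (ler_pM (nrm_ge0 _) (nrm_ge0 _) hz' hy') _.
  rewrite le_eqVlt; apply/orP; left; apply/eqP; ring.
apply: le_trans (ler_wpM2l _ (hc Om)) _; first by rewrite divr_ge0 // ltW.
by rewrite Om1 mulr1; apply: frac_le => //; exact: ltW.
Qed.

(* tr |T| is the limit of tr (T h_N T^* ), where |h_N T^*| <= 2. *)
Lemma norm1_quasi S T : algN S -> algN T ->
  norm1 T <= 4 * (norm1 S + norm1 (fun u => T u - S u)).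
Proof.
move=> hS hT; apply/ler_addgt0Pr => d d0.
have bT := algN_bop hT; have [ba pa ea] := absVP bT.
set a := absV T in ba pa ea; have ha : algN a by exact: algN_abs.
have [c [c0 hc]] := bop_pos_bound ba.
have [N hN] : exists N, c / N.+1%:R <= d.
  have [N hN] := inv_small (divr_gt0 d0 c0); exists N.
  by have := hN N (leqnn N); rewrite ltr_pdivlMr // mulrC => /ltW.
set h := happ a c N; have hh : algN h by exact: algN_happ.
have la := bop_lin ba.
have aa u : a (h u) = h (a u) by apply: happ_comm.
pose b := h \o adjV T; have hb : algN b by apply: algN_comp => //; exact: algN_adj.
have ab : b = adjV (T \o h).
  rewrite adjV_comp //; last exact: algN_bop.
  congr (_ \o _); apply/esym/adjV_uniq; last exact: algN_bop.
  exact: happ_self.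
have b2 : obound b 2.
  rewrite ab; apply: obound_adj => //; first exact: algN_bop (algN_comp hT hh).
  move=> u /=; rewrite -nrm_absV // -/a A_happ //.
  have := nrmB u (iter N (cplt a c) u); have := iter_cplt_bound ba pa c0 hc N u; lra.
have E : tr (T \o b) = tr a - tr (a \o iter N (cplt a c)).
  rewrite -[T \o b]/((T \o h) \o adjV T) trC; [|exact: algN_comp|exact: algN_adj].
  rewrite compA -ea /tr /= -ipBl -(islinB la); congr ip.
  by rewrite A_happ.
have E1 : tr (T \o b) = tr (S \o b) + tr ((fun u => T u - S u) \o b).
  by rewrite /tr /= -ipDl subrKC.
have h1 := tr_bound hS hb (ler0n R 2) b2.
have h2 := tr_bound (algN_B hT hS) hb (ler0n R 2) b2.
have h3 : normc (tr (a \o iter N (cplt a c))) <= d.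
  rewrite /tr (le_trans (cauchy_schwarz _ _)) // Om1 mulr1.
  by apply: le_trans (A_cplt_bound ba pa c0 hc N Om) _; rewrite Om1 mulr1.
have E2 : tr a = tr (S \o b) + tr ((fun u => T u - S u) \o b) + tr (a \o iter N (cplt a c)).
  by rewrite -E1 E subrK.
rewrite /norm1 -/a; apply: le_trans (Re_le_normc _) _.
rewrite E2; apply: le_trans (le_normcD _ _) _; rewrite lerD //.
apply: le_trans (le_normcD _ _) _; lra.
Qed.

End tracial_algebra.

(** * Hilbert space quotient of a presentation *)

Record prehilbert (R : realType) (H : hilbert R) : Prop := Prehilbert {
  ph_dom0 : hdom (0 : H);
  ph_dom : forall (a : R[i]) (u v : H), hdom u -> hdom v -> hdom (a *: u + v);
  ph_ip : forall (a : R[i]) (u v w : H), hdom u -> hdom v -> hdom w ->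
    hip (a *: u + v) w = a * hip u w + hip v w;
  ph_ipC : forall u v : H, hdom u -> hdom v -> hip v u = (hip u v)^*;
  ph_ge0 : forall u : H, hdom u -> 0 <= hip u u;
  ph_complete : forall u : nat -> H, (forall i, hdom (u i)) ->
    (forall e : R, 0 < e -> exists N, forall i j, (N <= i)%N -> (N <= j)%N ->
       hnorm (u i - u j) < e) ->
    exists l, hdom l /\ forall e : R, 0 < e -> exists N, forall i, (N <= i)%N ->
       hnorm (u i - l) < e }.

(* The quotient by the null vectors, realized as the image of the map
   u |-> <u, .> into the space of functions. *)
Section hausdorff_quotient.
Context {R : realType} {H : hilbert R}.
Variable ph : prehilbert H.
Implicit Types (u v w : H).

Definition dual u : H -> R[i]^o := fun w => if `[< hdom w >] then hip u w else 0.

Definition is_dual (_ : prehilbert H) : {pred H -> R[i]^o} :=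
  fun f => `[< exists2 u, hdom u & f = dual u >].

Lemma dual_lin (a : R[i]) u v : hdom u -> hdom v -> dual (a *: u + v) = a *: dual u + dual v.
Proof.
move=> hu hv; apply/funext => w; rewrite /dual [RHS]/=.
rewrite -[RHS]/(a * (if `[< hdom w >] then hip u w else 0) + (if `[< hdom w >] then hip v w else 0)).
by case: asboolP => hw; rewrite ?(ph_ip ph) //= mulr0 addr0.
Qed.

Lemma is_dual_submod : submod_closed (is_dual ph).
Proof.
split.
  apply/asboolP; exists 0; first exact: ph_dom0.
  have := dual_lin (-1) (ph_dom0 ph) (ph_dom0 ph).
  by rewrite scaler0 addr0 scaleN1r addNr => ->.
move=> a f g /asboolP[u hu ->] /asboolP[v hv ->]; apply/asboolP.
by exists (a *: u + v); [exact: ph_dom | rewrite dual_lin].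
Qed.

HB.instance Definition _ := GRing.isSubmodClosed.Build R[i] (H -> R[i]^o) (is_dual ph) is_dual_submod.

Record quot := Quot { quot_fun : H -> R[i]^o; quotP : quot_fun \in is_dual ph }.
HB.instance Definition _ := [isSub for quot_fun].
HB.instance Definition _ := [Choice of quot by <:].
HB.instance Definition _ := [SubChoice_isSubLmodule of quot by <:].

Lemma quot_rep (f : quot) : exists u, hdom u /\ quot_fun f = dual u.
Proof. by case: f => f /= /asboolP[u hu ->]; exists u. Qed.

Definition qrep (f : quot) : H := xget 0 [set u | hdom u /\ quot_fun f = dual u]%classic.
Lemma qrepP f : hdom (qrep f) /\ quot_fun f = dual (qrep f).
Proof. by rewrite /qrep; case: xgetP => [u _ //|h]; have [u /h] := quot_rep f. Qed.

Lemma is_dual_dual u : hdom u -> dual u \in is_dual ph.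
Proof. by move=> hu; apply/asboolP; exists u. Qed.

Definition quotJ u : quot :=
  if pselect (hdom u) is left hu then Quot (is_dual_dual hu) else 0.

Lemma quotJE u : hdom u -> quot_fun (quotJ u) = dual u.
Proof. by move=> hu; rewrite /quotJ; case: pselect. Qed.

Lemma quot_ext (f g : quot) : quot_fun f = quot_fun g -> f = g.
Proof. exact: val_inj. Qed.

Lemma quotJ_rep f : quotJ (qrep f) = f.
Proof. by have [h1 h2] := qrepP f; apply: quot_ext; rewrite quotJE. Qed.

Lemma quot_linE (a : R[i]) (f g : quot) :
  quot_fun (a *: f + g) = a *: quot_fun f + quot_fun g.
Proof. by []. Qed.

Lemma quotJ_lin (a : R[i]) u v : hdom u -> hdom v -> quotJ (a *: u + v) = a *: quotJ u + quotJ v.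
Proof.
move=> hu hv; apply: quot_ext; rewrite quot_linE !quotJE ?dual_lin //.
exact: ph_dom.
Qed.

(** [f] already is a functional <u, .>, so only [g] calls for a representative, and linearity in [f]
    is immediate. *)
Definition qip (f g : quot) : R[i] := quot_fun f (qrep g).

Lemma dualE u w : hdom w -> dual u w = hip u w.
Proof. by move=> hw; rewrite /dual; case: asboolP. Qed.

Lemma qip_hip f g : qip f g = hip (qrep f) (qrep g).
Proof.
by rewrite /qip; have [_ ->] := qrepP f; rewrite dualE //; case: (qrepP g).
Qed.

Lemma qipJ u v : hdom u -> hdom v -> qip (quotJ u) (quotJ v) = hip u v.
Proof.
move=> hu hv; rewrite /qip quotJE //; have [h1 h2] := qrepP (quotJ v).
rewrite dualE // (ph_ipC ph) // -(dualE _ hu) -h2 quotJE // dualE //.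
by rewrite -(ph_ipC ph).
Qed.

Lemma qip_lin (a : R[i]) (f g k : quot) : qip (a *: f + g) k = a * qip f k + qip g k.
Proof. by rewrite /qip quot_linE. Qed.

Lemma qipC f g : qip g f = (qip f g)^*.
Proof.
rewrite !qip_hip; apply: (ph_ipC ph); by case: (qrepP f); case: (qrepP g).
Qed.

Lemma qip_ge0 f : 0 <= qip f f.
Proof. by rewrite qip_hip; apply: (ph_ge0 ph); case: (qrepP f). Qed.

Lemma hip_null u w : hdom u -> hdom w -> hip u u = 0 -> hip u w = 0.
Proof.
move=> hu hw u0; apply/eqP; apply: contraT => n0.
set z := hip u w in n0.
have nz : 0 < normc z ^+ 2.
  rewrite exprn_gt0 // lt_def normc_ge0 andbT; apply: contra n0 => /eqP h.
  exact/eqP/Normc.eq0_normc.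
(* The squared norm of [a *: u + w] with a = - t z^*. As <u, u> = 0 it is affine in [t], and cannot
   stay nonnegative for all [t] when z is nonzero. *)
have h (t : R) : 0 <= Re (hip w w) - 2 * t * normc z ^+ 2.
  set a := (- t)%:C * z^*.
  have hd := ph_dom ph a hu hw; have [+ _] := ge0_ReIm (ph_ge0 ph hd).
  rewrite (ph_ip ph) // [hip u (a *: u + w)](ph_ipC ph) // [hip w (a *: u + w)](ph_ipC ph) //.
  rewrite !(ph_ip ph) // u0 mulr0 add0r [hip w u](ph_ipC ph) // -/z.
  rewrite ReD conjJK ReJ ReD /a.
  have -> : Re ((- t)%:C * z^* * z) = - t * normc z ^+ 2.
    by rewrite -mulrA [z^* * z]mulrC mulcJ -rcM.
  lra.
move: (normc z ^+ 2) nz h => q q0 h.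
have := h ((Re (hip w w) + 1) / (2 * q)).
have -> : 2 * ((Re (hip w w) + 1) / (2 * q)) * q = Re (hip w w) + 1.
  by field; rewrite gt_eqF.
lra.
Qed.

Lemma qip_eq0 f : qip f f = 0 -> f = 0.
Proof.
rewrite qip_hip; have [h1 h2] := qrepP f => f0; apply: quot_ext; rewrite h2.
apply/funext => w; rewrite /dual; case: asboolP => hw //; exact: hip_null.
Qed.

Lemma hnorm_quot u : hdom u -> hnorm u = Num.sqrt (Re (qip (quotJ u) (quotJ u))).
Proof. by move=> hu; rewrite qipJ. Qed.

Lemma ph_domB u v : hdom u -> hdom v -> hdom (u - v).
Proof. by move=> hu hv; rewrite addrC -scaleN1r; exact: ph_dom. Qed.

Lemma quotJB u v : hdom u -> hdom v -> quotJ (u - v) = quotJ u - quotJ v.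
Proof. by move=> hu hv; rewrite addrC -scaleN1r quotJ_lin // scaleN1r addrC. Qed.

Lemma quot_complete (f : nat -> quot) :
  (forall e : R, 0 < e -> exists N, forall i j, (N <= i)%N -> (N <= j)%N ->
     Num.sqrt (Re (qip (f i - f j) (f i - f j))) < e) ->
  exists l, forall e : R, 0 < e -> exists N, forall i, (N <= i)%N ->
     Num.sqrt (Re (qip (f i - l) (f i - l))) < e.
Proof.
move=> hf; have hd i : hdom (qrep (f i)) by case: (qrepP (f i)).
have [|l [hl hl']] := ph_complete ph hd.
  move=> e e0; have [N hN] := hf e e0; exists N => i j iN jN.
  by rewrite hnorm_quot ?quotJB ?quotJ_rep //; [exact: hN|exact: ph_domB].
exists (quotJ l) => e e0; have [N hN] := hl' e e0; exists N => i iN.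
have := hN i iN; rewrite hnorm_quot ?quotJB ?quotJ_rep //; exact: ph_domB.
Qed.

Definition quot_hspace : hspace R :=
  @HSpace R quot qip qip_lin qipC qip_ge0 qip_eq0 quot_complete.

Lemma quot_presents : @presents R H quot_hspace quotJ.
Proof.
split.
- by move=> a u v hu hv; split; [exact: ph_dom | exact: quotJ_lin].
- by move=> u v hu hv; rewrite /= qipJ.
- by move=> x; exists (qrep x); rewrite quotJ_rep; case: (qrepP x).
Qed.

End hausdorff_quotient.

(** * Square integrable functions *)

Section square_integrable.
Context {R : realType} d (T : measurableType d) (mu : probability T R).
Implicit Types (f g h : T -> R[i]).

Definition cmeas f := measurable_fun setT (fun x => Re (f x)) /\
  measurable_fun setT (fun x => Im (f x)).
Definition cintegrable f := mu.-integrable setT (fun x => (Re (f x))%:E) /\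
  mu.-integrable setT (fun x => (Im (f x))%:E).
Definition cint f : R[i] := (\int[mu]_x Re (f x)) +i* (\int[mu]_x Im (f x)).
Definition I2 f : \bar R := (\int[mu]_x ((normc (f x)) ^+ 2)%:E)%E.
Definition inL2 f := cmeas f /\ (I2 f < +oo)%E.

Lemma cmeas_lin (a : R[i]) f g : cmeas f -> cmeas g -> cmeas (fun x => a * f x + g x).
Proof.
move=> [f1 f2] [g1 g2]; split.
  under eq_fun do rewrite ReD ReM.
  by apply: measurable_funD => //; apply: measurable_funB; apply: measurable_funM.
under eq_fun do rewrite ImD ImM.
by apply: measurable_funD => //; apply: measurable_funD; apply: measurable_funM.
Qed.

Lemma cmeasM f g : cmeas f -> cmeas g -> cmeas (fun x => f x * g x).
Proof.
move=> [f1 f2] [g1 g2]; split.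
  under eq_fun do rewrite ReM.
  by apply: measurable_funB; apply: measurable_funM.
under eq_fun do rewrite ImM.
by apply: measurable_funD; apply: measurable_funM.
Qed.

Lemma cmeasJ f : cmeas f -> cmeas (fun x => (f x)^*).
Proof.
move=> [f1 f2]; split; first by under eq_fun do rewrite ReJ.
by under eq_fun do rewrite ImJ; apply: measurable_funN.
Qed.

Lemma cmeas_cst (c : R[i]) : cmeas (fun=> c).
Proof. by split; exact: measurable_cst. Qed.

Lemma cmeas_normc2 f : cmeas f -> measurable_fun setT (fun x => normc (f x) ^+ 2).
Proof.
move=> [f1 f2]; under eq_fun do rewrite normc_sq.
by apply: measurable_funD; exact: measurable_funX.
Qed.

Lemma cmeas_normc f : cmeas f -> measurable_fun setT (fun x => normc (f x)).
Proof.
move=> /cmeas_normc2 hf.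
have -> : (fun x => normc (f x)) = Num.sqrt \o (fun x => normc (f x) ^+ 2).
  by apply/funext => x /=; rewrite sqrtr_sqr ger0_norm // normc_ge0.
apply: measurableT_comp hf; apply: measurable_realfun.continuous_measurable_fun.
exact: sqrt_continuous.
Qed.

Lemma emeas_normc2 f : cmeas f -> measurable_fun setT (fun x => (normc (f x) ^+ 2)%:E).
Proof. by move=> /cmeas_normc2 hf; exact/measurable_EFinP. Qed.

Lemma I2_ge0 f : (0 <= I2 f)%E.
Proof. by apply: integral_ge0 => x _; rewrite lee_fin sqr_ge0. Qed.

Lemma I2_le f g (c : R) : 0 <= c -> cmeas f -> cmeas g ->
  (forall x, normc (f x) ^+ 2 <= c * normc (g x) ^+ 2) -> (I2 f <= c%:E * I2 g)%E.
Proof.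
move=> c0 hf hg h; rewrite /I2 -ge0_integralZl //; last 2 first.
- exact: emeas_normc2.
- by move=> x _; rewrite lee_fin sqr_ge0.
apply: ge0_le_integral => //.
- by move=> x _; rewrite lee_fin sqr_ge0.
- exact: emeas_normc2.
- by apply: emeasurable_funM => //; exact: emeas_normc2.
- by move=> x _; rewrite -EFinM lee_fin.
Qed.

Lemma normcD_sq (z w : R[i]) : normc (z + w) ^+ 2 <= 2 * normc z ^+ 2 + 2 * normc w ^+ 2.
Proof.
have h := le_normcD z w; have z0 := normc_ge0 z; have w0 := normc_ge0 w.
have zw0 := normc_ge0 (z + w).
apply: (@le_trans _ _ ((normc z + normc w) ^+ 2)); first by rewrite ler_pXn2r // nnegrE addr_ge0.
have := sqr_ge0 (normc z - normc w); rewrite sqrrB sqrrD; lra.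
Qed.

Lemma I2_D f g : cmeas f -> cmeas g ->
  (I2 (fun x => f x + g x)%R <= 2%:E * I2 f + 2%:E * I2 g)%E.
Proof.
move=> hf hg; rewrite /I2 -!ge0_integralZl //; try by [exact: emeas_normc2|move=> x _; rewrite lee_fin sqr_ge0].
rewrite -ge0_integralD //.
- apply: ge0_le_integral => //.
  + by move=> x _; rewrite lee_fin sqr_ge0.
  + apply: emeas_normc2; have := cmeas_lin 1 hf hg.
    by congr cmeas; apply/funext => x; rewrite mul1r.
  + by apply: emeasurable_funD; apply: emeasurable_funM => //; exact: emeas_normc2.
  + by move=> x _; rewrite -!EFinM -EFinD lee_fin normcD_sq.
- by move=> x _; rewrite -EFinM lee_fin mulr_ge0 // sqr_ge0.
- by apply: emeasurable_funM => //; exact: emeas_normc2.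
- by move=> x _; rewrite -EFinM lee_fin mulr_ge0 // sqr_ge0.
- by apply: emeasurable_funM => //; exact: emeas_normc2.
Qed.

Lemma inL2_D f g : inL2 f -> inL2 g -> inL2 (fun x => f x + g x).
Proof.
move=> [mf hf] [mg hg]; split.
  by have := cmeas_lin 1 mf mg; congr cmeas; apply/funext => x; rewrite mul1r.
apply: le_lt_trans (I2_D mf mg) _.
by rewrite lte_add_pinfty // lte_mul_pinfty.
Qed.

Lemma inL2_Z (a : R[i]) f : inL2 f -> inL2 (fun x => a * f x).
Proof.
move=> [mf hf].
have ma : cmeas (fun x => a * f x) by apply: cmeasM => //; exact: cmeas_cst.
split => //; apply: (@le_lt_trans _ _ ((normc a ^+ 2)%:E * I2 f)%E).
  apply: I2_le => //; first exact: sqr_ge0.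
  by move=> x; rewrite Normc.normcM exprMn.
by rewrite lte_mul_pinfty // lee_fin sqr_ge0.
Qed.

Lemma inL2_lin (a : R[i]) f g : inL2 f -> inL2 g -> inL2 (fun x => a * f x + g x).
Proof. by move=> hf hg; apply: inL2_D => //; exact: inL2_Z. Qed.

Lemma inL2_0 : inL2 (fun=> 0).
Proof.
split; first exact: cmeas_cst.
rewrite /I2; under eq_integral do rewrite Normc.normc0 expr0n /=.
by rewrite integral0 ltry.
Qed.

Lemma dominated_cintegrable f (b : T -> R) : cmeas f ->
  mu.-integrable setT (fun x => (b x)%:E) -> (forall x, normc (f x) <= b x) -> cintegrable f.
Proof.
move=> [m1 m2] ib h; split; apply: le_integrable ib => //; try exact/measurable_EFinP.
  move=> x _; rewrite !abse_EFin lee_fin (le_trans (absRe_le_normc _)) // (le_trans (h x)) //.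
  exact: ler_norm.
move=> x _; rewrite !abse_EFin lee_fin (le_trans (Im_le_normc _)) // (le_trans (h x)) //.
exact: ler_norm.
Qed.

Lemma I2_integrable f : inL2 f -> mu.-integrable setT (fun x => (normc (f x) ^+ 2)%:E).
Proof.
move=> [mf hf]; apply/integrableP; split; first exact: emeas_normc2.
apply: le_lt_trans hf; rewrite le_eqVlt; apply/orP; left; apply/eqP.
by apply: eq_integral => x _; rewrite abse_EFin ger0_norm // sqr_ge0.
Qed.

Lemma cintegrable_mulJ f g : inL2 f -> inL2 g -> cintegrable (fun x => f x * (g x)^*).
Proof.
move=> hf hg; have [mf _] := hf; have [mg _] := hg.
apply: (@dominated_cintegrable _ (fun x => normc (f x) ^+ 2 + normc (g x) ^+ 2)).
- by apply: cmeasM => //; exact: cmeasJ.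
- by have := integrableD measurableT (I2_integrable hf) (I2_integrable hg).
move=> x; rewrite Normc.normcM normcJ.
have := sqr_ge0 (normc (f x) - normc (g x)); rewrite sqrrB.
have := mulr_ge0 (normc_ge0 (f x)) (normc_ge0 (g x)); lra.
Qed.

Lemma cint_lin (a : R[i]) f g : cintegrable f -> cintegrable g ->
  cint (fun x => a * f x + g x) = a * cint f + cint g.
Proof.
move=> [f1 f2] [g1 g2].
have Zi (c : R) (h : T -> R) : mu.-integrable setT (fun x => (h x)%:E) ->
    mu.-integrable setT (fun x => (c * h x)%:E).
  by move=> hh; have := integrableZl measurableT c hh.
have Bi (h k : T -> R) : mu.-integrable setT (fun x => (h x)%:E) ->
    mu.-integrable setT (fun x => (k x)%:E) -> mu.-integrable setT (fun x => (h x - k x)%:E).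
  by move=> hh hk; have := integrableB measurableT hh hk.
have Di (h k : T -> R) : mu.-integrable setT (fun x => (h x)%:E) ->
    mu.-integrable setT (fun x => (k x)%:E) -> mu.-integrable setT (fun x => (h x + k x)%:E).
  by move=> hh hk; have := integrableD measurableT hh hk.
apply: complex_ext; rewrite ?ReD ?ReM ?ImD ?ImM /cint /=.
  under eq_Rintegral do rewrite ReD ReM.
  rewrite RintegralD //; last exact: Bi (Zi _ _ _) (Zi _ _ _).
  by rewrite RintegralB //; [rewrite !RintegralZl | exact: Zi | exact: Zi].
under eq_Rintegral do rewrite ImD ImM.
rewrite RintegralD //; last exact: Di (Zi _ _ _) (Zi _ _ _).
by rewrite RintegralD //; [rewrite !RintegralZl | exact: Zi | exact: Zi].
Qed.

Lemma cintJ f : cintegrable f -> cint (fun x => (f x)^*) = (cint f)^*.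
Proof.
move=> [f1 f2]; apply: complex_ext; rewrite ?ReJ ?ImJ /cint /=.
  by apply: eq_Rintegral => x _; rewrite ReJ.
under eq_Rintegral do rewrite ImJ -mulN1r.
by rewrite RintegralZl // mulN1r.
Qed.

Lemma cint_sq f : cint (fun x => f x * (f x)^*) = (fine (I2 f))%:C.
Proof.
apply: complex_ext; rewrite /cint /=.
  by congr fine; apply: eq_integral => x _; rewrite mulcJ.
under eq_Rintegral do rewrite mulcJ /=.
by rewrite /Rintegral integral0.
Qed.

Lemma I2_fin f : inL2 f -> I2 f = (fine (I2 f))%:E.
Proof. by move=> [_ hf]; rewrite fineK // ge0_fin_numE // I2_ge0. Qed.

End square_integrable.

Local Open Scope classical_set_scope.

Lemma in_fset_seq (I : choiceType) (s : seq I) k : (k \in [fset i in s]%fset) = (k \in s).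
Proof. by rewrite in_fset. Qed.

(** * Completeness of L_2 *)

Section riesz_fischer.
Context {R : realType} d (T : measurableType d) (mu : probability T R).
Implicit Types (f g h : T -> R[i]).

Lemma cconv_Re (z : nat -> R[i]) l : cconv z l -> (fun k => Re (z k)) @ \oo --> Re l.
Proof.
move=> h; apply/cvgrPdist_lt => e e0; have [N hN] := h e e0; exists N => // i /= Ni.
by rewrite -ReB (le_lt_trans (absRe_le_normc _)) // normcBC hN.
Qed.

Lemma cconv_Im (z : nat -> R[i]) l : cconv z l -> (fun k => Im (z k)) @ \oo --> Im l.
Proof.
move=> h; apply/cvgrPdist_lt => e e0; have [N hN] := h e e0; exists N => // i /= Ni.
by rewrite -ImB (le_lt_trans (Im_le_normc _)) // normcBC hN.
Qed.

Lemma cconv_normc2 (z : nat -> R[i]) l (c : R[i]) : cconv z l ->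
  (fun k => normc (z k - c) ^+ 2) @ \oo --> normc (l - c) ^+ 2.
Proof.
move=> h; have {}h : (fun k => normc (z k - c)) @ \oo --> normc (l - c).
  apply/cvgrPdist_lt => e e0; have [N hN] := h e e0; exists N => // i /= Ni.
  have := hN i Ni; have := le_normcD (l - z i) (z i - c); have := le_normcD (z i - l) (l - c).
  rewrite !subrKA (normcBC l (z i)) ltr_norml; lra.
exact: (cvgM h h).
Qed.

Lemma cmeas_lim (w : nat -> T -> R[i]) f : (forall k, cmeas (w k)) ->
  (forall x, cconv (fun k => w k x) (f x)) -> cmeas f.
Proof.
move=> mw hw; split.
  apply: (@measurable_fun_cvg _ _ _ _ (fun k x => Re (w k x))) => [k|x _]; first by case: (mw k).
  exact: cconv_Re.
apply: (@measurable_fun_cvg _ _ _ _ (fun k x => Im (w k x))) => [k|x _]; first by case: (mw k).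
exact: cconv_Im.
Qed.

Lemma limn_einf_le (u : nat -> \bar R) (c : \bar R) : (forall n, (u n <= c)%E) -> (limn_einf u <= c)%E.
Proof.
move=> h; rewrite limn_einf_lim; apply: lime_le; first exact: is_cvg_einfs.
near=> n; apply: le_trans (h n); apply: ereal_inf_lbound; by exists n => /=.
Unshelve. all: by end_near. Qed.

Lemma I2_fatou (w : nat -> T -> R[i]) f g (c : \bar R) : (forall k, cmeas (w k)) -> cmeas g ->
  (forall x, cconv (fun k => w k x) (f x)) ->
  (forall k, (I2 mu (fun x => w k x - g x)%R <= c)%E) -> (I2 mu (fun x => f x - g x)%R <= c)%E.
Proof.
move=> mw mg hw hc.
have mB k : cmeas (fun x => w k x - g x).
  have := cmeas_lin (-1) mg (mw k); congr cmeas; apply/funext => x.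
  by rewrite mulN1r addrC.
have := @fatou _ _ _ mu setT measurableT (fun k x => (normc (w k x - g x) ^+ 2)%:E).
move=> /(_ (fun k => emeas_normc2 (mB k))) /(_ _) H.
apply: (@le_trans _ _ (limn_einf (fun k => I2 mu (fun x => w k x - g x)%R))); last exact: limn_einf_le.
apply: le_trans (H _); last by move=> k x _; rewrite lee_fin sqr_ge0.
rewrite le_eqVlt; apply/orP; left; apply/eqP; apply: eq_integral => x _; apply/esym.
have h1 := cconv_normc2 (c := g x) (hw x).
apply: (cvg_limn_einf_sup _).1; apply/cvg_EFin; first by apply: nearW.
exact: h1.
Qed.

Lemma geom_sum (n : nat) : \sum_(0 <= k < n) (2^-1 : R) ^+ k <= 2.
Proof.
suff -> : \sum_(0 <= k < n) (2^-1 : R) ^+ k = 2 - 2 * 2^-1 ^+ n.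
  by rewrite gerBl mulr_ge0 // exprn_ge0 // invr_ge0.
elim: n => [|n IH]; first by rewrite big_geq // expr0; lra.
by rewrite big_nat_recr //= IH exprS; field.
Qed.

(** Riesz-Fischer: a fast subsequence [v] has increments with integrable sum [G], hence converges
    where [G] is finite; the limit is set to 0 elsewhere. The second clause says that the limit
    depends on the point through the values of the sequence alone, which will preserve
    periodicity. *)
Lemma L2_complete (u : nat -> T -> R[i]) : (forall i, inL2 mu (u i)) ->
  (forall e : R, 0 < e -> exists N, forall i j, (N <= i)%N -> (N <= j)%N ->
     (I2 mu (fun x => u i x - u j x)%R < e%:E)%E) ->
  exists f, [/\ inL2 mu f, forall x y, (forall i, u i x = u i y) -> f x = f y
    & forall e : R, 0 < e -> exists N, forall i, (N <= i)%N ->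
       (I2 mu (fun x => u i x - f x)%R < e%:E)%E].
Proof.
move=> hu hC.
have mu_ i : cmeas (u i) by case: (hu i).
have mB f g : cmeas f -> cmeas g -> cmeas (fun x => f x - g x).
  move=> mf mg; have := cmeas_lin (-1) mg mf; congr cmeas; apply/funext => x.
  by rewrite mulN1r addrC.
have q0 k : 0 < (4^-1 : R) ^+ k by rewrite exprn_gt0 // invr_gt0.
have p0 k : 0 < (2^-1 : R) ^+ k by rewrite exprn_gt0 // invr_gt0.
have /choice[N hN] : forall k : nat, exists N, forall i j, (N <= i)%N -> (N <= j)%N ->
    (I2 mu (fun x => u i x - u j x)%R < ((4^-1 : R) ^+ k)%:E)%E by move=> k; exact: hC.
pose n := fix n k := if k is k'.+1 then maxn (N k) (n k') else N 0%N.
have Nn k : (N k <= n k)%N by case: k => [|k] //=; rewrite leq_maxl.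
have nS k j : (n k <= n (k + j))%N.
  by elim: j => [|j IH]; rewrite ?addn0 // addnS (leq_trans IH) //= leq_maxr.
pose v k := u (n k).
have mv k : cmeas (v k) by exact: mu_.
have vd k j : (I2 mu (fun x => v (k + j)%N x - v k x)%R < ((4^-1 : R) ^+ k)%:E)%E.
  by apply: hN; rewrite ?Nn // (leq_trans (Nn k)).
pose a k x := normc (v k.+1 x - v k x).
have ma k : measurable_fun setT (fun x => (a k x)%:E).
  by apply/measurable_EFinP; apply: cmeas_normc; apply: mB.
have ia k : (\int[mu]_x (a k x)%:E <= ((2^-1 : R) ^+ k)%:E)%E.
  set s := (2^-1 : R) ^+ k.
  have sE : s * s = 4^-1 ^+ k by rewrite /s -exprMn; congr (_ ^+ _); field.
  have s0 : 0 < s by exact: p0.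
  have sn : s != 0 by rewrite gt_eqF.
  (* Pointwise a <= s / 2 + a^2 / (2 s) with s = 2^-k; integrated over a probability space, this
     replaces the Cauchy-Schwarz inequality. *)
  apply: (@le_trans _ _ (\int[mu]_x ((s / 2)%:E + ((s^-1 / 2)%:E * ((a k x) ^+ 2)%:E)))%E).
    apply: ge0_le_integral => //.
    - by move=> x _; rewrite lee_fin normc_ge0.
    - apply: emeasurable_funD => //; apply: emeasurable_funM => //.
      by apply: emeas_normc2; apply: mB.
    move=> x _; rewrite -EFinM -EFinD lee_fin.
    have -> : s / 2 + s^-1 / 2 * a k x ^+ 2 = a k x + s^-1 / 2 * (a k x - s) ^+ 2 by field.
    by rewrite lerDl mulr_ge0 ?sqr_ge0 // divr_ge0 // invr_ge0 ltW.
  rewrite ge0_integralD //; last 3 first.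
  - by move=> x _; rewrite lee_fin divr_ge0 // ltW.
  - by move=> x _; rewrite -EFinM lee_fin mulr_ge0 ?sqr_ge0 // divr_ge0 // invr_ge0 ltW.
  - by apply: emeasurable_funM => //; apply: emeas_normc2; apply: mB.
  rewrite ge0_integralZl //; last 3 first.
  - by apply: emeas_normc2; apply: mB.
  - by move=> x _; rewrite lee_fin sqr_ge0.
  - by rewrite lee_fin divr_ge0 // invr_ge0 ltW.
  have -> : (\int[mu]__ (s / 2)%:E = (s / 2)%:E)%E.
    by have := integral_cst mu measurableT (s / 2)%:E; rewrite /cst => ->; rewrite [X in (_ * X)%E](@probability_setT _ _ _ mu) mule1.
  have hk := ltW (vd k 1%N); rewrite addn1 in hk.
  apply: (@le_trans _ _ ((s / 2)%:E + (s^-1 / 2)%:E * ((4^-1 : R) ^+ k)%:E)%E).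
    by rewrite leeD2l // lee_wpmul2l // lee_fin divr_ge0 // invr_ge0 ltW.
  rewrite -EFinM -EFinD lee_fin -sE.
  by have -> : s / 2 + s^-1 / 2 * (s * s) = s by field.
pose G x := (\sum_(0 <= k <oo) (a k x)%:E)%E.
have mG : measurable_fun setT G.
  by apply: ge0_emeasurable_sum => // k x _ _; rewrite lee_fin normc_ge0.
have G0 x : (0 <= G x)%E by apply: nneseries_ge0 => k _ _; rewrite lee_fin normc_ge0.
have iG : (\int[mu]_x G x <= 2%:E)%E.
  rewrite /G integral_nneseries //; last by move=> k x _; rewrite lee_fin normc_ge0.
  apply: lime_le.
    by apply: is_cvg_nneseries => k _ _; apply: integral_ge0 => x _; rewrite lee_fin normc_ge0.
  apply: nearW => m; apply: (@le_trans _ _ (\sum_(0 <= k < m) ((2^-1 : R) ^+ k)%:E)%E).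
    by apply: lee_sum => k _.
  by rewrite sumEFin lee_fin geom_sum.
have intG : mu.-integrable setT G.
  apply/integrableP; split => //; apply: le_lt_trans (ltry 2).
  apply: le_trans iG; rewrite le_eqVlt; apply/orP; left; apply/eqP.
  by apply: eq_integral => x _; rewrite gee0_abs.
pose A := [set x | (G x < +oo)%E].
have mA : measurable A.
  by have := emeasurable_fun_infty_o measurableT mG +oo%E; rewrite setTI.
pose ind x : R[i] := (\1_A x)%:C.
have mind : cmeas ind.
  by split; [exact: measurable_indic | exact: measurable_cst].
pose w k x := ind x * v k x.
have mw k : cmeas (w k) by apply: cmeasM.
have indP x : A x -> ind x = 1 by move=> Ax; rewrite /ind indicE mem_set.
have indN x : ~ A x -> ind x = 0 by move=> Ax; rewrite /ind indicE memNset.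
have cw x : exists l, cconv (fun k => w k x) l.
  have [Ax|Ax] := pselect (A x); last first.
    exists 0; have -> : (fun k => w k x) = fun=> 0 by apply/funext => k; rewrite /w indN // mul0r.
    exact: cconv_cst.
  have Gf : G x \is a fin_num by rewrite ge0_fin_numE.
  have bS (B : {fset nat}) : \sum_(k <- B) a k x <= fine (G x).
    pose m := (\max_(k <- B) k).+1.
    apply: (@le_trans _ _ (\sum_(0 <= k < m) a k x)).
      rewrite (_ : \sum_(0 <= k < m) a k x = \sum_(k <- [fset k in iota 0 m]%fset) a k x); last first.
        apply: perm_big; apply: uniq_perm; rewrite ?iota_uniq ?fset_uniq //.
        by move=> k; rewrite in_fset_seq /index_iota subn0.
      rewrite [leRHS](@big_fset_split _ _ B).
        by rewrite lerDl; apply: sumr_ge0 => k _; exact: normc_ge0.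
      apply/fsubsetP => k kB; rewrite in_fset_seq mem_iota add0n leq0n /= ltnS.
      exact: leq_bigmax_seq.
    rewrite -lee_fin fineK // -sumEFin; apply: nneseries_lim_ge => k _ _.
    by rewrite lee_fin normc_ge0.
  apply: ccauchy => e e0.
  have [B hB] := sum_tail (fun k => normc_ge0 (v k.+1 x - v k x)) bS (half_gt0 e0).
  pose m := (\max_(k <- B) k).+1.
  have tel k j : normc (w (k + j)%N x - w k x) <= \sum_(k <= i < k + j) a i x.
    rewrite /w indP // !mul1r; elim: j => [|j IH].
      by rewrite addn0 subrr Normc.normc0 big_geq.
    rewrite addnS big_nat_recr ?leq_addr //=.
    rewrite -[v _ x - v k x](subrKA (v (k + j)%N x)) addrC.
    by apply: le_trans (le_normcD _ _) _; rewrite lerD.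
  have small k : (m <= k)%N -> normc (w k x - w m x) < e / 2.
    move=> mk; rewrite -(subnKC mk); apply: le_lt_trans (tel _ _) _.
    rewrite subnKC // (_ : \sum_(m <= i < k) a i x = \sum_(i <- [fset i in index_iota m k]%fset) a i x).
      apply: hB => i; rewrite in_fset_seq mem_index_iota => /andP[mi _].
      apply/negP => iB; have : (i <= \max_(k <- B) k)%N by exact: leq_bigmax_seq.
      by rewrite leqNgt; move: mi; rewrite /m => ->.
    apply: perm_big; apply: uniq_perm; rewrite ?iota_uniq ?fset_uniq //.
    by move=> i; rewrite in_fset_seq.
  exists m => i j mi mj; rewrite -[w i x - _](subrKA (w m x)) (le_lt_trans (le_normcD _ _)) //.
  by rewrite [e]splitr ltrD ?small // normcBC small.
pose f x := climn (fun k => w k x).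
have hf x : cconv (fun k => w k x) (f x).
  by have [l hl] := cw x; rewrite /f (climn_cconv hl).
have mf : cmeas f := cmeas_lim mw hf.
have wv k j : (I2 mu (fun x => w (k + j)%N x - w k x)%R <= ((4^-1 : R) ^+ k)%:E)%E.
  apply: le_trans (ltW (vd k j)); rewrite -[leRHS]mul1e.
  apply: I2_le => //; [exact: mB | by apply: mB |] => x.
  rewrite mul1r /w -mulrBr Normc.normcM; have [Ax|Ax] := pselect (A x).
    by rewrite indP // Normc.normc1 mul1r.
  by rewrite indN // Normc.normc0 mul0r expr0n /= sqr_ge0.
(* Fatou's lemma along the later terms [w (k + j)] carries the Cauchy estimate over to the limit. *)
have fw k : (I2 mu (fun x => f x - w k x)%R <= ((4^-1 : R) ^+ k)%:E)%E.
  apply: (@I2_fatou (fun j => w (k + j)%N)) => // x e e0.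
  by have [M hM] := hf x e e0; exists M => j Mj; apply: hM; rewrite (leq_trans Mj) // leq_addl.
(* [v k] and [w k] differ at most where [G] is infinite, a null set because [G] is integrable. *)
have fv k : I2 mu (fun x => f x - v k x) = I2 mu (fun x => f x - w k x).
  apply: ge0_ae_eq_integral => //; try by [apply: emeas_normc2; apply: mB|move=> x _; rewrite lee_fin sqr_ge0].
  have := integrable_ae measurableT intG; apply: filterS => x /(_ I) Gx _.
  by rewrite /w indP ?mul1r // /A /= -ge0_fin_numE.
exists f; split.
- have l1 : inL2 mu (v 0%N) by exact: hu.
  have l2 : inL2 mu (fun x => f x - v 0%N x).
    by split; [exact: mB|rewrite fv (le_lt_trans (fw 0%N)) // ltry].
  by have := inL2_D l2 l1; congr inL2; apply/funext => x; rewrite subrK.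
- move=> x y xy; rewrite /f; congr climn; apply/funext => k.
  have vE i : v i x = v i y by rewrite /v xy.
  have GE : G x = G y by rewrite /G; congr (limn _); apply/funext => m; apply: eq_bigr => i _; rewrite /a !vE.
  by rewrite /w vE; congr (_ * _); rewrite /ind !indicE; congr ((_ : bool)%:R%:C); apply/idP/idP => /set_mem h; apply/mem_set; rewrite /A /= -?GE // GE.
- move=> e e0.
  have [k hk] : exists k, 4 * (4^-1 : R) ^+ k < e.
    have [k hk] := inv_small (divr_gt0 e0 (ltr0Sn R 3)); exists k.
    have h4 : (k.+1 <= 4 ^ k)%N by exact: ltn_expl.
    rewrite mulrC -ltr_pdivlMr //; apply: le_lt_trans (hk k (leqnn k)).
    by rewrite exprVn lef_pV2 ?posrE ?exprn_gt0 // -natrX ler_nat.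
  exists (n k) => i ki.
  have h1 : (I2 mu (fun x => u i x - v k x)%R < ((4^-1 : R) ^+ k)%:E)%E.
    by apply: hN; rewrite ?Nn // (leq_trans (Nn k)).
  have h2 : (I2 mu (fun x => v k x - f x)%R <= ((4^-1 : R) ^+ k)%:E)%E.
    apply: le_trans (fw k); rewrite -fv /I2 le_eqVlt; apply/orP; left; apply/eqP.
    by apply: eq_integral => x _; rewrite normcBC.
  have -> : (fun x => u i x - f x) = (fun x => (u i x - v k x) + (v k x - f x)).
    by apply/funext => x; rewrite subrKA.
  apply: le_lt_trans (I2_D mu (mB _ _ (mu_ i) (mu_ _)) (mB _ _ (mu_ _) mf)) _.
  apply: (@le_lt_trans _ _ (4 * (4^-1 : R) ^+ k)%:E); last by rewrite lte_fin.
  have -> : (4 * (4^-1 : R) ^+ k)%:E = (2%:E * ((4^-1 : R) ^+ k)%:E + 2%:E * ((4^-1 : R) ^+ k)%:E)%E.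
    by rewrite -EFinM -EFinD; congr EFin; lra.
  by rewrite leeD // lee_wpmul2l // ltW.
Qed.

End riesz_fischer.

(** * Trigonometric polynomials on the torus *)

Section trigonometric_functions.
Context {R : realType} (n : nat).
Local Notation pt := (@Defs.point R n).
Implicit Types (t : R) (x : pt).

Lemma expiD (s t : R) : expi (s + t) = expi s * expi t.
Proof. by apply: complex_ext; rewrite ?ReM ?ImM /= ?cosD ?sinD //; ring. Qed.
Lemma expi0 : expi (0 : R) = 1.
Proof. by rewrite /expi cos0 sin0. Qed.
Lemma expiN t : expi (- t) = (expi t)^*.
Proof. by apply: complex_ext; rewrite ?ReJ ?ImJ /= ?cosN ?sinN. Qed.
Lemma normc_expi t : normc (expi t) = 1.
Proof. by rewrite /= cos2Dsin2 sqrtr1. Qed.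
Lemma expi2pi : expi (2 * pi) = 1 :> R[i].
Proof.
have -> : (2 * pi : R) = pi *+ 2 by rewrite mulr_natl.
by rewrite /expi cos2pi sin2pi.
Qed.
Lemma expi2piz (z : int) : expi (2 * pi * z%:~R) = 1 :> R[i].
Proof.
have nat_case (m : nat) : expi (2 * pi * m%:R) = 1 :> R[i].
  elim: m => [|m IH]; first by rewrite mulr0 expi0.
  have -> : 2 * pi * m.+1%:R = 2 * pi * m%:R + 2 * pi :> R by rewrite -[m.+1%:R]natr1; ring.
  by rewrite expiD IH expi2pi mul1r.
case: z => m; first exact: nat_case.
by rewrite NegzE mulrNz mulrN expiN nat_case; apply: complex_ext; rewrite ?ReJ ?ImJ /= ?oppr0.
Qed.

Lemma expi_periodic (a : R) (z : int) : expi (a + 2 * pi * z%:~R) = expi a.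
Proof. by rewrite expiD expi2piz mulr1. Qed.

Lemma sum_int_delta (j : 'I_n) (x : pt) (c : int) :
  \sum_i (c * (i == j)%:R)%:~R * tnth x i = c%:~R * tnth x j :> R.
Proof.
rewrite (bigD1 j) //= eqxx mulr1 big1 ?addr0 // => i /negbTE ->.
by rewrite mulr0 mul0r.
Qed.

Definition ek (k : 'I_n -> int) (x : pt) : R[i] := expi (\sum_j (k j)%:~R * tnth x j).

Inductive ctrig : (pt -> R[i]) -> Prop :=
| ctrig_e k : ctrig (ek k)
| ctrig_lin (a : R[i]) f g : ctrig f -> ctrig g -> ctrig (fun x => a * f x + g x).

Lemma ekD k l x : ek k x * ek l x = ek (fun j => k j + l j) x.
Proof.
rewrite /ek -expiD -big_split /=; congr expi; apply: eq_bigr => j _.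
by rewrite intrD mulrDl.
Qed.

Lemma ek0 x : ek (fun=> 0) x = 1.
Proof. by rewrite /ek big1 ?expi0 // => j _; rewrite mul0r. Qed.

Lemma ctrig_eq f g : ctrig f -> (forall x, f x = g x) -> ctrig g.
Proof. by move=> hf /funext <-. Qed.

Lemma ctrig0 : ctrig (fun=> 0).
Proof.
apply: (ctrig_eq (ctrig_lin (-1) (ctrig_e (fun=> 0)) (ctrig_e (fun=> 0)))) => x.
by rewrite mulN1r addNr.
Qed.
Lemma ctrigZ a f : ctrig f -> ctrig (fun x => a * f x).
Proof. by move=> hf; apply: (ctrig_eq (ctrig_lin a hf ctrig0)) => x; rewrite addr0. Qed.
Lemma ctrig_cst a : ctrig (fun=> a).
Proof. by apply: (ctrig_eq (ctrigZ a (ctrig_e (fun=> 0)))) => x; rewrite ek0 mulr1. Qed.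
Lemma ctrigD f g : ctrig f -> ctrig g -> ctrig (fun x => f x + g x).
Proof. by move=> hf hg; apply: (ctrig_eq (ctrig_lin 1 hf hg)) => x; rewrite mul1r. Qed.
Lemma ctrigM f g : ctrig f -> ctrig g -> ctrig (fun x => f x * g x).
Proof.
elim=> [k|a f1 f2 _ IH1 _ IH2] hg.
  elim: hg => [l|a g1 g2 _ IH1 _ IH2].
    by apply: (ctrig_eq (ctrig_e (fun j => k j + l j))) => x; rewrite ekD.
  by apply: (ctrig_eq (ctrig_lin a IH1 IH2)) => x; rewrite mulrDr mulrCA.
by apply: (ctrig_eq (ctrig_lin a (IH1 hg) (IH2 hg))) => x; rewrite mulrDl mulrA.
Qed.
Lemma ctrigX f m : ctrig f -> ctrig (fun x => f x ^+ m).
Proof.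
move=> hf; elim: m => [|m IH]; first exact: ctrig_cst.
by apply: (ctrig_eq (ctrigM hf IH)) => x; rewrite exprS.
Qed.

Lemma ctrig_cos (j : 'I_n) (c : R) : ctrig (fun x => (cos (tnth x j - c))%:C).
Proof.
pose k (z : int) : 'I_n -> int := fun i => z * (i == j)%:R.
apply: (ctrig_eq (ctrigD (ctrigZ ((2^-1)%:C * expi (- c)) (ctrig_e (k 1)))
  (ctrigZ ((2^-1)%:C * expi c) (ctrig_e (k (-1)))))) => x.
rewrite /ek !sum_int_delta mul1r mulN1r -!mulrA -!expiD -mulrDr.
have -> : - c + tnth x j = tnth x j - c by rewrite addrC.
have -> : c - tnth x j = - (tnth x j - c) by rewrite opprB.
rewrite expiN; apply: complex_ext; rewrite ?ReM ?ImM ReD ImD ?ReJ ?ImJ /=; by field.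
Qed.

(* By Bernoulli's inequality stepp N u is at least 1 - N (2 u)^(2 N) and at most
   1 / (N (2 u)^(2 N)), hence the exponents. *)
Definition stepp (N : nat) (u : R) := (1 - u ^+ (2 * N)) ^+ (N * 4 ^ N).

Lemma stepp01 N u : 0 <= u <= 1 -> 0 <= stepp N u <= 1.
Proof.
move=> /andP[u0 u1]; have h0 : 0 <= u ^+ (2 * N) by exact: exprn_ge0.
have h1 : u ^+ (2 * N) <= 1 by exact: exprn_ile1.
by rewrite exprn_ge0 ?subr_ge0 //= exprn_ile1 ?subr_ge0 // gerBl.
Qed.

Lemma bernoulli_ub (a : R) M : 0 <= a <= 1 -> (1 - a) ^+ M * (1 + M%:R * a) <= 1.
Proof.
move=> /andP[a0 a1]; elim: M => [|M IH]; first by rewrite expr0 mul0r addr0 mulr1.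
rewrite exprS; apply: le_trans IH; rewrite -mulrA mulrCA ler_wpM2l ?exprn_ge0 ?subr_ge0 //.
rewrite -natr1; have := mulr_ge0 (ler0n R M) (sqr_ge0 a); have := sqr_ge0 a; nra.
Qed.

Lemma bernoulli_lb (a : R) M : 0 <= a <= 1 -> 1 - M%:R * a <= (1 - a) ^+ M.
Proof.
move=> /andP[a0 a1]; elim: M => [|M IH]; first by rewrite expr0 mul0r subr0.
rewrite exprS -natr1; have h : 0 <= (1 - a) ^+ M by rewrite exprn_ge0 // subr_ge0.
have := mulr_ge0 (ler0n R M) (sqr_ge0 a); nra.
Qed.

(** 1 - r^N is (1 - r) times a sum of N powers of r, each of them at least r^N. *)
Lemma nexp_le (r : R) N : 0 <= r -> r < 1 -> N%:R * r ^+ N <= (1 - r)^-1.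
Proof.
move=> r0 r1; have p : 0 < 1 - r by rewrite subr_gt0.
rewrite -[leRHS]div1r ler_pdivlMr //.
suff h : N%:R * r ^+ N * (1 - r) <= 1 - r ^+ N.
  by apply: le_trans h _; rewrite gerBl exprn_ge0.
elim: N => [|N IH]; first by rewrite mul0r mul0r expr0 subrr.
have h : 0 <= r ^+ N by rewrite exprn_ge0.
have h1 : r ^+ N <= 1 by rewrite exprn_ile1 // ltW.
rewrite exprS -natr1.
have e1 : (N%:R + 1) * (r * r ^+ N) * (1 - r) = r * (N%:R * r ^+ N * (1 - r)) + r ^+ N * r * (1 - r) by ring.
rewrite e1; have h2 := ler_wpM2l r0 IH.
have h3 : r ^+ N * r * (1 - r) <= 1 - r.
  rewrite -[leRHS]mul1r ler_wpM2r //; first exact: ltW.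
  by rewrite mulr_ile1 // ltW.
lra.
Qed.

(** The convergence holds at every point of [0, 1]. With r = 2 u < 1 the defect is at most (N r^N)
    r^N, where the first factor is bounded; for 2 u >= 1, including u = 1/2, the value is at most 1
    / (N + 1). *)
Lemma stepp_lim (u : R) : 0 <= u <= 1 -> (fun N => stepp N u) @ \oo --> ((u < 2^-1)%R%:R : R).
Proof.
move=> u01; have /andP[u0 u1] := u01.
have a01 N : 0 <= u ^+ (2 * N) <= 1 by rewrite exprn_ge0 // exprn_ile1.
have pw N : (2 * u) ^+ (2 * N) = (4 ^ N)%:R * u ^+ (2 * N).
  by rewrite exprMn exprM natrX; congr (_ ^+ _ * _); rewrite -natrX.
have [h|h] := ltP u 2^-1; apply/cvgrPdist_lt => e e0 /=.
  pose r := 2 * u; have r0 : 0 <= r by rewrite mulr_ge0.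
  have r1 : r < 1 by rewrite /r; lra.
  have p : 0 < 1 - r by rewrite subr_gt0.
  have /cvgrPdist_lt /(_ (e * (1 - r)) (mulr_gt0 e0 p))[N _ hN] : (GRing.exp r : R ^nat) @ \oo --> (0 : R).
    by apply: cvg_expr; rewrite ger0_norm.
  exists N => // M /= NM; have := hN M NM; rewrite /= sub0r normrN ger0_norm ?exprn_ge0 // => hM.
  have /andP[s0 s1] := stepp01 M u01.
  rewrite ger0_norm ?subr_ge0 //.
  have := bernoulli_lb (M * 4 ^ M) (a01 M); rewrite -/(stepp M u) => hb.
  have hc : (M * 4 ^ M)%:R * u ^+ (2 * M) = M%:R * r ^+ M * r ^+ M.
    by rewrite natrM -mulrA -pw -/r -mulrA -exprD mul2n -addnn.
  have h1 : M%:R * r ^+ M * r ^+ M <= (1 - r)^-1 * r ^+ M.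
    by rewrite ler_wpM2r ?exprn_ge0 // nexp_le.
  have h2 : (1 - r)^-1 * r ^+ M < e by rewrite mulrC ltr_pdivrMr.
  rewrite hc in hb; lra.
have [N hN] := inv_small e0; exists N => // M /= NM.
have /andP[s0 s1] := stepp01 M u01; rewrite sub0r normrN ger0_norm //.
apply: le_lt_trans (hN M NM).
have := bernoulli_ub (M * 4 ^ M) (a01 M); rewrite -/(stepp M u).
have hc : M%:R <= (M * 4 ^ M)%:R * u ^+ (2 * M).
  rewrite natrM -mulrA -pw ler_peMr //; apply: exprn_ege1; lra.
move=> hb; rewrite -[M.+1%:R^-1]mul1r ler_pdivlMr ?ltr0n //; apply: le_trans hb.
by rewrite ler_wpM2l // -[M.+1%:R]natr1 addrC lerD2l.
Qed.

(* A condition (j, c, b) stands for cos (x_j - c) > b. *)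
Definition ccond := ('I_n * R * R)%type.
Definition ccos (c : ccond) x := cos (tnth x c.1.1 - c.1.2).
Definition csat (s : seq ccond) x : bool := all (fun c => c.2 < ccos c x) s.
(** Affine rescaling of the cosine that sends the threshold b to 1/2; as |cos - b| <= 1 + |b|, it
    takes its values in [0, 1], the domain of [stepp_lim]. *)
Definition caff (c : ccond) x := 2^-1 - (ccos c x - c.2) * (2 * (1 + `|c.2|))^-1.
Definition cphi N (s : seq ccond) x := \prod_(c <- s) stepp N (caff c x).

Lemma caffP c x : 0 <= caff c x <= 1 /\ (caff c x < 2^-1) = (c.2 < ccos c x).
Proof.
have p : 0 < 2 * (1 + `|c.2|) by rewrite mulr_gt0 // ltr_wpDr.
have h1 := cos_geN1 (tnth x c.1.1 - c.1.2); have h2 := cos_le1 (tnth x c.1.1 - c.1.2).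
have h3 := ler_norm c.2; have h4 := ler_norm (- c.2); rewrite normrN in h4.
set q := (2 * (1 + `|c.2|))^-1 in h1 *.
have q0 : 0 < q by rewrite invr_gt0.
have qE : q * (1 + `|c.2|) = 2^-1.
  by rewrite /q; field; rewrite gt_eqF // ltr_wpDr.
rewrite /caff -/q /ccos; split.
  by apply/andP; split; nra.
by rewrite gtrBl pmulr_lgt0 // subr_gt0.
Qed.

Lemma cphi01 N s x : 0 <= cphi N s x <= 1.
Proof.
rewrite /cphi; elim: s => [|c s /andP[h1 h2]]; first by rewrite big_nil ler01 lexx.
rewrite big_cons; have /andP[h3 h4] := stepp01 N (caffP c x).1.
by rewrite mulr_ge0 // mulr_ile1.
Qed.

Lemma cphi_lim s x : (fun N => cphi N s x) @ \oo --> ((csat s x)%:R : R).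
Proof.
rewrite /cphi; elim: s => [|c s IH].
  by under eq_fun do rewrite big_nil; exact: cvg_cst.
under eq_fun do rewrite big_cons; rewrite /csat /= -mulnb natrM -(caffP c x).2.
by apply: cvgM IH; exact: stepp_lim (caffP c x).1.
Qed.

Lemma ctrig_cphi N s : ctrig (fun x => (cphi N s x)%:C).
Proof.
elim: s => [|c s IH].
  by apply: (ctrig_eq (ctrig_cst 1)) => x; rewrite /cphi big_nil.
suff h : ctrig (fun x => (stepp N (caff c x))%:C).
  by apply: (ctrig_eq (ctrigM h IH)) => x; rewrite /cphi big_cons rcM.
have h1 : ctrig (fun x => (caff c x)%:C).
  set q := (2 * (1 + `|c.2|))^-1.
  apply: (ctrig_eq (ctrigD (ctrig_cst (2^-1 + c.2 * q)%:C) (ctrigZ (- q)%:C (ctrig_cos c.1.1 c.1.2)))) => x.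
  by rewrite -rcM -rcD; congr (_%:C); rewrite /caff /ccos -/q; ring.
have h2 := ctrigX (2 * N) h1.
have h3 := ctrigD (ctrig_cst 1) (ctrigZ (-1) h2).
apply: (ctrig_eq (ctrigX (N * 4 ^ N) h3)) => x.
have -> : (stepp N (caff c x))%:C = (1 - (caff c x)%:C ^+ (2 * N)) ^+ (N * 4 ^ N) by rewrite /stepp rcX rcB rcX.
by rewrite mulN1r.
Qed.

Lemma csat_cat s s' x : csat (s ++ s') x = csat s x && csat s' x.
Proof. exact: all_cat. Qed.

Definition csets : set (set pt) := [set A | exists s, A = [set x | csat s x]].

Lemma csetsI : setI_closed csets.
Proof.
move=> _ _ [s ->] [s' ->]; exists (s ++ s'); apply/seteqP; split => x /=; rewrite csat_cat.
  by move=> [-> ->].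
by move=> /andP.
Qed.

Section monotone_class.
Variable P : (pt -> R) -> Prop.
Hypothesis Plin : forall (a : R) f g, P f -> P g -> P (fun x => a * f x + g x).
Hypothesis Plim : forall (F : nat -> pt -> R) f, (forall N, P (F N)) ->
  (forall N x, `|F N x| <= 1) -> (forall x, (fun N => F N x) @ \oo --> f x) -> P f.
Hypothesis Ptrig : forall f, ctrig f -> P (fun x => Re (f x)).

(** By the pi-lambda theorem it is enough to treat the sets in [csets], which are limits of
    trigonometric polynomials, complements and disjoint unions. *)
Lemma monotone_class_csets A : <<s csets >> A -> P (\1_A).
Proof.
rewrite -(setI_closed_g_dynkin_g_sigma_algebra csetsI); move: A.
apply: smallest_sub; last first.
  move=> _ [s ->]; apply: (Plim (F := fun N => cphi N s)).
  - by move=> N; exact: (Ptrig (ctrig_cphi N s)).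
  - by move=> N x; have /andP[h1 h2] := cphi01 N s x; rewrite ger0_norm.
  - move=> x; have := @cphi_lim s x; rewrite indicE.
    suff -> : (x \in [set x | csat s x]) = csat s x by [].
    by apply/idP/idP; rewrite inE.
have P1 : P (fun=> 1) by exact: (Ptrig (ctrig_cst 1)).
split.
- have := P1; congr P; apply/funext => x; by rewrite indicE in_setT.
- move=> A hA; have := Plin (-1) hA P1; congr P; apply/funext => x.
  by rewrite indicC indicE mulN1r; case: (x \in A); rewrite ?addNr ?oppr0 ?add0r.
- move=> F tF hF; pose S N x : R := \sum_(0 <= k < N) \1_(F k) x.
  have PS N : P (S N).
    elim: N => [|N IH].
      have := Plin (-1) P1 P1; congr P; apply/funext => x; by rewrite /S big_geq // mulN1r addNr.
    have := Plin 1 (hF N) IH; congr P; apply/funext => x.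
    by rewrite /S big_nat_recr //= mul1r addrC.
  (* By disjointness the partial sums are 0 or 1, as the uniform bound in [Plim] demands. *)
  have SE x j : F j x -> forall N, S N x = (j < N)%N%:R.
    move=> Fj N; rewrite /S.
    have E k : \1_(F k) x = (k == j)%:R :> R.
      rewrite indicE; case: eqP => [->|kj]; first by rewrite mem_set.
      rewrite memNset // => Fk; apply: kj; apply: (tF k j) => //; by exists x.
    under eq_bigr do rewrite E.
    elim: N => [|N IH]; first by rewrite big_geq.
    rewrite big_nat_recr //= IH -natrD ltnS; congr (_%:R).
    by case: (ltngtP N j).
  have SN x : (forall j, ~ F j x) -> forall N, S N x = 0.
    by move=> h N; rewrite /S big1 // => k _; rewrite indicE memNset.
  apply: (Plim (F := S)) => // [N x|x].
    have [[j Fj]|h] := pselect (exists j, F j x).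
      by rewrite (SE x j) //; case: (j < N)%N; rewrite ?normr1 ?normr0.
    by rewrite SN ?normr0 // => j Fj; apply: h; exists j.
  have [[j Fj]|h] := pselect (exists j, F j x).
    rewrite indicE mem_set; last by exists j.
    apply/cvgrPdist_lt => e e0; exists j.+1 => // N /= jN.
    by rewrite (SE x j) // jN subrr normr0.
  rewrite indicE memNset; last by move=> [j _ Fj]; apply: h; exists j.
  apply/cvgrPdist_lt => e e0; exists 0%N => // N /= _.
  by rewrite SN ?subrr ?normr0 // => j Fj; apply: h; exists j.
Qed.

End monotone_class.

Definition red1 (t : R) : R := t - 2 * pi * (Num.floor (t / (2 * pi)))%:~R.
Definition red x : pt := [tuple (red1 (tnth x i) : measurableTypeR R) | i < n].

Lemma red1_itv t : 0 <= red1 t < 2 * pi.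
Proof.
have p : 0 < 2 * pi :> R := two_pi_gt0; rewrite /red1.
have h1 := Num.Theory.ge_floor (t / (2 * pi)); have h2 := Num.Theory.lt_succ_floor (t / (2 * pi)).
set m := (Num.floor _)%:~R in h1 h2 *.
rewrite subr_ge0 ltrBlDl; apply/andP; split.
  by rewrite mulrC -ler_pdivlMr.
by move: h2; rewrite intrD1 ltr_pdivrMr // mulrDl mul1r mulrC.
Qed.

Lemma cos_sin_red1 t : cos (red1 t) = cos t /\ sin (red1 t) = sin t.
Proof.
have := expi_periodic (red1 t) (Num.floor (t / (2 * pi))).
by rewrite {1}/red1 subrK => -[-> ->].
Qed.

(** Describes the reduced coordinate through sine and cosine only: the sign of the sine tells the
    two halves of [0, 2 pi) apart, and the cosine is monotone on each of them. *)
Lemma red1_lt t b : (red1 t < b) =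
  (0 < b) && ((2 * pi <= b) || if b <= pi then (0 <= sin t) && (cos b < cos t)
                              else (0 <= sin t) || (cos t < cos b)).
Proof.
have [<- <-] := cos_sin_red1 t; have /andP[s0 s2] := red1_itv t.
move: (red1 t) s0 s2 => s s0 s2; have p0 := pi_gt0 R.
have [b0|b0] := ltP 0 b => /=; last by apply/negbTE; rewrite -leNgt (le_trans b0).
have [b2|b2] := leP (2 * pi) b => /=; first by rewrite (lt_le_trans s2).
have sinneg (u : R) : pi < u -> u < 2 * pi -> sin u < 0.
  move=> u1 u2; have : 0 < sin (u - pi) by apply: sin_gt0_pi; apply/andP; split; lra.
  by have := sinDpi (u - pi); rewrite subrK => ->; rewrite oppr_lt0.
have cosrefl (u : R) : cos u = cos (2 * pi - u).
  have -> : 2 * pi - u = - u + pi *+ 2 by rewrite -mulr_natl; lra.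
  by rewrite cosD2pi cosN.
have [sp|sp] := leP s pi.
  have ss : 0 <= sin s by apply: sin_ge0_pi; rewrite s0.
  have [bp|bp] := leP b pi; rewrite ss /=; last by rewrite (le_lt_trans sp).
  by rewrite ltr_cos // in_itv /= ?s0 ?sp ?bp ?(ltW b0).
have ss := sinneg s sp s2; rewrite [0 <= sin s]leNgt ss /=.
have [bp|bp] := leP b pi; first by apply/negbTE; rewrite -leNgt (le_trans bp) // ltW.
rewrite (cosrefl s) (cosrefl b) ltr_cos ?in_itv /=; last 2 first.
- by apply/andP; split; lra.
- by apply/andP; split; lra.
by rewrite ltrD2l ltrN2.
Qed.

Let csT := g_sigma_algebraType csets.

Lemma csets_cond (c : ccond) : measurable ([set x | c.2 < ccos c x] : set csT).
Proof.
apply: sub_gen_smallest; exists [:: c]; apply/seteqP.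
by split=> x /=; rewrite /csat /= andbT.
Qed.

(** Trigonometric functions only see points modulo 2 pi, so not all Borel sets are generated by
    [csets]; their preimages under [red] are. *)
Lemma red_measurable : measurable_fun setT (red : csT -> pt).
Proof.
apply/measurable_fun_tnthP => i.
have -> : (@tnth n (measurableTypeR R) ^~ i \o (red : csT -> pt)) = fun x => red1 (tnth x i).
  by apply/funext => x /=; rewrite tnth_mktuple.
apply: (@measurability _ _ csT (measurableTypeR R) setT (fun x : csT => red1 (tnth x i)) _ (RGenCInfty.measurableE R)) => _ [_ [b ->] <-]; rewrite setTI.
have -> : (fun x : csT => red1 (tnth x i)) @^-1` `[b, +oo[ = ~` [set x : csT | red1 (tnth x i) < b].
  by apply/seteqP; split=> x /=; rewrite in_itv /= andbT leNgt => /negP.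
apply: measurableC.
have mcos (d : R) : measurable [set x : csT | d < cos (tnth x i)].
  have := csets_cond (i, 0, d); congr measurable; apply/seteqP.
  by split=> x /=; rewrite /ccos /= subr0.
have mcosN (d : R) : measurable [set x : csT | cos (tnth x i) < d].
  have := csets_cond (i, pi, - d); congr measurable; apply/seteqP.
  have E (x : csT) : cos (tnth x i - pi) = - cos (tnth x i).
    by rewrite -[in RHS](subrK pi (tnth x i)) cosDpi opprK.
  by split=> x /=; rewrite /ccos /= E ltrN2.
(* The complement of the condition cos (x_i + pi / 2) > 0, that is - sin x_i > 0. *)
have msin : measurable [set x : csT | 0 <= sin (tnth x i)].
  have := measurableC (csets_cond (i, - (pi / 2), 0)); congr measurable; apply/seteqP.
  by split=> x /=; rewrite /ccos /= opprK cosDpihalf oppr_gt0 leNgt => /negP.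
have [b0|b0] := ltP 0 b; last first.
  rewrite (_ : [set x | _] = set0) //; apply/seteqP; split=> x //=.
  by rewrite red1_lt ltNge b0.
have [b2|b2] := leP (2 * pi) b.
  rewrite (_ : [set x | _] = setT) //; apply/seteqP; split=> x //= _.
  by rewrite red1_lt b0 b2.
have [bp|bp] := leP b pi.
  rewrite (_ : [set x | _] = [set x : csT | 0 <= sin (tnth x i)] `&` [set x | cos b < cos (tnth x i)]).
    exact: measurableI.
  apply/seteqP; split=> x /=; rewrite red1_lt b0 [2 * pi <= b]leNgt b2 bp /=; first by move=> /andP.
  by move=> [-> ->].
rewrite (_ : [set x | _] = [set x : csT | 0 <= sin (tnth x i)] `|` [set x | cos (tnth x i) < cos b]).
  exact: measurableU.
apply/seteqP; split=> x /=; rewrite red1_lt b0 [2 * pi <= b]leNgt b2 [b <= pi]leNgt bp /=; first by move=> /orP.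
by move=> [->|->] //; rewrite orbT.
Qed.

(* Applied to translation invariance of the integral, and to orthogonality to a
   given function. *)
Lemma monotone_class_red (P : (pt -> R) -> Prop) :
  (forall (a : R) f g, P f -> P g -> P (fun x => a * f x + g x)) ->
  (forall (F : nat -> pt -> R) f, (forall N, P (F N)) ->
    (forall N x, `|F N x| <= 1) -> (forall x, (fun N => F N x) @ \oo --> f x) -> P f) ->
  (forall f, ctrig f -> P (fun x => Re (f x))) ->
  forall A : set (pt), measurable A -> P (fun x => \1_A (red x)).
Proof.
move=> h1 h2 h3 A mA; have := red_measurable measurableT mA; rewrite setTI => mA'.
have := monotone_class_csets h1 h2 h3 mA'; congr P; apply/funext => x.
Qed.

End trigonometric_functions.

Section bounded_measurable.
Context d (T : measurableType d) {R : realType} (P : probability T R).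
Implicit Types f g : T -> R.

Definition bmeas f := measurable_fun setT f /\ exists c, forall x, `|f x| <= c.

Lemma bmeas_lin (a : R) f g : bmeas f -> bmeas g -> bmeas (fun x => a * f x + g x).
Proof.
move=> [mf [c hc]] [mg [b hb]]; split.
  by apply: measurable_funD => //; apply: measurable_funM.
exists (`|a| * c + b) => x; apply: le_trans (ler_normD _ _) _.
by rewrite normrM lerD // ler_wpM2l.
Qed.

Lemma bmeasM f g : bmeas f -> bmeas g -> bmeas (fun x => f x * g x).
Proof.
move=> [mf [c hc]] [mg [b hb]]; split; first exact: measurable_funM.
by exists (c * b) => x; rewrite normrM ler_pM.
Qed.

Lemma bmeas_integrable f : bmeas f -> P.-integrable setT (EFin \o f).
Proof.
move=> [mf [c hc]].
apply: (@le_integrable _ _ _ P setT measurableT (EFin \o f) (EFin \o cst c)).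
- exact/measurable_EFinP.
- by move=> x _ /=; rewrite lee_fin (le_trans (hc x)) // ler_norm.
- exact: finite_measure_integrable_cst.
Qed.

Lemma prob_Rintegral_cst (c : R) : \int[P]_x c = c.
Proof.
have h := @probability_setT _ _ _ P.
by have := Rintegral_cst P measurableT c; rewrite [X in fine X]h mulr1.
Qed.

Lemma bmeas_integrableM f g : bmeas f -> P.-integrable setT (EFin \o g) ->
  P.-integrable setT (fun x => (f x * g x)%:E).
Proof.
move=> [mf [c hc]] ig; have /integrableP[/measurable_EFinP mg _] := ig.
apply: (@le_integrable _ _ _ P setT measurableT _ (fun x => (c%:E * (g x)%:E)%E)).
- by apply/measurable_EFinP; exact: measurable_funM.
- move=> x _; rewrite -EFinM lee_fin !normrM ler_pM //.
  by rewrite (le_trans (hc x)) // ler_norm.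
- exact: integrableZl.
Qed.

Lemma bmeas_lim_int g (F : nat -> T -> R) f c : P.-integrable setT (EFin \o g) ->
  (forall N, measurable_fun setT (F N)) -> (forall N x, `|F N x| <= c) ->
  (forall x, (fun N => F N x) @ \oo --> f x) ->
  [/\ measurable_fun setT f, forall x, `|f x| <= c
   & (fun N => \int[P]_x (F N x * g x)) @ \oo --> \int[P]_x (f x * g x)].
Proof.
move=> ig mF bF lF; have mf : measurable_fun setT f.
  by apply: (measurable_fun_cvg mF) => x _; exact: lF.
have bf x : `|f x| <= c.
  have h : (fun N => `|F N x|) @ \oo --> `|f x| by exact: (cvg_norm (lF x)).
  rewrite -(cvg_lim _ h) //; apply: limr_le; first exact: cvgP h.
  by near=> N; exact: bF.
split => //.
have /integrableP[/measurable_EFinP mg _] := ig.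
have [||||| h1 _ h2] := @dominated_convergence _ _ _ P setT measurableT
  (fun N x => (F N x * g x)%:E) (fun x => (f x * g x)%:E) (fun x => (c%:E * `|(g x)%:E|)%E).
- by move=> N; apply/measurable_EFinP; exact: measurable_funM.
- by apply/measurable_EFinP; exact: measurable_funM.
- apply: aeW => x _; apply: cvg_EFin; first by near=> N.
  by apply: cvgMl; exact: lF.
- by apply: integrableZl => //; exact: integrable_abse.
- by apply: aeW => x N _; rewrite -EFinM lee_fin normrM ler_wpM2r.
by apply: fine_cvg; rewrite fineK //; exact: integrable_fin_num.
Unshelve. all: by end_near.
Qed.

End bounded_measurable.

(** * Integrals of exponentials over the torus *)

Section torus_integrals.
Context {R : realType}.
Local Notation unif := (uniform_prob (@two_pi_gt0 R)).

Lemma uniform_primitive (f F : R -> R) : (forall t, 0 <= f t) -> continuous f ->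
  (forall t : R, is_derive t 1 F (f t)) ->
  (\int[unif]_t (f t)%:E = ((2 * pi)^-1 * (F (2 * pi) - F 0))%:E)%E.
Proof.
move=> f0 cf dF.
rewrite integral_uniform; last first.
- by move=> x; rewrite lee_fin.
- by apply/measurable_EFinP; exact: continuous_measurable_fun.
have cF t : {for t, continuous F}.
  by apply: differentiable_continuous; apply/derivable1_diffP; have [] := dF t.
rewrite subr0 (@continuous_FTC2 _ f F) ?two_pi_gt0 //.
- exact: continuous_subspaceT.
- split; first by move=> t _; have [] := dF t.
  + by apply: cvg_at_right_filter; exact: cF.
  + by apply: cvg_at_left_filter; exact: cF.
- by move=> t _; rewrite derive1E; have [_ ->] := dF t.
Qed.

Lemma bmeas_cos (c : R) : bmeas (fun t : measurableTypeR R => cos (c * t)).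
Proof.
split; last by exists 1 => t; rewrite ler_norml cos_geN1 cos_le1.
apply: continuous_measurable_fun => t.
by apply: (@continuous_comp _ _ _ ( *%R c) cos); [exact: mulrl_continuous|exact: continuous_cos].
Qed.

Lemma bmeas_sin (c : R) : bmeas (fun t : measurableTypeR R => sin (c * t)).
Proof.
split; last by exists 1 => t; rewrite ler_norml sin_geN1 sin_le1.
apply: continuous_measurable_fun => t.
by apply: (@continuous_comp _ _ _ ( *%R c) sin); [exact: mulrl_continuous|exact: continuous_sin].
Qed.

(** [uniform_primitive] is stated for nonnegative functions; it is applied to 1 + h, with primitive
    t + H t. *)
Lemma uniform_oscillating (h H : R -> R) : bmeas (h : measurableTypeR R -> R) ->
  (forall t, -1 <= h t) -> continuous h ->
  (forall t : R, is_derive t 1 H (h t)) -> H (2 * pi) = H 0 -> \int[unif]_t (h t) = 0.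
Proof.
move=> bh h1 ch dH HE.
have p : 2 * pi != 0 :> R by rewrite gt_eqF // two_pi_gt0.
have h2 : (\int[unif]_t (1 + h t)%:E = 1)%E.
  rewrite (@uniform_primitive (fun t => 1 + h t) (fun t => t + H t)).
  - have -> : 2 * pi + H (2 * pi) - (0 + H 0) = 2 * pi by rewrite HE; ring.
    by rewrite mulVf.
  - by move=> t; have := h1 t; lra.
  - by move=> t; apply: cvgD; [exact: cvg_cst|exact: ch].
have b1 : bmeas (cst 1 : measurableTypeR R -> R).
  by split; [exact: measurable_cst|exists 1 => t; rewrite normr1].
have := RintegralD measurableT (bmeas_integrable unif b1) (bmeas_integrable unif bh).
rewrite (prob_Rintegral_cst unif 1) /Rintegral h2 /= => h3.
lra.
Qed.

Lemma cint_expi (k : int) :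
  cint unif (fun t : measurableTypeR R => expi (k%:~R * t)) = (k == 0)%:R.
Proof.
have [->|k0] := eqVneq k 0.
  apply: complex_ext; rewrite /cint /=; under eq_Rintegral do rewrite mul0r ?cos0 ?sin0.
    exact: prob_Rintegral_cst.
  exact: prob_Rintegral_cst.
have c0 : k%:~R != 0 :> R by rewrite intr_eq0.
have [e1 e2] : cos (k%:~R * (2 * pi)) = 1 :> R /\ sin (k%:~R * (2 * pi)) = 0 :> R.
  by have := @expi2piz R k; rewrite mulrC => -[].
have cc : continuous (fun t : R => cos (k%:~R * t)).
  by move=> t; apply: (@continuous_comp _ _ _ ( *%R (k%:~R : R)) cos); [exact: mulrl_continuous|exact: continuous_cos].
have cs : continuous (fun t : R => sin (k%:~R * t)).
  by move=> t; apply: (@continuous_comp _ _ _ ( *%R (k%:~R : R)) sin); [exact: mulrl_continuous|exact: continuous_sin].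
apply: complex_ext; rewrite /cint /=.
  apply: (@uniform_oscillating _ (fun t => k%:~R^-1 * sin (k%:~R * t))) => //.
  - exact: bmeas_cos.
  - by move=> t; exact: cos_geN1.
  - move=> t; apply: is_derive_eq; rewrite /GRing.scale /=; by field.
  - by rewrite e2 !mulr0 sin0 mulr0.
apply: (@uniform_oscillating _ (fun t => - k%:~R^-1 * cos (k%:~R * t))) => //.
- exact: bmeas_sin.
- by move=> t; exact: sin_geN1.
- move=> t; apply: is_derive_eq; rewrite /GRing.scale /=; by field.
- by rewrite e1 mulr0 cos0 ?mulr1.
Qed.

Lemma prod_Rintegral d1 d2 (T1 : measurableType d1) (T2 : measurableType d2)
    (P1 : probability T1 R) (P2 : probability T2 R) f g :
  bmeas f -> bmeas g -> bmeas (fun p : T1 * T2 => f p.1 * g p.2) /\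
  \int[(P1 \x P2)%E]_p (f p.1 * g p.2) = \int[P1]_x f x * \int[P2]_y g y.
Proof.
move=> bf bg; have h : bmeas (fun p : T1 * T2 => f p.1 * g p.2).
  apply: bmeasM.
    have [mf [c hc]] := bf; split; last by exists c => x; exact: hc.
    exact: measurableT_comp mf measurable_fst.
  have [mf [c hc]] := bg; split; last by exists c => x; exact: hc.
  exact: measurableT_comp mf measurable_snd.
split=> //.
have i1 := bmeas_integrable P1 bf; have i2 := bmeas_integrable P2 bg.
rewrite {1}/Rintegral -(integral12_prod_meas1 (bmeas_integrable (P1 \x P2)%E h)) /fubini_F.
under eq_integral => x _.
  rewrite (eq_integral (fun y => ((f x)%:E * (g y)%:E)%E)) //.
  rewrite integralZl //.
  over.
have e2 : (\int[P2]_y (g y)%:E)%E = (\int[P2]_y g y)%:E.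
  by rewrite fineK //; exact: integrable_fin_num.
rewrite e2 /= integralZr // -[X in (X * _)%E]fineK //; exact: integrable_fin_num.
Qed.

Lemma torus_Rintegral n (g : measurableTypeR R -> R) (h : n.-tuple (measurableTypeR R) -> R) :
  bmeas g -> bmeas h ->
  bmeas (fun x : n.+1.-tuple (measurableTypeR R) => g (thead x) * h [tuple of behead x]) /\
  \int[torus_measure n.+1]_x (g (thead x) * h [tuple of behead x]) =
   \int[unif]_t g t * \int[torus_measure n]_y h y.
Proof.
move=> bg bh; have [h1 h2] := prod_Rintegral unif (torus_measure n) bg bh.
have h3 : bmeas (fun x : n.+1.-tuple (measurableTypeR R) => g (thead x) * h [tuple of behead x]).
  apply: bmeasM.
    have [mg [c hc]] := bg; split; last by exists c => x; exact: hc.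
    exact: measurableT_comp mg (measurable_tnth ord0).
  have [mh [c hc]] := bh; split; last by exists c => x; exact: hc.
  exact: measurableT_comp mh (@measurable_behead _ _ _).
split=> //; rewrite -h2 /Rintegral; congr fine.
have E (p : measurableTypeR R * n.-tuple (measurableTypeR R)) :
    g (thead (consT p)) * h [tuple of behead (consT p)] = g p.1 * h p.2.
  by congr (_ * h _); apply: val_inj.
rewrite integral_distribution.
- by apply: eq_integral => p _ /=; rewrite E.
- by apply/measurable_EFinP; case: h3.
- apply: eq_integrable (bmeas_integrable _ h1) => // p _ /=; by rewrite E.
Qed.

End torus_integrals.

(** * Translation invariance and totality of the exponentials *)

Section torus_functions.
Context {R : realType}.
Local Notation unif := (uniform_prob (@two_pi_gt0 R)).

Definition cbmeas d (T : measurableType d) (f : T -> R[i]) :=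
  bmeas (fun x => Re (f x)) /\ bmeas (fun x => Im (f x)).

Lemma cbmeas_cmeas d (T : measurableType d) (f : T -> R[i]) : cbmeas f -> cmeas f.
Proof. by move=> [[m1 _] [m2 _]]. Qed.

Lemma cbmeas_cintegrable d (T : measurableType d) (P : probability T R) (f : T -> R[i]) :
  cbmeas f -> cintegrable P f.
Proof. by move=> [h1 h2]; split; exact: bmeas_integrable. Qed.

Lemma bmeas_cst d (T : measurableType d) (c : R) : bmeas (fun _ : T => c).
Proof. by split; [exact: measurable_cst|exists `|c|]. Qed.

Lemma cbmeas_lin d (T : measurableType d) (a : R[i]) (f g : T -> R[i]) :
  cbmeas f -> cbmeas g -> cbmeas (fun x => a * f x + g x).
Proof.
move=> [f1 f2] [g1 g2]; split.
  have := bmeas_lin (Re a) f1 (bmeas_lin (- Im a) f2 g1); congr bmeas; apply/funext => x.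
  by rewrite ReD ReM; ring.
have := bmeas_lin (Re a) f2 (bmeas_lin (Im a) f1 g2); congr bmeas; apply/funext => x.
by rewrite ImD ImM; ring.
Qed.

Lemma cint_cst d (T : measurableType d) (P : probability T R) (c : R[i]) :
  cint P (fun=> c) = c.
Proof. by apply: complex_ext; rewrite /cint /= prob_Rintegral_cst. Qed.

Lemma torus_cint n (g : measurableTypeR R -> R[i]) (h : n.-tuple (measurableTypeR R) -> R[i]) :
  cbmeas g -> cbmeas h ->
  cbmeas (fun x : n.+1.-tuple (measurableTypeR R) => g (thead x) * h [tuple of behead x]) /\
  cint (torus_measure n.+1) (fun x => g (thead x) * h [tuple of behead x]) =
   cint unif g * cint (torus_measure n) h.
Proof.
move=> [g1 g2] [h1 h2].
have [m11 i11] := torus_Rintegral g1 h1; have [m12 i12] := torus_Rintegral g1 h2.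
have [m21 i21] := torus_Rintegral g2 h1; have [m22 i22] := torus_Rintegral g2 h2.
split.
  split.
    have := bmeas_lin (-1) m22 m11; congr bmeas; apply/funext => x.
    by rewrite ReM; ring.
  have := bmeas_lin 1 m21 m12; congr bmeas; apply/funext => x.
  by rewrite ImM; ring.
apply: complex_ext; rewrite ?ReM ?ImM [LHS]/=.
  under eq_Rintegral do rewrite ReM.
  by rewrite RintegralB //; [rewrite i11 i22|exact: bmeas_integrable..].
under eq_Rintegral do rewrite ImM.
by rewrite RintegralD //; [rewrite i12 i21|exact: bmeas_integrable..].
Qed.

Lemma cint_ek n (k : 'I_n -> int) :
  cbmeas (@ek R n k) /\
  cint (torus_measure n) (@ek R n k) = ([forall j, k j == 0])%:R.
Proof.
elim: n k => [|n IH] k.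
  have E : ek k = (fun=> 1 : R[i]) by apply/funext => x; rewrite /ek big_ord0 expi0.
  rewrite E cint_cst; split; first by split; exact: bmeas_cst.
  by rewrite (_ : [forall j, _] = true) //; apply/forallP => -[].
have [h1 h2] := IH (fun j => k (lift ord0 j)).
have E : ek k = (fun x : n.+1.-tuple (measurableTypeR R) =>
    (fun t : measurableTypeR R => expi ((k ord0)%:~R * t)) (thead x) *
      ek (fun j => k (lift ord0 j)) [tuple of behead x]).
  apply/funext => x; rewrite /ek big_ord_recl expiD; congr (_ * expi _).
  apply: eq_bigr => i _; congr (_ * _); rewrite tnth_behead; congr tnth.
  by apply: val_inj; rewrite /= inordK // ltnS.
have bg : cbmeas (fun t : measurableTypeR R => expi ((k ord0)%:~R * t)).
  by split; [exact: bmeas_cos|exact: bmeas_sin].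
have [h3 h4] := torus_cint bg h1.
rewrite E; split=> //; rewrite h4 h2 cint_expi -natrM mulnb; congr (nat_of_bool _)%:R.
apply/idP/idP => [/andP[/eqP k0 /forallP k1]|/forallP h].
  by apply/forallP => j; case: (unliftP ord0 j) => [i|] ->; [exact: k1|rewrite k0].
by rewrite h; apply/forallP => j; exact: h.
Qed.

Section fixed_dimension.
Variable n : nat.
Local Notation pt := (@Defs.point R n).
Local Notation mu := (@torus_measure R n).

Lemma ctrig_cbmeas (f : pt -> R[i]) : ctrig f -> cbmeas f.
Proof. by elim=> [k|a {}f g _ hf _ hg]; [have [] := cint_ek k|exact: cbmeas_lin]. Qed.

Lemma ctrigJ (f : pt -> R[i]) : ctrig f -> ctrig (fun x => (f x)^*).
Proof.
elim=> [k|a {}f g _ hf _ hg].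
  apply: (ctrig_eq (ctrig_e (fun j => - k j))) => x; rewrite /ek -expiN; congr expi.
  by rewrite -sumrN; apply: eq_bigr => j _; rewrite mulrNz mulNr.
by apply: (ctrig_eq (ctrig_lin a^* hf hg)) => x; rewrite conjcD conjcM.
Qed.

Lemma ctrigRe (f : pt -> R[i]) : ctrig f -> ctrig (fun x => (Re (f x))%:C).
Proof.
move=> hf; apply: (ctrig_eq (ctrigZ (2^-1)%:C (ctrigD hf (ctrigJ hf)))) => x.
by apply: complex_ext; rewrite ?ReM ?ImM ReD ImD ReJ ImJ /=; field.
Qed.

Lemma translateD (x : pt) (a b : 'I_n -> R) :
  translate (translate x a) b = translate x (fun i => a i + b i).
Proof. by apply: eq_from_tnth => i; rewrite !tnth_mktuple addrA. Qed.

Lemma translate0 (x : pt) : translate x (fun=> 0) = x.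
Proof. by apply: eq_from_tnth => i; rewrite !tnth_mktuple addr0. Qed.

Lemma ek_translate (k : 'I_n -> int) (x : pt) a :
  ek k (translate x a) = expi (\sum_j (k j)%:~R * a j) * ek k x.
Proof.
rewrite /ek -expiD -big_split /=; congr expi; apply: eq_bigr => j _.
by rewrite tnth_mktuple mulrDr addrC.
Qed.

Lemma translate_measurable a : measurable_fun setT (fun x : pt => translate x a : pt).
Proof.
apply/measurable_fun_tnthP => i.
have -> : (@tnth n (measurableTypeR R) ^~ i \o (fun x : pt => translate x a)) =
    fun x => tnth x i + a i :> measurableTypeR R.
  by apply/funext => x /=; rewrite tnth_mktuple.
apply: (@measurable_funD _ pt R setT (fun x => tnth x i)) => //.
exact: measurable_tnth.
Qed.

Lemma cmeas_translate (f : pt -> R[i]) a : cmeas f -> cmeas (fun x => f (translate x a)).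
Proof.
by move=> [m1 m2]; split; [exact: measurableT_comp m1 (translate_measurable a)
                          |exact: measurableT_comp m2 (translate_measurable a)].
Qed.

Lemma bmeas_translate (f : pt -> R) a : bmeas f -> bmeas (fun x => f (translate x a)).
Proof.
move=> [m [c hc]]; split; last by exists c => x; exact: hc.
exact: measurableT_comp m (translate_measurable a).
Qed.

(** The monotone class argument with measurability as [P]: indicators composed with [red] are limits
    built from trigonometric polynomials. *)
Lemma red_meas : measurable_fun setT (fun x : pt => red x : pt).
Proof.
move=> _ A mA; rewrite setTI.
have h : measurable_fun setT (fun x : pt => \1_A (red x) : R).
  apply: (@monotone_class_red R n (fun f => measurable_fun setT f)) => //.
  - by move=> a f g hf hg; apply: measurable_funD => //; exact: measurable_funM.
  - by move=> F f hF _ hl; apply: (measurable_fun_cvg hF) => x _; exact: hl.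
  - by move=> f /ctrig_cbmeas /cbmeas_cmeas [].
have := h measurableT [set 1] (measurable_set1 _); rewrite setTI; congr measurable.
apply/seteqP; split=> x /=; rewrite indicE.
  by case: (boolP (red x \in A)) => [/set_mem //|_ /esym /eqP]; rewrite oner_eq0.
by move=> /mem_set ->.
Qed.

Lemma cint_ek_translate (k : 'I_n -> int) a :
  cint mu (fun x => ek k (translate x a)) = cint mu (ek k).
Proof.
have [b i] := cint_ek k; under [in LHS]eq_fun do rewrite ek_translate.
have -> : (fun x => expi (\sum_j (k j)%:~R * a j) * ek k x) =
   (fun x => expi (\sum_j (k j)%:~R * a j) * ek k x + (fun=> 0) x) :> (pt -> R[i]).
  by apply/funext => x; rewrite addr0.
rewrite cint_lin; last 2 first.
- exact: cbmeas_cintegrable.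
- by apply: cbmeas_cintegrable; split; exact: bmeas_cst.
rewrite cint_cst addr0 i; case: forallP => [h|]; last by rewrite mulr0.
by rewrite big1 ?expi0 ?mul1r // => j _; rewrite (eqP (h j)) mul0r.
Qed.

Lemma cint_ctrig_translate (f : pt -> R[i]) a : ctrig f ->
  cint mu (fun x => f (translate x a)) = cint mu f.
Proof.
have tr (g : pt -> R[i]) : ctrig g -> cbmeas (fun x => g (translate x a)).
  by move=> /ctrig_cbmeas [h1 h2]; split; [exact: (bmeas_translate a h1)|exact: (bmeas_translate a h2)].
elim=> [k|b {}f g hf IHf hg IHg]; first exact: cint_ek_translate.
rewrite (cint_lin b (f := fun x => f (translate x a)) (g := fun x => g (translate x a))); last 2 first.
- exact/cbmeas_cintegrable/tr.
- exact/cbmeas_cintegrable/tr.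
by rewrite IHf IHg cint_lin //; exact/cbmeas_cintegrable/ctrig_cbmeas.
Qed.

(** Translation multiplies [ek k] by a constant, and only k = 0, where this constant is 1, has a
    nonzero integral; the monotone class argument does the rest. *)
Lemma red_translate (A : set pt) a : measurable A ->
  \int[mu]_x (\1_A (red (translate x a)) : R) = \int[mu]_x (\1_A (red x) : R).
Proof.
move=> mA.
pose P (f : pt -> R) := bmeas f /\ \int[mu]_x f (translate x a) = \int[mu]_x f x.
suff [] : P (fun x => \1_A (red x)) by [].
apply: monotone_class_red => //.
- move=> c f g [bf hf] [bg hg]; split; first exact: bmeas_lin.
  have Zi h : bmeas h -> mu.-integrable setT (EFin \o (fun x => c * h x)).
    by move=> bh; have := bmeas_integrable mu (bmeas_lin c bh (bmeas_cst _ 0)); congr integrable; apply/funext => x /=; rewrite addr0.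
  have bft := bmeas_translate a bf; have bgt := bmeas_translate a bg.
  rewrite (RintegralD (f1 := fun x => c * f (translate x a)) (f2 := fun x => g (translate x a))) //; [|exact: Zi bft|exact: bmeas_integrable].
  rewrite RintegralD //; [|exact: Zi|exact: bmeas_integrable].
  rewrite !RintegralZl //; try exact: bmeas_integrable.
  by rewrite hf hg.
- move=> F f hF bF lF.
  have i1 : mu.-integrable setT (EFin \o (fun=> 1 : R)) by apply: bmeas_integrable; exact: bmeas_cst.
  have [m1 b1 l1] := @bmeas_lim_int _ _ _ mu (fun=> 1) F f 1 i1 (fun N => (hF N).1.1) bF lF.
  have [m2 b2 l2] := @bmeas_lim_int _ _ _ mu (fun=> 1) (fun N x => F N (translate x a)) (fun x => f (translate x a)) 1 i1
    (fun N => (bmeas_translate a (hF N).1).1) (fun N x => bF N _) (fun x => lF _).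
  split; first by split=> //; exists 1.
  have e1 (g : pt -> R) : \int[mu]_x (g x * 1) = \int[mu]_x g x by apply: eq_Rintegral => x _; rewrite mulr1.
  rewrite e1 in l1; rewrite e1 in l2.
  rewrite -(cvg_lim _ l1) // -(cvg_lim _ l2) //; congr (lim (_ @ \oo)); apply/funext => N.
  by rewrite !e1 (hF N).2.
- move=> f hf; split; first by case: (ctrig_cbmeas hf).
  have := cint_ctrig_translate a (ctrigRe hf).
  by move=> /(congr1 (fun z : R[i] => Re z)).
Qed.

(** Both sides are integrals of [G] for push-forward measures, along [red] and along [red] after the
    translation, which coincide by [red_translate]. *)
Lemma torus_translate (G : pt -> \bar R) a : measurable_fun setT G ->
  (forall x, 0 <= G x)%E -> (forall x, G (red x) = G x) ->
  (\int[mu]_x G (translate x a) = \int[mu]_x G x)%E.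
Proof.
move=> mG G0 Gr.
have mt : measurable_fun setT (fun x : pt => red (translate x a) : pt).
  exact: measurableT_comp red_meas (translate_measurable a).
have mr : measurable_fun setT (fun x : pt => red x : pt) := red_meas.
have -> : (\int[mu]_x G (translate x a) = \int[pushforward mu (fun x : pt => red (translate x a) : pt)]_x G x)%E.
  rewrite ge0_integral_pushforward //.
  by apply: eq_integral => x _ /=; rewrite Gr.
have -> : (\int[mu]_x G x = \int[pushforward mu (fun x : pt => red x : pt)]_x G x)%E.
  rewrite ge0_integral_pushforward //.
  by apply: eq_integral => x _ /=; rewrite Gr.
apply: eq_measure_integral => A mA _; rewrite /pushforward.
have key (phi : pt -> pt) : measurable_fun setT phi ->
    mu (phi @^-1` A) = (\int[mu]_x (\1_A (phi x) : R))%:E.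
  move=> mphi; have mp : measurable (phi @^-1` A) by rewrite -[X in measurable X]setTI; exact: mphi.
  rewrite /Rintegral (_ : (fun x => (\1_A (phi x))%:E) = (fun x => (\1_(phi @^-1` A) x)%:E)) //.
  rewrite integral_indic // setIT fineK // fin_num_measure //.
transitivity (mu ((fun x => red (translate x a)) @^-1` A)) => //.
by rewrite key // red_translate // -(key (fun x => red x)).
Qed.

(** The integer vectors giving periods of [f] form a subgroup that contains the standard basis. *)
Lemma periodic_int (V : Type) (f : pt -> V) (z : 'I_n -> int) :
  (forall (j : 'I_n) (x : pt), f (translate x (fun i => 2 * pi * (i == j)%:R)) = f x) ->
  forall x, f (translate x (fun i => 2 * pi * (z i)%:~R)) = f x.
Proof.
move=> pf; pose S (v : {ffun 'I_n -> int}) := forall x, f (translate x (fun i => 2 * pi * (v i)%:~R)) = f x.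
have S0 : S 0 by move=> x; rewrite -[in RHS](translate0 x); congr (f (translate x _)); apply/funext => i; rewrite ffunE mulr0.
have SD u v : S u -> S v -> S (u + v).
  move=> hu hv x; rewrite -[RHS](hu x) -[RHS](hv (translate x _)) translateD; congr (f (translate x _)).
  by apply/funext => i; rewrite ffunE intrD; ring.
have SN u : S u -> S (- u).
  move=> hu x; rewrite -[LHS](hu (translate x _)) translateD -[in RHS](translate0 x); congr (f (translate x _)).
  by apply/funext => i; rewrite ffunE mulrNz; ring.
have SM u (m : int) : S u -> S [ffun i => u i * m].
  move=> hu; have h k : S [ffun i => u i * k%:Z].
    elim: k => [|k IH].
      by move: S0; congr S; apply/ffunP => i; rewrite !ffunE mulr0.
    by have := SD _ _ hu IH; congr S; apply/ffunP => i; rewrite !ffunE -[k.+1]add1n PoszD mulrDr mulr1.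
  case: m => k; first exact: h.
  by have := SN _ (h k.+1); congr S; apply/ffunP => i; rewrite !ffunE NegzE mulrN.
pose z' := \sum_j [ffun i => [ffun i => (i == j : nat)%:R : int] i * z j] : {ffun 'I_n -> int}.
have -> : z = z'.
  apply/funext => i; rewrite /z' sum_ffunE (bigD1 i) //= big1 => [|j ji]; first by rewrite !ffunE eqxx mul1r addr0.
  by rewrite !ffunE eq_sym (negbTE ji) mul0r.
suff : S z' by []; rewrite /z'.
apply: (big_ind S) => // j _; apply: SM => x; rewrite -(pf j x); congr (f (translate x _)).
by apply/funext => i; rewrite ffunE; case: (i == j).
Qed.

Lemma periodic_red (V : Type) (f : pt -> V) :
  (forall (j : 'I_n) (x : pt), f (translate x (fun i => 2 * pi * (i == j)%:R)) = f x) ->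
  forall x, f (red x) = f x.
Proof.
move=> pf x; rewrite -(periodic_int (fun i => - Num.floor (tnth x i / (2 * pi))) pf x); congr f.
by apply: eq_from_tnth => i; rewrite !tnth_mktuple /red1 mulrNz mulrN.
Qed.

Lemma I2_translate (f : pt -> R[i]) a : cmeas f -> (forall x, f (red x) = f x) ->
  I2 mu (fun x => f (translate x a)) = I2 mu f.
Proof.
move=> mf fr; apply: (torus_translate a (G := fun x => (normc (f x) ^+ 2)%:E)).
- exact: emeas_normc2.
- by move=> x; rewrite lee_fin sqr_ge0.
- by move=> x; rewrite fr.
Qed.

Lemma cint_mul_lim (f : pt -> R[i]) (F : nat -> pt -> R) phi : cintegrable mu f ->
  (forall N, measurable_fun setT (F N)) -> (forall N x, `|F N x| <= 1) ->
  (forall x, (fun N => F N x) @ \oo --> phi x) -> (forall N, cint mu (fun x => (F N x)%:C * f x) = 0) ->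
  bmeas phi /\ cint mu (fun x => (phi x)%:C * f x) = 0.
Proof.
move=> [f1 f2] mF bF lF h.
have [m1 b1 l1] := bmeas_lim_int f1 mF bF lF; have [_ _ l2] := bmeas_lim_int f2 mF bF lF.
split; first by split => //; exists 1.
have e (g : pt -> R) : cint mu (fun x => (g x)%:C * f x) =
    (\int[mu]_x (g x * Re (f x))) +i* (\int[mu]_x (g x * Im (f x))).
  by rewrite /cint; congr Complex; apply: eq_Rintegral => x _; rewrite ?ReM ?ImM /= mul0r ?subr0 ?addr0.
rewrite e -(cvg_lim _ l1) // -(cvg_lim _ l2) //.
have E N : (\int[mu]_x (F N x * Re (f x)) = 0) /\ (\int[mu]_x (F N x * Im (f x)) = 0).
  by have := h N; rewrite e => -[-> ->].
under eq_fun do rewrite (E _).1; rewrite lim_cst //.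
by under eq_fun do rewrite (E _).2; rewrite lim_cst.
Qed.

(** Orthogonality extends from exponentials to the indicators of preimages of Borel sets under
    [red]. Since [f] is invariant under [red], these include the sets where its real or imaginary
    part has a given sign. *)
Lemma ek_total (f : pt -> R[i]) : inL2 mu f -> (forall x, f (red x) = f x) ->
  (forall k, cint mu (fun x => f x * (ek k x)^*) = 0) -> I2 mu f = 0%E.
Proof.
move=> Lf fr h.
have L1 : inL2 mu (fun=> 1).
  split; first exact: cmeas_cst.
  rewrite /I2; under eq_integral do rewrite Normc.normc1 expr1n.
  rewrite integral_cst // mul1e [X in (X < _)%E](_ : _ = 1%E) ?ltry //; exact: probability_setT.
have cf : cintegrable mu f.
  by have := cintegrable_mulJ Lf L1; congr cintegrable; apply/funext => x; rewrite (_ : 1^* = 1) ?mulr1 //; apply: complex_ext; rewrite ?ReJ ?ImJ /= ?oppr0.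
have cfb g : cbmeas g -> cintegrable mu (fun x => g x * f x).
  move=> [g1 g2]; have [f1 f2] := cf; split.
    under eq_fun do rewrite ReM EFinB; apply: integrableB => //; exact: bmeas_integrableM.
  by under eq_fun do rewrite ImM EFinD; apply: integrableD => //; exact: bmeas_integrableM.
have hct g : ctrig g -> cint mu (fun x => g x * f x) = 0.
  elim=> [k|a g1 g2 c1 h1 c2 h2].
    rewrite -(h (fun j => - k j)); congr cint; apply/funext => x.
    rewrite mulrC /ek -expiN; congr (_ * expi _).
    by rewrite -sumrN; apply: eq_bigr => j _; rewrite mulrNz mulNr opprK.
  under eq_fun do rewrite mulrDl -mulrA.
  rewrite cint_lin; [|exact/cfb/ctrig_cbmeas|exact/cfb/ctrig_cbmeas].
  by rewrite h1 h2 mulr0 addr0.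
have key (A : set pt) : measurable A -> cint mu (fun x => (\1_A (red x) : R)%:C * f x) = 0.
  move=> mA; pose P (g : pt -> R) := bmeas g /\ cint mu (fun x => (g x)%:C * f x) = 0.
  suff [] : P (fun x => \1_A (red x)) by [].
  have cbr (g : pt -> R) : bmeas g -> cbmeas (fun x => (g x)%:C) by move=> hg; split=> //; exact: bmeas_cst.
  apply: monotone_class_red => //.
  - move=> a g1 g2 [b1 h1] [b2 h2]; split; first exact: bmeas_lin.
    have -> : (fun x => (a * g1 x + g2 x)%:C * f x) = (fun x => a%:C * ((g1 x)%:C * f x) + (g2 x)%:C * f x) :> (pt -> R[i]).
      by apply/funext => x; rewrite rcD rcM mulrDl mulrA.
    rewrite cint_lin; [|exact/cfb/cbr|exact/cfb/cbr].
    by rewrite h1 h2 mulr0 addr0.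
  - by move=> F phi hF bF lF; apply: (cint_mul_lim cf (fun N => (hF N).1.1) bF lF) => N; exact: (hF N).2.
  - by move=> g hg; split; [case: (ctrig_cbmeas hg)|exact: hct (ctrigRe hg)].
have pos (u : pt -> R) : measurable_fun setT u -> (forall x, u (red x) = u x) ->
    mu.-integrable setT (EFin \o u) ->
    (forall A : set pt, measurable A -> \int[mu]_x (\1_A (red x) * u x) = 0) ->
    ae_eq mu setT (EFin \o u) (cst 0%E).
  move=> mu_ ur iu hA.
  apply/ae_eq_integral_abs => //; first exact/measurable_EFinP.
  (* Subtracting the integrals of [u] over these two sets yields the integral of |u|. *)
  pose A := [set x | 0 < u x]; pose B := [set x | u x < 0].
  have mA : measurable A.
    have := mu_ measurableT _ (measurable_itv (`]0, +oo[)%R); rewrite setTI; congr measurable.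
    by apply/seteqP; split=> x /=; rewrite in_itv /= andbT.
  have mB : measurable B.
    have := mu_ measurableT _ (measurable_itv (`]-oo, 0[)%R); rewrite setTI; congr measurable.
  have bi (C : set pt) : measurable C -> mu.-integrable setT (EFin \o (fun x => \1_C (red x) * u x)).
    move=> mC; apply: bmeas_integrableM => //; split.
      exact: measurableT_comp (measurable_indic mC) red_meas.
    by exists 1 => x; rewrite indicE; case: (_ \in _); rewrite ?normr1 ?normr0.
  have := RintegralB measurableT (bi A mA) (bi B mB); rewrite !hA // subr0.
  have E x : \1_A (red x) * u x - \1_B (red x) * u x = `|u x|.
    rewrite !indicE (_ : (red x \in A) = (0 < u x)); last by apply/idP/idP; rewrite inE /A /= ur.
    rewrite (_ : (red x \in B) = (u x < 0)); last by apply/idP/idP; rewrite inE /B /= ur.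
    by case: (ltrgt0P (u x)) => [| |->]; rewrite ?mul1r ?mul0r ?subr0 ?sub0r ?mulr0.
  under eq_Rintegral do rewrite E.
  move=> hI; rewrite -[LHS]fineK //; first by congr EFin.
  by have := integrable_fin_num measurableT (integrable_abse iu).
have [f1 f2] := cf; have [[m1 m2] _] := Lf.
have e A : measurable A -> \int[mu]_x (\1_A (red x) * Re (f x)) = 0 /\ \int[mu]_x (\1_A (red x) * Im (f x)) = 0.
  move=> mA; have := key A mA; rewrite /cint => -[k1 k2]; split.
    by rewrite -[RHS]k1; apply: eq_Rintegral => x _; rewrite ReM /= mul0r subr0.
  by rewrite -[RHS]k2; apply: eq_Rintegral => x _; rewrite ImM /= mul0r addr0.
have a1 := pos _ m1 (fun x => congr1 (fun z : R[i] => Re z) (fr x)) f1 (fun A mA => (e A mA).1).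
have a2 := pos _ m2 (fun x => congr1 (fun z : R[i] => Im z) (fr x)) f2 (fun A mA => (e A mA).2).
rewrite /I2 (ae_eq_integral (cst 0%E)) ?integral0 //.
- exact: emeas_normc2 Lf.1.
- move: a1 a2; apply: filterS2 => x /= h1 h2 _.
  have [e1] := h1 Logic.I; have [e2] := h2 Logic.I.
  by rewrite normc_sq e1 e2 expr0n /= addr0.
Qed.

End fixed_dimension.
End torus_functions.

(** * Weyl operators on the torus *)

Section isometries.
Context {R : realType} {V : hspace R}.

Lemma isometry_ip (T : V -> V) : islin T -> (forall u, nrm (T u) = nrm u) ->
  forall u v, ip (T u) (T v) = ip u v.
Proof.
move=> lT nT.
have re u v : Re (ip (T u) (T v)) = Re (ip u v).
  have := nrmD_sq (T u) (T v); rewrite -islinD // !nT nrmD_sq; lra.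
move=> u v; apply: complex_ext; first exact: re.
have h z : Im z = Re ((0 -i* 1) * z) :> R by rewrite ReM /=; ring.
by rewrite !h -!ipZl -islinZ // re.
Qed.

Lemma isometry_adj (T S : V -> V) : islin T -> (forall u, nrm (T u) = nrm u) ->
  (forall u, T (S u) = u) -> adjV T = S.
Proof.
move=> lT nT TS; apply: adjV_uniq => [u v|].
  by rewrite -[in LHS](TS v) isometry_ip.
by split=> //; exists 1; split=> // u; rewrite nT mul1r.
Qed.

Lemma comm_adj (A B : V -> V) : bop A -> bop B -> (forall u, A (B u) = B (A u)) ->
  forall u, adjV A (adjV B u) = adjV B (adjV A u).
Proof.
move=> bA bB h u; have : A \o B = B \o A by apply/funext => v; exact: h.
by move=> /(congr1 adjV); rewrite (adjV_comp bA bB) (adjV_comp bB bA) => /(congr1 (fun f => f u)).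
Qed.

End isometries.

Section torus_hilbert_space.
Context {R : realType} (n : nat).
Local Notation pt := (@Defs.point R n).
Local Notation mu := (@torus_measure R n).
Local Notation H := (@L2_Tn R n).
Implicit Types f g : H.

Lemma periodic_shift f (pf : Defs.periodic f) x : f (red x) = f x.
Proof. exact: periodic_red. Qed.

Lemma domE f : hdom f <-> inL2 mu f /\ Defs.periodic f.
Proof. by split=> [[mf pf If]|[[mf If] pf]]. Qed.

Lemma hipE f g : hip f g = cint mu (fun x => f x * (g x)^*).
Proof. by []. Qed.

Lemma hnormE f : hnorm f = Num.sqrt (fine (I2 mu f)).
Proof. by rewrite /hnorm hipE cint_sq. Qed.

Lemma hnorm_I2 f : inL2 mu f -> (hnorm f ^+ 2)%:E = I2 mu f.
Proof. by move=> hf; rewrite hnormE sqr_sqrtr ?fine_ge0 ?I2_ge0 // -I2_fin. Qed.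

Lemma hnorm_lt f (e : R) : inL2 mu f -> 0 < e -> (hnorm f < e <-> (I2 mu f < (e ^+ 2)%:E)%E).
Proof.
move=> hf e0; rewrite -hnorm_I2 // lte_fin ltr_pXn2r // nnegrE ?sqrtr_ge0 //; exact: ltW.
Qed.

Lemma L2_Tn_prehilbert : prehilbert H.
Proof.
have dlin (a : R[i]) f g : hdom f -> hdom g -> hdom (a *: f + g).
  move=> /domE [hf pf] /domE [hg pg]; apply/domE; split; first exact: inL2_lin.
  by move=> j x; rewrite /GRing.add /GRing.scale /= pf pg.
have d0 : hdom (0 : H) by apply/domE; split; [exact: inL2_0|].
split=> //.
- move=> a f g h /domE[hf _] /domE[hg _] /domE[hh _]; rewrite !hipE.
  rewrite -cint_lin; [|exact: cintegrable_mulJ..].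
  by congr cint; apply/funext => x; rewrite mulrA -mulrDl.
- move=> f g /domE[hf _] /domE[hg _]; rewrite !hipE -cintJ; last exact: cintegrable_mulJ.
  by congr cint; apply/funext => x; rewrite conjcM conjJK mulrC.
- by move=> f _; rewrite hipE cint_sq lecR fine_ge0 // I2_ge0.
- move=> u hu hC.
  have sub f g : hdom f -> hdom g -> inL2 mu (f - g).
    by move=> hf hg; have /domE[] := dlin (-1) g f hg hf; rewrite scaleN1r addrC.
  have := @L2_complete _ _ _ mu u (fun i => (proj1 (domE _) (hu i)).1).
  case=> [e e0|f [hf pf lf]].
    have se : 0 < Num.sqrt e by rewrite sqrtr_gt0.
    have [N hN] := hC _ se; exists N => i j Ni Nj.
    have := hN i j Ni Nj; rewrite (hnorm_lt _ se); last exact: sub.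
    by rewrite sqr_sqrtr // ltW.
  have df : hdom (f : H).
    (* The limit has the periods of the sequence, being determined pointwise by its values. *)
    apply/domE; split=> // j x; apply: pf => i.
    by have /domE[_ pi] := hu i; exact: pi.
  exists (f : H); split=> // e e0.
  have e2 : 0 < e ^+ 2 by rewrite exprn_gt0.
  have [N hN] := lf _ e2; exists N => i Ni.
  by rewrite hnorm_lt //; [exact: hN|exact: sub].
Qed.

Lemma torus_presentable : exists (V : hspace R) (J : H -> V), presents J.
Proof.
by exists (quot_hspace L2_Tn_prehilbert), (@quotJ R H L2_Tn_prehilbert); exact: quot_presents.
Qed.

Variables (V : hspace R) (J : H -> V).
Hypothesis MJ : presents J.

(** This family contains the U_j as well as the right multiplications, and is closed under products
    and, when c has modulus 1, under adjoints: all phases come from [weyl_comp]. *)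
Definition weyl (c : R[i]) (k : 'I_n -> int) (t : 'I_n -> R) (f : H) : H :=
  fun x => c * ek k x * f (translate x t).

Lemma normc_ek k (x : pt) : normc (ek k x) = 1. Proof. exact: normc_expi. Qed.

Definition dotZ (k : 'I_n -> int) (t : 'I_n -> R) : R := \sum_j (k j)%:~R * t j.

Lemma weyl_comp c k t d l s f :
  weyl c k t (weyl d l s f) = weyl (c * d * expi (dotZ l t)) (fun j => k j + l j) (fun j => t j + s j) f.
Proof.
apply/funext => x; rewrite /weyl ek_translate -ekD translateD -/(dotZ l t); ring.
Qed.

Lemma weyl1 f : weyl 1 (fun=> 0) (fun=> 0) f = f.
Proof. by apply/funext => x; rewrite /weyl ek0 !mul1r translate0. Qed.

Lemma weyl_dom c k t f : normc c = 1 -> hdom f ->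
  hdom (weyl c k t f) /\ hnorm (weyl c k t f) = hnorm f.
Proof.
move=> c1 /domE [[mf If] pf].
have I2E : I2 mu (weyl c k t f) = I2 mu f.
  rewrite -(I2_translate t mf (periodic_shift pf)) /I2; apply: eq_integral => x _.
  by rewrite /weyl !Normc.normcM c1 normc_ek !mul1r.
split; last by rewrite !hnormE I2E.
apply/domE; split; first split; last 2 first.
- by rewrite I2E.
- move=> j x; rewrite /weyl ek_translate translateD.
  have -> : \sum_i (k i)%:~R * (2 * pi * (i == j)%:R) = 2 * pi * (k j)%:~R :> R.
    rewrite (bigD1 j) //= eqxx big1 ?addr0 ?mulr1 1?mulrC // => i /negbTE ->.
    by rewrite !mulr0.
  rewrite expi2piz mul1r; congr (_ * _).
  by rewrite -(pf j (translate x t)) translateD; congr (f (translate x _)); apply/funext => i; rewrite addrC.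
- apply: cmeasM; last exact: cmeas_translate.
  apply: cmeasM; [exact: cmeas_cst|exact/cbmeas_cmeas/(cint_ek k).1].
Qed.

Lemma weyl_lift c k t : normc c = 1 ->
  bounded_op (weyl c k t) /\ forall f, hdom f -> lift_op J (weyl c k t) (J f) = J (weyl c k t f).
Proof.
move=> c1.
have b : bounded_op (weyl c k t).
  split=> [u hu|a u v hu hv|].
  - by case: (weyl_dom k t c1 hu).
  - rewrite /heq (_ : weyl c k t (a *: u + v) - (a *: weyl c k t u + weyl c k t v) = 0).
      by have [h0 _] := pres0 MJ; rewrite (pres_nrm MJ) // (pres0 MJ).2 nrm0.
    apply/funext => x; rewrite /weyl /GRing.add /GRing.opp /GRing.scale /= /GRing.zero /=.
    by rewrite /GRing.scale /=; ring.
  - by exists 1 => u hu; rewrite mul1r (weyl_dom k t c1 hu).2.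
by split=> // f hf; rewrite (liftE MJ b hf).
Qed.

Definition VW c k t : V -> V := lift_op J (weyl c k t).

Lemma VW_bop c k t : normc c = 1 -> bop (VW c k t).
Proof. by move=> /(weyl_lift k t) [b _]; exact: lift_isbop MJ _ b. Qed.

Lemma VW_J c k t f : normc c = 1 -> hdom f -> VW c k t (J f) = J (weyl c k t f).
Proof. by move=> /(weyl_lift k t) [_ h]; exact: h. Qed.

Lemma VW_nrm c k t u : normc c = 1 -> nrm (VW c k t u) = nrm u.
Proof.
move=> c1; have [f [hf <-]] := pres_surj MJ u.
rewrite VW_J // -!(pres_nrm MJ) //; first by case: (weyl_dom k t c1 hf).
by case: (weyl_dom k t c1 hf).
Qed.

Lemma VW_comp c k t d l s u : normc c = 1 -> normc d = 1 ->
  VW c k t (VW d l s u) = VW (c * d * expi (dotZ l t)) (fun j => k j + l j) (fun j => t j + s j) u.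
Proof.
move=> c1 d1; have [f [hf <-]] := pres_surj MJ u.
rewrite !VW_J ?weyl_comp //; last by case: (weyl_dom l s d1 hf).
by rewrite !Normc.normcM c1 d1 normc_expi !mul1r.
Qed.

Lemma VW1 u : VW 1 (fun=> 0) (fun=> 0) u = u.
Proof.
have [f [hf <-]] := pres_surj MJ u.
by rewrite VW_J ?weyl1 // Normc.normc1.
Qed.

Lemma VW_K c k t u : normc c = 1 ->
  VW c k t (VW (c^* * expi (dotZ k t)) (fun j => - k j) (fun j => - t j) u) = u.
Proof.
move=> c1; have d1 : normc (c^* * expi (dotZ k t)) = 1.
  by rewrite Normc.normcM normcJ c1 normc_expi mul1r.
rewrite VW_comp //.
rewrite (_ : (fun j => k j + _) = (fun=> 0)); last by apply/funext => j; rewrite subrr.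
rewrite (_ : (fun j => t j + _) = (fun=> 0)); last by apply/funext => j; rewrite subrr.
rewrite (_ : c * _ * _ = 1) ?VW1 //.
have -> : dotZ (fun j => - k j) t = - dotZ k t.
  by rewrite /dotZ -sumrN; apply: eq_bigr => j _; rewrite mulrNz mulNr.
by rewrite mulrA -mulrA -expiD subrr expi0 mulr1 mulcJ c1 expr1n.
Qed.

Lemma VW_adj c k t : normc c = 1 ->
  adjV (VW c k t) = VW (c^* * expi (dotZ k t)) (fun j => - k j) (fun j => - t j).
Proof.
move=> c1; apply: isometry_adj; [exact: bop_lin (VW_bop k t c1)| |]; move=> u.
  exact: VW_nrm.
exact: VW_K.
Qed.

Lemma oneP : hdom (@Defs.one R n : H).
Proof.
apply/domE; split=> //; split; first exact: cmeas_cst.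
rewrite /I2; under eq_integral do rewrite Normc.normc1 expr1n.
rewrite integral_cst // mul1e [X in (X < _)%E](_ : _ = 1%E) ?ltry //; exact: probability_setT.
Qed.

Definition Om : V := J (@Defs.one R n).

Lemma ek_dom (k : 'I_n -> int) : hdom (ek k : H) /\ J (ek k) = VW 1 k (fun=> 0) Om.
Proof.
have E : weyl 1 k (fun=> 0) (@Defs.one R n) = ek k.
  by apply/funext => x; rewrite /weyl mul1r mulr1.
rewrite /Om VW_J ?E ?Normc.normc1 //; last exact: oneP.
by split=> //; rewrite -E; case: (weyl_dom k (fun=> 0) (Normc.normc1 R) oneP).
Qed.

Lemma VW_Om c k t : normc c = 1 -> VW c k t Om = c *: J (ek k).
Proof.
move=> c1; have [d _] := ek_dom k; rewrite VW_J //; last exact: oneP.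
have := (pres_lin MJ c d (pres0 MJ).1).2.
rewrite (pres0 MJ).2 !addr0 => <-; congr J.
by apply/funext => x; rewrite /weyl mulr1.
Qed.

Lemma ek_onb : onb (fun k : Zn n => J (ek k)).
Proof.
split=> [k l|u hu].
  rewrite -(pres_ip MJ (ek_dom k).1 (ek_dom l).1) hipE.
  transitivity (cint mu (@ek R n (fun j => k j - l j))).
    congr cint; apply/funext => x; rewrite -ekD; congr (_ * _).
    by rewrite /ek -expiN; congr expi; rewrite -sumrN; apply: eq_bigr => j _; rewrite mulrNz mulNr.
  rewrite (cint_ek _).2; congr (nat_of_bool _)%:R; apply/forallP/eqP => [h|-> j].
    by apply/ffunP => j; apply/eqP; rewrite -subr_eq0; exact: h.
  by rewrite subrr.
have [f [hf fu]] := pres_surj MJ u.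
apply: nrm_eq0; rewrite -fu -(pres_nrm MJ) // hnormE.
have /domE [Lf pf] := hf.
rewrite (ek_total Lf (periodic_shift pf)) ?sqrtr0 // => k.
have := hu [ffun j => k j]; rewrite -fu -(pres_ip MJ) //; last by case: (ek_dom [ffun j => k j]).
rewrite hipE => <-; congr cint; apply/funext => x; congr (_ * (expi _)^*).
by apply: eq_bigr => j _; rewrite ffunE.
Qed.

Lemma onb_phase (I : choiceType) (e : I -> V) (c : I -> R[i]) : onb e ->
  (forall i, normc (c i) = 1) -> onb (fun i => c i *: e i).
Proof.
move=> [oe te] c1; split=> [i j|u hu].
  rewrite ipZl ipZr oe; case: eqP => [->|_]; last by rewrite !mulr0.
  by rewrite mulr1 mulcJ c1 expr1n.
apply: te => i; have := hu i; rewrite ipZr => /eqP; rewrite mulf_eq0 => /orP[/eqP h|/eqP //].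
by have := c1 i; rewrite -normcJ h Normc.normc0 => /esym /eqP; rewrite oner_eq0.
Qed.

Lemma nrm_Om : nrm Om = 1.
Proof.
have := nrm_ons ek_onb.1 (0 : Zn n); rewrite (ek_dom _).2.
by rewrite VW_nrm // Normc.normc1.
Qed.

End torus_hilbert_space.

(** * The von Neumann algebra of the noncommutative torus *)

Section torus_algebra.
Context {R : realType} (n : nat) (theta : 'M[R]_n).
Hypothesis htheta : (theta^T = - theta)%R.
Hypothesis n_gt0 : (0 < n)%N.
Local Notation H := (@L2_Tn R n).
Variables (V : hspace R) (J : @L2_Tn R n -> V).
Hypothesis MJ : presents J.
Local Notation L := (@lift_op R H V J).
Local Notation Om := (@Om R n V J).
Local Notation VW := (@VW R n V J).
Local Notation U := (U theta).
Local Notation bounded := (@bounded_op R H).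
Implicit Types (S T : H -> H) (A : V -> V).

Definition tth (k : 'I_n -> int) (i : 'I_n) : R := pi * \sum_j theta i j * (k j)%:~R.

Lemma theta_antisym i j : theta i j = - theta j i.
Proof. by have := congr1 (fun A : 'M[R]_n => A j i) htheta; rewrite !mxE. Qed.

Lemma tthD (k l : 'I_n -> int) : tth (fun j => k j + l j) = fun i => tth k i + tth l i.
Proof.
apply/funext => i; rewrite /tth -mulrDr -big_split; congr (_ * _).
by apply: eq_bigr => j _; rewrite /= intrD mulrDr.
Qed.

Lemma tthN (k : 'I_n -> int) : tth (fun j => - k j) = fun i => - tth k i.
Proof.
apply/funext => i; rewrite /tth -mulrN -sumrN; congr (_ * _).
by apply: eq_bigr => j _; rewrite mulrNz mulrN.
Qed.

Lemma tth0 : tth (fun=> 0) = fun=> 0.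
Proof. by apply/funext => i; rewrite /tth big1 ?mulr0 // => j _; rewrite mulr0. Qed.

(** The bilinear form k . theta l inherits the antisymmetry of theta. It governs the phases in the
    products of Weyl operators. *)
Lemma dotZ_tth k l : dotZ k (tth l) = - dotZ l (tth k).
Proof.
have E a b : dotZ a (tth b) = pi * \sum_i \sum_j (a i)%:~R * theta i j * (b j)%:~R.
  rewrite /dotZ mulr_sumr; apply: eq_bigr => i _; rewrite /tth mulrCA; congr (_ * _).
  by rewrite mulr_sumr; apply: eq_bigr => j _; rewrite mulrA.
rewrite !E exchange_big -mulrN -sumrN; congr (_ * _); apply: eq_bigr => i _.
rewrite -sumrN; apply: eq_bigr => j _; rewrite (theta_antisym j i); ring.
Qed.

Lemma dotZ_tth0 k : dotZ k (tth k) = 0.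
Proof. have := dotZ_tth k k; lra. Qed.

Definition delt (j : 'I_n) (i : 'I_n) : int := (i == j)%:R.

Lemma U_weyl j : U j = weyl 1 (delt j) (tth (delt j)).
Proof.
apply/funext => f; apply/funext => x; rewrite /Defs.U /weyl mul1r; congr (expi _ * f (translate x _)).
  by rewrite -[LHS]mul1r -(sum_int_delta j x 1); apply: eq_bigr => i _; rewrite mul1r.
apply/funext => i; rewrite /tth (bigD1 j) //= big1 => [|l /negbTE lj]; first by rewrite /delt eqxx mulr1 addr0.
by rewrite /delt lj mulr0.
Qed.

Lemma one1 : normc (1 : R[i]) = 1. Proof. exact: Normc.normc1. Qed.

Lemma U_bounded j : bounded (U j).
Proof. by rewrite U_weyl; case: (weyl_lift MJ (delt j) (tth (delt j)) one1). Qed.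

Lemma U_lift j : L (U j) = VW 1 (delt j) (tth (delt j)).
Proof. by rewrite U_weyl. Qed.

(** Commutation with the adjoints is included so that this set is itself stable under adjoints. *)
Definition Ucomm (A : V -> V) := bop A /\ forall j u,
  A (L (U j) u) = L (U j) (A u) /\ A (adjV (L (U j)) u) = adjV (L (U j)) (A u).

Lemma Ucomm_bop A : Ucomm A -> bop A. Proof. by case. Qed.

Lemma Ucomm_adj A : Ucomm A -> Ucomm (adjV A).
Proof.
move=> [bA h]; split=> [|j u]; first exact: adjV_bop.
have bU : bop (L (U j)) by exact: lift_isbop MJ _ (U_bounded j).
split; last by apply: comm_adj => // v; case: (h j v).
rewrite -{1 2}(adjVK bU); apply: comm_adj => //; first exact: adjV_bop.
by move=> v; case: (h j v).
Qed.

(* The phases agree because theta is antisymmetric. *)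
Lemma VW_twist c k d l u : normc c = 1 -> normc d = 1 ->
  VW c k (fun i => - tth k i) (VW d l (tth l) u) = VW d l (tth l) (VW c k (fun i => - tth k i) u).
Proof.
move=> c1 d1; rewrite !(VW_comp MJ) //; congr (VW _ _ _ u).
- have -> : dotZ l (fun i => - tth k i) = - dotZ l (tth k).
    by rewrite /dotZ -sumrN; apply: eq_bigr => i _; rewrite mulrN.
  by rewrite -dotZ_tth [d * c]mulrC.
- by apply/funext => i; rewrite addrC.
- by apply/funext => i; rewrite addrC.
Qed.

Lemma twist_Ucomm c k : normc c = 1 -> Ucomm (VW c k (fun i => - tth k i)).
Proof.
move=> c1; split=> [|j u]; first exact: (VW_bop MJ).
rewrite U_lift; split; first exact: VW_twist c1 one1.
rewrite (VW_adj MJ) ?one1 // -(tthN (delt j)); apply: VW_twist => //.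
by rewrite Normc.normcM normcJ one1 normc_expi mul1r.
Qed.

Local Notation N := (algN Ucomm).

Definition vNalg : set (H -> H) := [set T | bounded T /\ N (L T)].

Lemma vNalg_id : vNalg id.
Proof. by have [h e] := lift_id MJ; split=> //; rewrite e; exact: algN_id. Qed.

Lemma vNalg_comp S T : vNalg S -> vNalg T -> vNalg (S \o T).
Proof.
move=> [bS nS] [bT nT]; have [h e] := lift_comp MJ bS bT.
by split=> //; rewrite e; exact: algN_comp.
Qed.

Lemma vNalg_lin (a : R[i]) S T : vNalg S -> vNalg T -> vNalg (a *: S + T).
Proof.
move=> [bS nS] [bT nT]; have [h e] := lift_lin MJ a bS bT.
by split=> //; rewrite e; exact: (algN_lin Ucomm_bop).
Qed.

Lemma vNalg_adj T : vNalg T -> vNalg (adj T).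
Proof.
move=> [bT nT]; have [h e] := lift_adj MJ bT.
by split=> //; rewrite e; exact: (algN_adj Ucomm_bop Ucomm_adj).
Qed.

Lemma vNalg_U j : vNalg (U j).
Proof.
split; first exact: U_bounded.
by split; [exact: lift_isbop MJ _ (U_bounded j)|move=> A [_ h] u; case: (h j u)].
Qed.

(** [T] is U^k up to a phase. The phase of an ordered monomial is left implicit, since only its
    modulus will matter. *)
Definition isW T k := vNalg T /\ exists c, normc c = 1 /\ L T = VW c k (tth k).

Lemma isW_id : isW id (fun=> 0).
Proof.
split; first exact: vNalg_id.
exists 1; split; first exact: one1.
by rewrite (lift_id MJ).2 tth0; apply/funext => u; rewrite (VW1 MJ).
Qed.

Lemma isW_comp S T k l : isW S k -> isW T l -> isW (S \o T) (fun j => k j + l j).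
Proof.
move=> [mS [c [c1 eS]]] [mT [d [d1 eT]]]; split; first exact: vNalg_comp.
exists (c * d * expi (dotZ l (tth k))); split.
  by rewrite !Normc.normcM c1 d1 normc_expi !mul1r.
rewrite (lift_comp MJ mS.1 mT.1).2 eS eT tthD; apply/funext => u /=; exact: (VW_comp MJ).
Qed.

Lemma isW_adj T k : isW T k -> isW (adj T) (fun j => - k j).
Proof.
move=> [mT [c [c1 eT]]]; split; first exact: vNalg_adj.
exists (c^* * expi (dotZ k (tth k))); split.
  by rewrite Normc.normcM normcJ c1 normc_expi mul1r.
by rewrite (lift_adj MJ mT.1).2 eT (VW_adj MJ) // tthN.
Qed.

Lemma isW_U j : isW (U j) (delt j).
Proof. by split; [exact: vNalg_U|exists 1; split; [exact: one1|exact: U_lift]]. Qed.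

Lemma isW_eq T k l : isW T k -> k =1 l -> isW T l.
Proof. by move=> h /funext <-. Qed.

Lemma isW_pow j z : isW (U_pow theta j z) (fun i => z * delt j i).
Proof.
case: z => m.
  elim: m => [|m IH]; first by apply: isW_eq isW_id _ => i; rewrite mul0r.
  apply: isW_eq (isW_comp (isW_U j) IH) _ => i.
  by rewrite -[m.+1]add1n PoszD mulrDl mul1r.
suff h p : isW (iter p (fun S => star (U j) \o S) id) (fun i => - p%:Z * delt j i).
  by apply: isW_eq (h m.+1) _ => i; rewrite NegzE.
elim: p => [|p IH]; first by apply: isW_eq isW_id _ => i; rewrite oppr0 mul0r.
apply: isW_eq (isW_comp (isW_adj (isW_U j)) IH) _ => i.
by rewrite -[p.+1]add1n PoszD opprD mulrDl mulN1r.
Qed.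

Lemma isW_mono (k : Zn n) : isW (U_mono theta k) k.
Proof.
have h (r : seq 'I_n) : isW (\big[(fun S T : H -> H => S \o T)/id]_(j <- r) U_pow theta j (k j))
    (fun i => \sum_(j <- r) k j * delt j i).
  elim: r => [|j r IH]; first by rewrite big_nil; apply: isW_eq isW_id _ => i; rewrite big_nil.
  rewrite big_cons; apply: isW_eq (isW_comp (isW_pow j (k j)) IH) _ => i.
  by rewrite big_cons.
apply: isW_eq (h (index_enum 'I_n)) _ => i.
rewrite (bigD1 i) //= big1 => [|j ji]; first by rewrite /delt eqxx mulr1 addr0.
by rewrite /delt eq_sym (negbTE ji) mulr0.
Qed.

Lemma phase_ex (k : Zn n) : exists c, normc c = 1 /\ L (U_mono theta k) = VW c k (tth k).
Proof. by case: (isW_mono k). Qed.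
Definition phase (k : Zn n) := projT1 (cid (phase_ex k)).
Lemma phase1 (k : Zn n) : normc (phase k) = 1. Proof. by rewrite /phase; case: cid => c []. Qed.
Lemma W_VW (k : Zn n) : L (U_mono theta k) = VW (phase k) k (tth k).
Proof. by rewrite /phase; case: cid => c []. Qed.

Definition WU (k : Zn n) : V -> V := L (U_mono theta k).
(** Right multiplication by U^k: same phase and exponential, opposite translation. On the constant
    function 1 the translation is invisible, so it agrees there with [WU k]. *)
Definition XU (k : Zn n) : V -> V := VW (phase k) k (fun i => - tth k i).

Lemma W_N (k : Zn n) : N (WU k). Proof. by have [[_ h] _] := isW_mono k. Qed.
Lemma WU_nrm (k : Zn n) u : nrm (WU k u) = nrm u.
Proof. by rewrite /WU W_VW (VW_nrm MJ) // phase1. Qed.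
Lemma WU_adjK (k : Zn n) u : WU k (adjV (WU k) u) = u.
Proof. by rewrite /WU W_VW (VW_adj MJ) ?phase1 // (VW_K MJ) ?phase1. Qed.
Lemma WU_Om (k : Zn n) : WU k Om = phase k *: J (ek k).
Proof. by rewrite /WU W_VW (VW_Om MJ) // phase1. Qed.
Lemma oW : onb (fun k : Zn n => WU k Om).
Proof.
have := onb_phase (ek_onb MJ) phase1; congr onb; apply/funext => k; by rewrite WU_Om.
Qed.

Lemma WUa_Om (k : Zn n) : adjV (WU k) Om = (phase k)^* *: J (ek (fun j => - k j)).
Proof.
rewrite /WU W_VW (VW_adj MJ) ?phase1 // dotZ_tth0 expi0 mulr1 (VW_Om MJ) //.
by rewrite normcJ phase1.
Qed.

Lemma oWa : onb (fun k : Zn n => adjV (WU k) Om).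
Proof.
have [h0 h1] := ek_onb MJ.
have h : onb (fun k : Zn n => J (ek (fun j => - k j))).
  pose m (k : Zn n) : Zn n := [ffun j => - k j].
  have E (k : Zn n) : (fun j => - k j) = m k :> ('I_n -> int) by apply/funext => j; rewrite ffunE.
  split=> [k l|u hu].
    rewrite !E h0; congr (nat_of_bool _)%:R; apply/eqP/eqP => [h|-> //].
    by apply/ffunP => j; have := congr1 (fun f : Zn n => - f j) h; rewrite !ffunE !opprK.
  apply: h1 => k; have := hu (m k); congr (ip _ (J (ek _)) = _).
  by apply/funext => j; rewrite ffunE opprK.
have := onb_phase h (fun k => etrans (normcJ (phase k)) (phase1 k)).
by congr onb; apply/funext => k; rewrite WUa_Om.
Qed.

Lemma X_C (k : Zn n) : Ucomm (XU k). Proof. exact: twist_Ucomm (phase1 k). Qed.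
Lemma XE (k : Zn n) : XU k Om = WU k Om. Proof. by rewrite WU_Om /XU (VW_Om MJ) // phase1. Qed.
Lemma XaE (k : Zn n) : adjV (XU k) Om = adjV (WU k) Om.
Proof.
rewrite WUa_Om /XU (VW_adj MJ) ?phase1 //.
have -> : dotZ k (fun i => - tth k i) = - dotZ k (tth k).
  by rewrite /dotZ -sumrN; apply: eq_bigr => i _; rewrite mulrN.
by rewrite dotZ_tth0 oppr0 expi0 mulr1 (VW_Om MJ) // normcJ phase1.
Qed.

Lemma star_vNalg : star_algebra vNalg.
Proof.
split.
- by move=> T [].
- move=> S T [bS nS] bT /(op_eqP MJ bS bT) e; split=> //; by rewrite -e.
- exact: vNalg_lin.
- exact: vNalg_comp.
- exact: vNalg_adj.
Qed.

Lemma vNalg_range_U : range U `<=` vNalg.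
Proof. by move=> _ [j _ <-]; exact: vNalg_U. Qed.

(** [vNalg] is a commutant: every element of [Ucomm], brought back to functions by [drop], commutes
    with it, so its bicommutant commutes with [Ucomm]. *)
Lemma vN_vNalg : vonNeumann_algebra vNalg.
Proof.
split; first exact: star_vNalg.
apply/seteqP; split=> T.
  move=> [bT hT]; split=> //; split=> [|A cA u]; first exact: lift_isbop MJ _ bT.
  have [bA eA] := dropP MJ (Ucomm_bop cA).
  have cm : commutant vNalg (drop J A).
    split=> // S [bS nS]; have [b1 e1] := lift_comp MJ bS bA; have [b2 e2] := lift_comp MJ bA bS.
    apply/(op_eqP MJ b1 b2); rewrite e1 e2 eA; apply/funext => v /=.
    by case: nS => _ /(_ A cA v).
  have [b1 e1] := lift_comp MJ bT bA; have [b2 e2] := lift_comp MJ bA bT.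
  have /(op_eqP MJ b2 b1) := hT _ cm; rewrite e1 e2 eA.
  by move=> /(congr1 (fun f => f u)).
move=> [bT nT]; split=> // S [bS hS].
have [b1 e1] := lift_comp MJ bS bT; have [b2 e2] := lift_comp MJ bT bS.
apply/(op_eqP MJ b1 b2); apply/esym.
have /(op_eqP MJ b2 b1) -> // := hS T (conj bT nT).
Qed.

(** The commutant of any von Neumann algebra containing the U_j lies in [Ucomm]; taking commutants
    again, [vNalg] is contained in that algebra. *)
Lemma LinftyE T : Linfty_Tn theta T <-> vNalg T.
Proof.
split=> [h|[bT [_ nT]]].
  by apply: h; split; [exact: vN_vNalg|exact: vNalg_range_U].
move=> A [[sA cA] UA]; rewrite -cA; split=> // S [bS hS].
have cS : Ucomm (L S).
  split=> [|j u]; first exact: lift_isbop MJ _ bS.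
  have AU : A (U j) by apply: UA; exists j.
  have [_ _ _ _ /(_ _ AU) AUa] := sA.
  have bU := U_bounded j; have [bUa eUa] := lift_adj MJ bU.
  have com T' : A T' -> bounded T' -> forall u, L S (L T' u) = L T' (L S u).
    move=> AT' bT' v; have := hS _ AT'.
    have [b1 e1] := lift_comp MJ bS bT'; have [b2 e2] := lift_comp MJ bT' bS.
    by move=> /(op_eqP MJ b2 b1); rewrite e1 e2 => /(congr1 (fun f => f v)) /esym.
  by split; [exact: com|rewrite -eUa; exact: com].
have [b1 e1] := lift_comp MJ bS bT; have [b2 e2] := lift_comp MJ bT bS.
by apply/(op_eqP MJ b1 b2); rewrite e1 e2; apply/funext => u /=; rewrite nT.
Qed.

Lemma cstar_vNalg : cstar_algebra vNalg.
Proof.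
split; first exact: star_vNalg.
move=> T bT h; split=> //; apply: (algN_norm_closed Ucomm_bop); first exact: lift_isbop MJ _ bT.
move=> d d0; have [S [bS nS] hS] := h d d0; exists (L S) => //.
have [bd ed] := liftB MJ bT bS.
have := opnorm_obound MJ bd (ltW hS); rewrite ed => ho u.
by rewrite nrmBC; exact: ho.
Qed.

Lemma C_vNalg T : C_Tn theta T -> vNalg T.
Proof. by apply; split; [exact: cstar_vNalg|exact: vNalg_range_U]. Qed.

Lemma C_cstar : @cstar_algebra R H (C_Tn theta).
Proof.
have sub : C_Tn theta `<=` bounded by move=> T /C_vNalg [].
split; first split=> //.
- move=> S T CS bT e A hA; have [[[_ h _ _ _] _] _] := hA; exact: (h S) (CS A hA) bT e.
- by move=> a S T CS CT A hA; have [[[_ _ h _ _] _] _] := hA; apply: h; [exact: CS|exact: CT].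
- by move=> S T CS CT A hA; have [[[_ _ _ h _] _] _] := hA; apply: h; [exact: CS|exact: CT].
- by move=> S CS A hA; have [[[_ _ _ _ h] _] _] := hA; apply: h; exact: CS.
- move=> T bT h A hA; have [[_ cA] _] := hA; apply: cA => // e e0.
  by have [S CS hS] := h e e0; exists S => //; exact: CS.
Qed.

Lemma C_U j : C_Tn theta (U j).
Proof. by move=> A [_ h]; apply: h; exists j. Qed.

Lemma U_unitary j u : adjV (L (U j)) (L (U j) u) = u.
Proof.
rewrite U_lift (VW_adj MJ) ?one1 // dotZ_tth0 expi0.
have j1 : normc ((1 : R[i])^* * 1) = 1 by rewrite mulr1 normcJ one1.
rewrite (VW_comp MJ) ?one1 //.
rewrite -[RHS](VW1 MJ); congr (VW _ _ _ u).
- rewrite -tthN dotZ_tth (_ : dotZ (fun j0 => _) _ = - dotZ (delt j) (tth (delt j))); last first.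
    by rewrite /dotZ -sumrN; apply: eq_bigr => i _; rewrite mulrNz mulNr.
  rewrite dotZ_tth0 !oppr0 expi0 !mulr1; apply: complex_ext; rewrite ?ReJ ?ImJ /= ?oppr0 //.
- by apply/funext => i; rewrite addNr.
- by apply/funext => i; rewrite addNr.
Qed.

(** [star_algebra] does not postulate a unit; it is recovered as U_j^* U_j, where the index j exists
    because n > 0. *)
Lemma C_id : C_Tn theta id.
Proof.
have [[_ heq _ hc ha] _] := C_cstar; pose j := Ordinal n_gt0.
have [bi ei] := lift_id MJ; have [ba ea] := lift_adj MJ (U_bounded j).
have [bc ec] := lift_comp MJ ba (U_bounded j).
apply: (heq _ _ (hc _ _ (ha _ (C_U j)) (C_U j)) bi).
apply/(op_eqP MJ bc bi); rewrite ec ei ea; apply/funext => u; exact: U_unitary.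
Qed.

Lemma C_mono (k : Zn n) : C_Tn theta (U_mono theta k).
Proof.
have [[_ _ _ hc ha] _] := C_cstar.
apply: (big_ind (C_Tn theta)) => [|S T|j _]; [exact: C_id|exact: hc|].
rewrite /U_pow; case: (k j) => m; elim: m => [|m IH] /=.
- exact: C_id.
- by apply: hc => //; exact: C_U.
- by apply: hc; [apply: ha; exact: C_U|exact: C_id].
- by apply: hc; [apply: ha; exact: C_U|exact: IH].
Qed.

End torus_algebra.

(** * The spaces L_1 and L_2 of the noncommutative torus *)

Section noncommutative_L2.
Context {R : realType} (n : nat) (theta : 'M[R]_n).
Hypothesis htheta : (theta^T = - theta)%R.
Hypothesis n_gt0 : (0 < n)%N.
Local Notation H := (@L2_Tn R n).
Variables (V : hspace R) (J : @L2_Tn R n -> V).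
Hypothesis MJ : presents J.
Local Notation L := (@lift_op R H V J).
Local Notation Om := (@Om R n V J).
Local Notation N := (algN (Ucomm theta J)).
Local Notation vNalg := (@vNalg R n theta V J).
Local Notation W := (@WU R n theta V J).
Implicit Types (S T : H -> H) (A B : V -> V).

Let Cb := @Ucomm_bop R n theta V J.
Let Ca := Ucomm_adj MJ (theta := theta).
Let WN := W_N theta MJ.
Let ow := oW theta MJ.
Let owa := oWa htheta MJ.
Let XC := X_C htheta MJ.
Let Xe := XE theta MJ.
Let Xae := XaE htheta MJ.
Let O1 := nrm_Om MJ.

Lemma N_bop A : N A -> bop A. Proof. by case. Qed.
Lemma NtrC A B : N A -> N B -> tr Om (A \o B) = tr Om (B \o A).
Proof. exact: (trC Cb Ca WN ow owa XC Xe Xae). Qed.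
Lemma Ninj A B : N A -> N B -> A Om = B Om -> A = B.
Proof. exact: (algN_inj Cb ow XC Xe). Qed.
Lemma NmulOm A B (c : R) : N A -> N B -> 0 <= c -> obound B c -> nrm (A (B Om)) <= c * nrm (A Om).
Proof. exact: (nrm_mulOm Cb Ca WN ow owa XC Xe Xae). Qed.
Lemma Nnorm1_ge0 A : N A -> 0 <= norm1 Om A.
Proof. exact: (norm1_ge0 Cb Ca WN ow owa XC Xe Xae). Qed.
Lemma Nfactorization A : N A -> forall d : R, 0 < d -> exists y z, [/\ N y, N z,
  forall u v, normc (ip (A u) v) <= nrm (z u) * nrm (y v) + d * nrm u * nrm v,
  nrm (z Om) ^+ 2 = norm1 Om A & nrm (y Om) ^+ 2 <= 4 * norm1 Om A].
Proof. exact: (factorization_form Cb Ca WN ow owa XC Xe Xae). Qed.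
Lemma Ntr_bound A B (c : R) : N A -> N B -> 0 <= c -> obound B c ->
  normc (tr Om (A \o B)) <= 2 * c * norm1 Om A.
Proof. exact: (tr_bound Cb Ca WN ow owa XC Xe Xae O1). Qed.
Lemma Nnorm1_quasi A B : N A -> N B ->
  norm1 Om B <= 4 * (norm1 Om A + norm1 Om (fun u => B u - A u)).
Proof. exact: (norm1_quasi Cb Ca WN ow owa XC Xe Xae O1). Qed.
Lemma N_adj A : N A -> N (adjV A). Proof. exact: (algN_adj Cb Ca). Qed.

Lemma one_dom : hdom (@Defs.one R n : H). Proof. exact: oneP. Qed.

Lemma tauE T : bounded_op T -> tau T = tr Om (L T).
Proof.
move=> bT; have dT : hdom (T (@Defs.one R n : H)) by case: bT => h _ _; apply: h; exact: one_dom.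
rewrite /tau (pres_ip MJ) //; last exact: one_dom.
by rewrite (liftE MJ bT one_dom).
Qed.

Lemma modulusP T : vNalg T -> vNalg (modulus T) /\ L (modulus T) = absV (L T).
Proof.
move=> [bT nT]; have [bA eA] := lift_abs MJ bT; split=> //; split=> //.
by rewrite eA; exact: (algN_abs Cb Ca).
Qed.

Lemma norm_Lp2 T : vNalg T -> norm_Lp 2 T = nrm (L T Om).
Proof.
move=> mT; have [[bA nA] eA] := modulusP mT; have bT := N_bop mT.2.
have [bAV pAV _] := absVP bT.
have [b1 e1] := lift_comp MJ bA bA.
rewrite /norm_Lp; change (iter 2 _ _) with (modulus T \o modulus T).
rewrite (tauE (T := modulus T \o modulus T)) // e1 eA /tr /=.
rewrite (pos_selfadj (bop_lin bAV) pAV) -nrm_sq nrm_absV //.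
by rewrite powR12_sqrt ?sqr_ge0 // sqrtr_sqr ger0_norm // nrm_ge0.
Qed.

Lemma norm_Lp1 T : vNalg T -> norm_Lp 1 T = norm1 Om (L T).
Proof.
move=> mT; have [[bA nA] eA] := modulusP mT.
rewrite /norm_Lp; change (iter 1 _ _) with (modulus T).
rewrite (tauE (T := modulus T)) // eA invr1 powRr1 //.
exact: Nnorm1_ge0 mT.2.
Qed.

Lemma vNalgB S T : vNalg S -> vNalg T -> vNalg (S - T) /\ L (S - T) = fun u => L S u - L T u.
Proof.
move=> [bS nS] [bT nT]; have [b e] := liftB MJ bS bT; split=> //; split=> //.
by rewrite e; exact: (algN_B Cb).
Qed.

Lemma Lp1P (x : nat -> H -> H) : Lp theta 1 x -> (forall i, vNalg (x i)) /\
  forall e : R, 0 < e -> exists M, forall i j, (M <= i)%N -> (M <= j)%N ->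
    norm1 Om (fun u => L (x i) u - L (x j) u) < e.
Proof.
move=> [hx hC]; have mx i : vNalg (x i) by apply/(LinftyE theta MJ).
split=> // e /hC [M hM]; exists M => i j Mi Mj.
have [h1 h2] := vNalgB (mx i) (mx j); rewrite -h2 -norm_Lp1 //; exact: hM.
Qed.

Lemma Lp2P (x : nat -> H -> H) : Lp theta 2 x <->
  (forall i, vNalg (x i)) /\ vcauchy (fun i => L (x i) Om).
Proof.
split=> [[hx hC]|[mx hC]].
  have mx i : vNalg (x i) by apply/(LinftyE theta MJ).
  split=> // e /hC [M hM]; exists M => i j Mi Mj.
  have [h1 h2] := vNalgB (mx i) (mx j).
  by have := hM i j Mi Mj; rewrite norm_Lp2 // h2.
split=> [i|e /hC [M hM]]; first by apply/(LinftyE theta MJ).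
exists M => i j Mi Mj; have [h1 h2] := vNalgB (mx i) (mx j).
by rewrite norm_Lp2 // h2; exact: hM.
Qed.

Local Notation H2 := (L2_theta theta).
Definition J2 (x : H2) : V := xget 0 [set l | vconv (fun i => L (x i) Om) l].

Lemma J2P (x : H2) l : vconv (fun i => L (x i) Om) l -> J2 x = l.
Proof.
move=> hl; apply: (@vconv_unique _ _ (fun i => L (x i) Om)) => //.
exact: (@xgetPex _ 0 [set l | vconv (fun i => L (x i) Om) l] (ex_intro _ l hl)).
Qed.

Lemma J2_conv (x : H2) : hdom x -> vconv (fun i => L (x i) Om) (J2 x).
Proof. by move=> /Lp2P [_ /vcauchyP [l hl]]; rewrite (J2P hl). Qed.

Lemma starP T : vNalg T -> vNalg (star T) /\ L (star T) = adjV (L T).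
Proof. by move=> mT; split; [exact: vNalg_adj|exact: (lift_adj MJ mT.1).2]. Qed.

Lemma compP S T : vNalg S -> vNalg T -> vNalg (S \o T) /\ L (S \o T) = L S \o L T.
Proof. by move=> mS mT; split; [exact: vNalg_comp|exact: (lift_comp MJ mS.1 mT.1).2]. Qed.

Lemma linP (a : R[i]) S T : vNalg S -> vNalg T ->
  vNalg (a *: S + T) /\ L (a *: S + T) = fun u => a *: L S u + L T u.
Proof. by move=> mS mT; split; [exact: vNalg_lin|exact: (lift_lin MJ a mS.1 mT.1).2]. Qed.

Lemma tr_star A B : N A -> N B -> tr Om (A \o adjV B) = ip (A Om) (B Om).
Proof.
by move=> nA nB; rewrite NtrC //; [rewrite /tr /= ip_adjl //; exact: N_bop|exact: N_adj].
Qed.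

Lemma vN_sum (I : Type) (r : seq I) (F : I -> H -> H) : (forall i, vNalg (F i)) ->
  vNalg (\sum_(i <- r) F i) /\ L (\sum_(i <- r) F i) = fun u => \sum_(i <- r) L (F i) u.
Proof.
move=> mF; have [b e] := lift_sum MJ r (fun i => (mF i).1); split=> //; split=> //.
by rewrite e; apply: (algN_sum Cb) => i; case: (mF i).
Qed.

Lemma monoP k : vNalg (U_mono theta k). Proof. by case: (isW_mono theta MJ k). Qed.

Lemma vNZ (c : R[i]) T : vNalg T -> vNalg (c *: T) /\ L (c *: T) = fun u => c *: L T u.
Proof.
move=> mT; have [b e] := liftZ MJ c mT.1; split=> //; split=> //; rewrite e.
exact: (algN_Z Cb) mT.2.
Qed.

Lemma J2_presents : @presents R H2 V J2.
Proof.
split.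
- move=> a u v hu hv; have [mu _] := proj1 (Lp2P _) hu; have [mv _] := proj1 (Lp2P _) hv.
  have h : vconv (fun i => L ((a *: u + v) i) Om) (a *: J2 u + J2 v).
    have := vconvD (vconvZ a (J2_conv hu)) (J2_conv hv); congr vconv; apply/funext => i.
    by rewrite (_ : (a *: u + v) i = a *: u i + v i) // (linP a (mu i) (mv i)).2.
  split; last exact: J2P.
  apply/Lp2P; split; last exact: vconv_cauchy h.
  by move=> i; case: (linP a (mu i) (mv i)).
- move=> u v hu hv; have [mu _] := proj1 (Lp2P _) hu; have [mv _] := proj1 (Lp2P _) hv.
  apply: climn_cconv.
  have := cconv_ip (J2_conv hu) (J2_conv hv); congr cconv; apply/funext => i.
  have [ms es] := starP (mv i); have [mc ec] := compP (mu i) ms.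
  by rewrite tauE ?ec ?es ?tr_star //; [case: (mu i)|case: (mv i)|case: mc].
(* Surjectivity: partial sums of the expansion of [l], with precision 1 / (i + 1), are values at
   [Om] of linear combinations of the U^k and form the required Cauchy sequence. *)
- move=> l; have hl := parseval l ow.
  have /choice[F hF] : forall i, exists B : {fset Zn n}, nrm (\sum_(k <- B) ip l (W k Om) *: W k Om - l) < i.+1%:R^-1.
    move=> i; have p : 0 < i.+1%:R^-1 :> R by rewrite invr_gt0 ltr0n.
    by have [B hB] := hl _ p; exists B; apply: hB; exact: fsubset_refl.
  pose x i : H -> H := \sum_(k <- F i) ip l (W k Om) *: U_mono theta k.
  have mk (k : Zn n) := vNZ (ip l (W k Om)) (monoP k).
  have mx i := vN_sum (F i) (fun k => (mk k).1).
  have h : vconv (fun i => L (x i) Om) l.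
    apply: (vconv_bound (a := fun i => i.+1%:R^-1)); first by move=> e; exact: inv_small.
    move=> i; apply: ltW; rewrite /x (mx i).2; have := hF i; congr (nrm (_ - _) < _).
    by apply: eq_bigr => k _; rewrite (mk k).2.
  exists x; split; last exact: J2P.
  by apply/Lp2P; split; [move=> i; exact: (mx i).1|exact: vconv_cauchy h].
Qed.

Lemma in_LpP T : vNalg T -> hdom (in_Lp T : H2) /\ J2 (in_Lp T) = L T Om.
Proof.
move=> mT; have h := vconv_cst (L T Om); split; last exact: J2P.
by apply/Lp2P; split=> //; exact: vconv_cauchy h.
Qed.

Definition e2 (k : Zn n) : H2 := in_Lp (U_mono theta k).
Lemma e2P k : hdom (e2 k) /\ J2 (e2 k) = W k Om.
Proof. exact: in_LpP (monoP k). Qed.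

Lemma e2_onb : onb (J2 \o e2).
Proof. by have := ow; congr onb; apply/funext => k /=; rewrite (e2P k).2. Qed.

Lemma obound_lt_opnorm T (c e : R) : bounded_op T -> 0 <= c -> c < e -> obound (L T) c ->
  (norm_op T < e%:E)%E.
Proof. by move=> bT c0 ce h; apply: le_lt_trans (opnorm_le MJ bT h c0) _; rewrite lte_fin. Qed.

Lemma sums_to_opsums (F : Zn n -> H -> H) T : (forall k, bounded_op (F k)) -> bounded_op T ->
  sums_to (@norm_op R n) F T <-> opsums (fun k => L (F k)) (L T).
Proof.
move=> bF bT.
have E (B : {fset Zn n}) : bounded_op ((\sum_(k <- B) F k)%R - T) /\
    L ((\sum_(k <- B) F k)%R - T) = fun u => \sum_(k <- B) L (F k) u - L T u.
  have [bS eS] := lift_sum MJ B bF; have [bd ed] := liftB MJ bS bT.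
  by split=> //; rewrite ed eS.
split=> h e e0.
  have [B hB] := h e e0; exists B => B' BB'; rewrite -(E B').2.
  by apply: opnorm_obound; [exact: MJ|exact: (E B').1|exact: ltW (hB _ BB')].
have [B hB] := h _ (half_gt0 e0); exists B => B' BB'.
apply: (@obound_lt_opnorm _ (e / 2)); [exact: (E B').1|exact/ltW/half_gt0|lra|].
by rewrite (E B').2; exact: hB.
Qed.

Lemma op_sumP (F : Zn n -> H -> H) A : (forall k, bounded_op (F k)) -> bop A ->
  opsums (fun k => L (F k)) A -> @bounded_op R H (op_sum F) /\ L (op_sum F) = A.
Proof.
move=> bF bA hA; have [bD eD] := dropP MJ bA.
have ex : exists T, [set T | @bounded_op R H T /\ sums_to (@norm_op R n) F T] T.
  by exists (drop J A); split=> //; apply/(sums_to_opsums bF bD); rewrite eD.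
have [bT hT] := xgetPex 0 ex; split=> //.
by apply: opsums_unique hA; apply/(sums_to_opsums bF bT).
Qed.

Lemma C_0 : C_Tn theta (0 : H -> H).
Proof.
have [[_ _ hl _ _] _] := C_cstar theta MJ; have ci := C_id htheta n_gt0 MJ.
by have := hl (-1) _ _ ci ci; rewrite scaleN1r addNr.
Qed.

Lemma C_sum (B : {fset Zn n}) (F : Zn n -> H -> H) : (forall k, C_Tn theta (F k)) ->
  C_Tn theta (\sum_(k <- B) F k : H -> H).
Proof.
move=> hF; have [[_ _ hl _ _] _] := C_cstar theta MJ.
apply: (big_ind (fun T : H -> H => C_Tn theta T)) => [|S T cS cT|k _]; [exact: C_0| |exact: hF].
by have := hl 1 _ _ cS cT; rewrite scale1r.
Qed.

(** The C^*-algebra is closed in norm. Applied to the sums S_u, this shows that [Psdo_C] has a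
    candidate to pick. *)
Lemma op_sum_C (F : Zn n -> H -> H) A : (forall k, C_Tn theta (F k)) -> bop A ->
  opsums (fun k => L (F k)) A -> C_Tn theta (op_sum F) /\ L (op_sum F) = A.
Proof.
move=> cF bA hA; have bF k : @bounded_op R H (F k) by case: (C_vNalg MJ (cF k)).
have [bT eT] := op_sumP bF bA hA; split=> //.
have [[_ _ _ _ _] hc] := C_cstar theta MJ; apply: hc => // e e0.
have [B hB] := hA _ (half_gt0 e0); exists (\sum_(k <- B) F k : H -> H); first exact: C_sum.
have [bS eS] := lift_sum MJ B bF; have [bd ed] := liftB MJ bT bS.
apply: (@obound_lt_opnorm _ (e / 2)); [exact: bd|exact/ltW/half_gt0|lra|].
by rewrite ed eT eS => u; rewrite nrmBC; exact: hB (fsubset_refl _) u.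
Qed.

End noncommutative_L2.

(** * Lattice sums *)

Section lattice_sums.
Context {R : realType}.

Lemma sum_uniq_sub_le (I : eqType) (s s' : seq I) (F : I -> R) : (forall i, 0 <= F i) ->
  uniq s -> uniq s' -> {subset s <= s'} -> \sum_(i <- s) F i <= \sum_(i <- s') F i.
Proof.
move=> F0 us us' ss.
have -> : \sum_(i <- s) F i = \sum_(i <- s' | i \in s) F i.
  rewrite -[RHS]big_filter; apply: perm_big; apply: uniq_perm => //; first exact: filter_uniq.
  by move=> i; rewrite mem_filter; case: (boolP (i \in s)) => //= /ss ->.
by rewrite [leRHS](bigID (mem s)) /= lerDl sumr_ge0.
Qed.

Lemma powR_exp (x r : R) : 0 < x -> x `^ r = expR (r * ln x).
Proof. by move=> x0; rewrite /powR gt_eqF. Qed.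

(** Comparison with the integral of x^(-q-1), obtained by using exp t >= 1 + t twice: to bound the
    difference of the logarithms of m + 2 and m + 1 below by 1 / (m + 2), and to bound its
    exponential. *)
Lemma powR_telescope (q : R) m : 0 < q ->
  q * m.+2%:R `^ (- (q + 1)) <= m.+1%:R `^ (- q) - m.+2%:R `^ (- q).
Proof.
move=> q0; rewrite !powR_exp ?ltr0n //.
have := @lnK R m.+2%:R (ltr0Sn _ _); have := @lnK R m.+1%:R (ltr0Sn _ _).
set a := ln m.+1%:R; set b := ln m.+2%:R => ha hb.
have h1 : 1 + (a - b) <= 1 - expR (- b).
  apply: le_trans (expR_ge1Dx _) _; rewrite expRD ha.
  have -> : m.+1%:R = expR b - 1 :> R by rewrite hb -[m.+2%:R]natr1 addrK.
  by rewrite mulrBl -expRD subrr expR0 mul1r.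
have h2 : 1 + q * (b - a) <= expR (q * (b - a)) := expR_ge1Dx _.
have -> : - (q + 1) * b = - q * b + - b by ring.
have -> : - q * a = - q * b + q * (b - a) by ring.
rewrite !expRD -[X in _ - X]mulr1 -mulrBr mulrCA ler_wpM2l ?expR_ge0 //.
have h3 := ler_wpM2l (ltW q0) h1; lra.
Qed.

Lemma nat_powR_sum (p : R) K : 1 < p ->
  \sum_(0 <= i < K) i.+1%:R `^ (- p) <= 1 + (p - 1)^-1.
Proof.
move=> p1; have q0 : 0 < p - 1 by rewrite subr_gt0.
suff h : \sum_(0 <= i < K.+1) i.+1%:R `^ (- p) <= 1 + (p - 1)^-1 * (1 - K.+1%:R `^ (- (p - 1))).
  have h1 : \sum_(0 <= i < K) i.+1%:R `^ (- p) <= \sum_(0 <= i < K.+1) i.+1%:R `^ (- p).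
    by rewrite [leRHS]big_nat_recr //= lerDl powR_ge0.
  apply: le_trans h1 (le_trans h _); rewrite lerD2l; apply: ler_piMr; first by rewrite invr_ge0 ltW.
  by rewrite gerBl powR_ge0.
elim: K => [|K IH]; first by rewrite big_nat1 !powR1 subrr mulr0 addr0.
rewrite big_nat_recr //=.
have := powR_telescope K q0; rewrite subrK => h.
have h2 : K.+2%:R `^ (- p) <= (p - 1)^-1 * (K.+1%:R `^ (- (p - 1)) - K.+2%:R `^ (- (p - 1))).
  by rewrite mulrC ler_pdivlMr // mulrC.
move: IH h2; rewrite !mulrBr; lra.
Qed.

Lemma int_powR_sum (p : R) : 1 < p -> exists M, forall s : seq int, uniq s ->
  \sum_(z <- s) (1 + `|z|%:~R) `^ (- p) <= M.
Proof.
move=> p1; exists (2 * (1 + (p - 1)^-1)) => s us.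
have [K zK'] : exists K, forall z, z \in s -> (`|z| < K)%N.
  exists (\max_(z <- s) `|z|%N).+1 => z zs.
  by rewrite ltnS; exact: (@leq_bigmax_seq _ s xpredT (fun z : int => `|z|%N) z zs isT).
pose s' := [seq Posz i | i <- iota 0 K] ++ [seq Negz i | i <- iota 0 K].
have ss : {subset s <= s'}.
  move=> z zs; have zK := zK' z zs.
  rewrite mem_cat; case: z zs zK => m zs zK; apply/orP; [left|right]; apply: map_f; rewrite mem_iota add0n //=.
  exact: ltnW.
have us' : uniq s'.
  rewrite cat_uniq !map_inj_uniq ?iota_uniq //=; try by move=> ? ? [].
  by rewrite andbT; apply/hasPn => _ /mapP[i _ ->]; apply/negP => /mapP[].
apply: le_trans (sum_uniq_sub_le _ us us' ss) _; first by move=> z; exact: powR_ge0.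
rewrite big_cat /= !big_map mulr_natl mulr2n; apply: lerD.
  apply: le_trans (nat_powR_sum K p1); rewrite /index_iota subn0.
  by apply: ler_sum => i _; rewrite /= -[i.+1%:R]natr1 addrC lexx.
apply: le_trans (nat_powR_sum K p1); rewrite /index_iota subn0.
(* [Negz i] has absolute value i + 1, so its term has base i + 2 and is dominated by the term with
   base i + 1. *)
apply: ler_sum => i _; rewrite !powRN lef_pV2 ?posrE ?powR_gt0 ?ltr0n //.
apply: ge0_ler_powR; rewrite ?nnegrE ?ler0n ?addr_ge0 //; first by lra.
by rewrite /= lerDr.
Qed.

Variable n : nat.

(** [B] lies in the cube whose side [cs] collects all coordinates of its points, and the sum over a
    cube factors into a product. *)
Lemma lattice_prod_sum (g : int -> R) M : (forall z, 0 <= g z) ->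
  (forall s : seq int, uniq s -> \sum_(z <- s) g z <= M) ->
  forall B : {fset Zn n}, \sum_(k <- B) \prod_j g (k j) <= M ^+ n.
Proof.
move=> g0 hg B.
pose cs := undup (flatten [seq [seq k j | j <- enum 'I_n] | k : Zn n <- B]).
pose h (f : {ffun 'I_n -> seq_sub cs}) : Zn n := [ffun j => val (f j)].
have hinj : injective h.
  by move=> f f' e; apply/ffunP => j; apply: val_inj; have := congr1 (fun k : Zn n => k j) e; rewrite !ffunE.
have csP (k : Zn n) j : k \in (B : seq _) -> k j \in cs.
  move=> kB; rewrite mem_undup; apply/flattenP; exists [seq k j | j <- enum 'I_n].
    by apply/mapP; exists k.
  by apply: map_f; rewrite mem_enum.
apply: (@le_trans _ _ (\sum_(k <- [seq h f | f <- enum {ffun 'I_n -> seq_sub cs}]) \prod_j g (k j))).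
  apply: sum_uniq_sub_le.
  - by move=> k; apply: prodr_ge0 => j _.
  - exact: fset_uniq.
  - by rewrite map_inj_uniq ?enum_uniq.
  - move=> k kB; apply/mapP; exists [ffun j => SeqSub (csP k j kB)]; first by rewrite mem_enum.
    by apply/ffunP => j; rewrite !ffunE.
rewrite big_map big_enum /=.
have -> : \sum_f \prod_j g (h f j) = \prod_(j < n) \sum_(z : seq_sub cs) g (val z).
  rewrite bigA_distr_bigA; apply: eq_bigr => f _; apply: eq_bigr => j _; by rewrite ffunE.
rewrite prodr_const card_ord; apply: lerXn2r; rewrite ?nnegrE ?sumr_ge0 //.
  by have := hg [::] isT; rewrite big_nil.
have := hg cs (undup_uniq _); congr (_ <= _).
have e : perm_eq cs [seq val z | z <- enum {: seq_sub cs}].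
  apply: uniq_perm; [exact: undup_uniq|by rewrite map_inj_uniq ?enum_uniq //; exact: val_inj|].
  move=> z; apply/idP/mapP => [zc|[y _ ->]]; last exact: valP.
  by exists (SeqSub zc); rewrite ?mem_enum.
by rewrite (perm_big _ e) big_map big_enum.
Qed.

Lemma enorm_ge0 (xi : 'rV[R]_n) : 0 <= enorm xi. Proof. exact: sqrtr_ge0. Qed.

Lemma enorm1_gt0 (xi : 'rV[R]_n) : 0 < 1 + enorm xi.
Proof. by have := enorm_ge0 xi; lra. Qed.

Lemma enorm_vecZ (k : Zn n) j : `|k j|%:~R <= enorm (@vecZ R n k).
Proof.
rewrite -[leLHS]ger0_norm ?ler0z // -sqrtr_sqr /enorm; apply: ler_wsqrtr.
rewrite (bigD1 j) //= mxE -rmorphXn /= -[X in X <= _]addr0; apply: lerD.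
  by rewrite -[leRHS]rmorphXn /= ler_int real_normK ?num_real.
by apply: sumr_ge0 => i _; exact: sqr_ge0.
Qed.

(** The power is split into n equal factors of exponent - s / n, each bounded by keeping one
    coordinate of k; the resulting sums over the integers converge since s / n > 1. *)
Lemma lattice_sum (s : R) : (0 < n)%N -> n%:R < s -> exists M, forall B : {fset Zn n},
  \sum_(k <- B) (1 + enorm (@vecZ R n k)) `^ (- s) <= M.
Proof.
move=> n0 ns; have n0' : 0 < n%:R :> R by rewrite ltr0n.
have p1 : 1 < s / n%:R by rewrite ltr_pdivlMr // mul1r.
have [M hM] := int_powR_sum p1; exists (M ^+ n) => B.
apply: le_trans (lattice_prod_sum (fun z => powR_ge0 (1 + `|z|%:~R) (- (s / n%:R))) hM B).
apply: ler_sum => k _; have e0 := enorm1_gt0 (@vecZ R n k).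
have -> : (1 + enorm (@vecZ R n k)) `^ (- s) = \prod_(j < n) (1 + enorm (@vecZ R n k)) `^ (- (s / n%:R)).
  rewrite prodr_const card_ord -powR_mulrn ?powR_ge0 // -powRrM; congr (_ `^ _).
  by rewrite mulNr divfK // gt_eqF.
apply: ler_prod => j _; rewrite powR_ge0 /=.
have a0 : 0 < 1 + `|k j|%:~R :> R by rewrite ltr_pwDl // ler0z.
rewrite !powRN lef_pV2 ?posrE ?powR_gt0 //.
apply: ge0_ler_powR; rewrite ?nnegrE; [lra|exact: ltW|exact: ltW|].
by rewrite lerD2l enorm_vecZ.
Qed.

End lattice_sums.

(** * Pseudodifferential operators *)

Section pseudodifferential.
Context {R : realType} (n : nat) (theta : 'M[R]_n).
Hypothesis htheta : (theta^T = - theta)%R.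
Hypothesis n_gt0 : (0 < n)%N.
Local Notation H := (@L2_Tn R n).
Variables (V : hspace R) (J : @L2_Tn R n -> V).
Hypothesis MJ : presents J.
Local Notation L := (@lift_op R H V J).
Local Notation Om := (@Om R n V J).
Local Notation N := (algN (Ucomm theta J)).
Local Notation W := (@WU R n theta V J).
Local Notation H2 := (L2_theta theta).
Local Notation J2 := (@J2 R n theta V J).
Local Notation M2 := (J2_presents htheta MJ).
Local Notation e k := (W k Om).

Let Cb := @Ucomm_bop R n theta V J.
Let ow := oW theta MJ.

Lemma bop_eq_onb (A B : V -> V) : bop A -> bop B -> (forall k : Zn n, A (e k) = B (e k)) -> A = B.
Proof.
move=> bA bB h; apply/funext => u.
apply: (@vsums_unique _ _ _ (fun k : Zn n => ip u (e k) *: A (e k))).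
  have := vsums_bop bA (parseval u ow); congr vsums; apply/funext => k /=.
  by rewrite (islinZ (bop_lin bA)).
have := vsums_bop bB (parseval u ow); congr vsums; apply/funext => k /=.
by rewrite (islinZ (bop_lin bB)) h.
Qed.

Lemma coef_eq (u v : V) : (forall k : Zn n, ip u (e k) = ip v (e k)) -> u = v.
Proof.
move=> h; apply/eqP; rewrite -subr_eq0; apply/eqP; apply: ow.2 => k.
by rewrite ipBl h subrr.
Qed.

Section symbol_operator.
Variables (P : Zn n -> V -> V) (a : Zn n -> R) (M : R).
Hypotheses (PN : forall k, N (P k)) (a0 : forall k, 0 <= a k)
  (Pa : forall k, obound (P k) (a k)) (M0 : 0 <= M)
  (aM : forall B : {fset Zn n}, \sum_(k <- B) a k ^+ 2 <= M ^+ 2).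

Let G (u : V) (k : Zn n) (x : V) := ip u (e k) *: P k (W k x).

Lemma PW_N k : N (P k \o W k).
Proof. by apply: algN_comp => //; exact: (W_N theta MJ k). Qed.

Lemma PW_bound k : obound (P k \o W k) (a k).
Proof. by move=> x /=; rewrite -(WU_nrm theta MJ k x); exact: Pa. Qed.

Lemma G_N u k : N (G u k).
Proof. exact: (algN_Z Cb (ip u (e k)) (PW_N k)). Qed.

(** By Cauchy-Schwarz the norms |u_k| a_k have sum at most |u| M. The operator norm of the sum is
    thus controlled by the L_2-norm of [u], which need not be smooth. *)
Lemma Sop_ex u : exists S, [/\ islin S, obound S (nrm u * M) & opsums (G u) S].
Proof.
apply: (@opsums_ex _ _ _ _ (fun k => normc (ip u (e k)) * a k)).
- by move=> k; exact: bop_lin (N_bop (G_N u k)).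
- by move=> k x; rewrite nrmZ -mulrA ler_wpM2l ?normc_ge0 //; exact: PW_bound.
- by move=> k; rewrite mulr_ge0 ?normc_ge0.
- move=> B; apply: sum_cs_le => //; first exact: nrm_ge0.
  exact: bessel_ineq ow.1 _ _ (fset_uniq _).
Qed.

(* Sop u is the operator sum_k u_k rho(k) U^k of the algebra, and PV u is the
   vector P_rho u. *)
Definition Sop u : V -> V := projT1 (cid (Sop_ex u)).

Lemma SopP u : [/\ islin (Sop u), obound (Sop u) (nrm u * M) & opsums (G u) (Sop u)].
Proof. by rewrite /Sop; case: cid. Qed.

Lemma Sop_bop u : bop (Sop u).
Proof.
have [l b _] := SopP u; split=> //; exists (nrm u * M); split=> //.
by rewrite mulr_ge0 // nrm_ge0.
Qed.

Lemma Sop_N u : N (Sop u).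
Proof.
apply: (algN_norm_closed Cb); first exact: Sop_bop.
move=> d d0; have [_ _ /(_ d d0) [B hB]] := SopP u.
exists (fun x => \sum_(k <- B) G u k x); last exact: hB (fsubset_refl _).
by apply: (algN_sum Cb) => k; exact: G_N.
Qed.

Lemma Sop_uniq u S : opsums (G u) S -> S = Sop u.
Proof. by move=> hS; have [_ _ h] := SopP u; apply: opsums_unique hS h. Qed.

Lemma Sop_lin (c : R[i]) u v : Sop (c *: u + v) = fun x => c *: Sop u x + Sop v x.
Proof.
have [_ _ h1] := SopP u; have [_ _ h2] := SopP v.
apply/esym/Sop_uniq; have := opsums_lin c h1 h2; congr opsums.
apply/funext => k; apply/funext => x; rewrite /G ipDl ipZl scalerDl scalerA //.
Qed.

Lemma Sop_e k : Sop (e k) = P k \o W k.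
Proof.
apply/esym/Sop_uniq => d d0; exists [fset k]%fset => B kB x.
have kB' : k \in B by apply: (fsubsetP kB); rewrite in_fset1.
rewrite (big_fsetD1 k) //= [G _ _ _]/G ow.1 eqxx scale1r big1_fset ?addr0 ?subrr ?nrm0.
  by rewrite mulr_ge0 ?nrm_ge0 // ltW.
move=> j; rewrite in_fsetD1 => /andP[jk _] _; rewrite /G ow.1 eq_sym (negbTE jk).
by rewrite scale0r.
Qed.

Definition PV u := Sop u Om.

Lemma PV_lin : islin PV.
Proof. by move=> c u v; rewrite /PV Sop_lin. Qed.

Lemma PV_bound : obound PV M.
Proof.
move=> u; have [_ h _] := SopP u; have := h Om.
by rewrite (nrm_Om MJ) mulr1 mulrC.
Qed.

Lemma PV_bop : bop PV.
Proof. by split; [exact: PV_lin|exists M; split; [exact: M0|exact: PV_bound]]. Qed.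

Lemma PV_e k : PV (e k) = P k (e k).
Proof. by rewrite /PV Sop_e. Qed.

(** [PV u] is [Sop u Om], and right multiplication by [Sop u] is bounded in L_2. The bound involves
    [A] through its L_2-norm alone, which allows limits in L_2. *)
Lemma mul_PV_bound A u : N A -> nrm (A (PV u)) <= nrm u * M * nrm (A Om).
Proof.
move=> nA; apply: (NmulOm htheta MJ) => //; first exact: Sop_N.
  by rewrite mulr_ge0 ?nrm_ge0.
by have [] := SopP u.
Qed.

Lemma mul_PV_e A k : N A -> nrm (A (PV (e k))) <= a k * nrm (A Om).
Proof.
move=> nA; rewrite PV_e; apply: (@NmulOm _ _ _ htheta _ _ MJ A (P k \o W k)) => //.
  exact: PW_N.
exact: PW_bound.
Qed.

End symbol_operator.

Lemma delt_rapid (k : Zn n) : rapid (fun j : Zn n => (j == k)%:R : R[i]^o).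
Proof.
move=> p; exists ((1 + enorm (@vecZ R n k)) ^+ p) => j.
case: eqP => [->|_]; first by rewrite Normc.normc1 mulr1.
by rewrite Normc.normc0 mulr0 exprn_ge0 // ltW // enorm1_gt0.
Qed.

Lemma rapid_sum (u : @coefs R n) : rapid u -> exists M : R, forall B : {fset Zn n},
  \sum_(k <- B) normc (u k) <= M.
Proof.
move=> /(_ n.+1) [c hc].
have nlt : n%:R < n.+1%:R :> R by rewrite ltr_nat.
have [M hM] := lattice_sum n_gt0 nlt.
exists (c * M) => B.
have c0 : 0 <= c.
  by apply: le_trans (hc 0); rewrite mulr_ge0 ?normc_ge0 ?exprn_ge0 // ltW // enorm1_gt0.
apply: le_trans (ler_wpM2l c0 (hM B)); rewrite mulr_sumr; apply: ler_sum => k _.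
have p := enorm1_gt0 (@vecZ R n k).
rewrite powRN powR_mulrn ?(ltW p) // ler_pdivlMr ?exprn_gt0 // mulrC; exact: hc.
Qed.

Lemma seriesP (u : @coefs R n) : rapid u -> C_Tn theta (Defs.series theta u) /\
  opsums (fun k x => u k *: W k x) (L (Defs.series theta u)).
Proof.
move=> /rapid_sum [M hM].
have [|k x||S [lS bS hS]] := @opsums_ex R V (Zn n) (fun k x => u k *: W k x) (fun k => normc (u k)) M _ _ _ hM.
- by move=> k; exact: bop_lin (bopZ (u k) (N_bop (W_N theta MJ k))).
- by rewrite nrmZ (WU_nrm theta MJ).
- by move=> k; exact: normc_ge0.
have M0 : 0 <= M by have := hM fset0; rewrite big_seq_fset0.
have bopS : bop S by split=> //; exists M.
have E k : L (u k *: U_mono theta k) = fun x => u k *: W k x := (vNZ MJ (u k) (monoP theta MJ k)).2.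
have cF k : C_Tn theta (u k *: U_mono theta k : H -> H).
  have [[_ _ hl _ _] _] := C_cstar theta MJ.
  have := hl (u k) _ _ (C_mono htheta n_gt0 MJ k) (C_0 htheta n_gt0 MJ).
  by rewrite addr0.
have hS' : opsums (fun k => L (u k *: U_mono theta k)) S.
  by have := hS; congr opsums; apply/funext => k; rewrite E.
have [c e] := op_sum_C htheta n_gt0 MJ cF bopS hS'.
by split=> //; rewrite /Defs.series e.
Qed.

Lemma series_coef (u : @coefs R n) k : rapid u -> ip (L (Defs.series theta u) Om) (e k) = u k.
Proof.
move=> /seriesP [_ h]; have h' := opsums_vsums Om h.
exact: (@ip_vsums_ons _ _ _ _ ow.1 (fun k => u k : R[i]) _ k h').
Qed.

Lemma delta0 (u : @coefs R n) : delta [ffun=> 0%N] u = u.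
Proof. by apply/funext => k; rewrite /delta big1 ?mul1r // => j _; rewrite ffunE expr0. Qed.

Section symbols.
Variables (m : R) (rho : 'rV[R]_n -> @coefs R n).
Hypothesis hrho : symbol theta (- m) rho.

Lemma symbol_bound : (forall k, C_Tn theta (rho_at theta rho k)) /\
  exists c : R, 0 <= c /\ forall k, obound (L (rho_at theta rho k)) (c * (1 + enorm (@vecZ R n k)) `^ (- m)).
Proof.
have [D [D0 rD _ _ bD]] := hrho.
have Cr k : C_Tn theta (rho_at theta rho k).
  by have [] := @seriesP (rho (vecZ k)); rewrite -?D0.
split=> //; have [c hc] := bD [ffun=> 0%N] [ffun=> 0%N].
have E xi : ((c * (1 + enorm xi) `^ (- m - (mlen ([ffun=> 0%N] : multi n))%:R)) = c * (1 + enorm xi) `^ (- m)).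
  by rewrite /mlen big1 ?subr0 // => j _; rewrite ffunE.
have p (k : Zn n) : 0 < (1 + enorm (@vecZ R n k)) `^ (- m) by rewrite powR_gt0 // enorm1_gt0.
have h k : (norm_op (rho_at theta rho k) <= (c * (1 + enorm (@vecZ R n k)) `^ (- m))%:E)%E.
  by have := hc (vecZ k); rewrite E /seminorm delta0 D0.
exists c; split.
  have := le_trans (opnorm_ge0 MJ _) (h 0); rewrite lee_fin pmulr_lge0 //.
by move=> k; apply: (opnorm_obound MJ) (h k); case: (C_vNalg MJ (Cr k)).
Qed.

Let Pk k := L (rho_at theta rho k).
Lemma rho_N k : N (Pk k).
Proof. by case: (C_vNalg MJ (symbol_bound.1 k)). Qed.

Variables (a : Zn n -> R) (M : R).
Hypotheses (a0 : forall k, 0 <= a k)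
  (Pa : forall k, obound (Pk k) (a k)) (M0 : 0 <= M)
  (aM : forall B : {fset Zn n}, \sum_(k <- B) a k ^+ 2 <= M ^+ 2).

Local Notation S := (Sop rho_N a0 Pa M0 aM).
Local Notation PVr := (PV rho_N a0 Pa M0 aM).

Lemma wsum_C (c : Zn n -> R[i]) u : (forall k, c k = ip u (e k)) ->
  C_Tn theta (op_sum (fun k => c k *: (rho_at theta rho k \o U_mono theta k))) /\
  L (op_sum (fun k => c k *: (rho_at theta rho k \o U_mono theta k))) = S u.
Proof.
move=> hc; have [[_ _ hl hcm _] _] := C_cstar theta MJ.
have cm k : C_Tn theta (rho_at theta rho k \o U_mono theta k).
  by apply: hcm; [exact: symbol_bound.1|exact: (C_mono htheta n_gt0 MJ k)].
have cF k : C_Tn theta (c k *: (rho_at theta rho k \o U_mono theta k) : H -> H).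
  by have := hl (c k) _ _ (cm k) (C_0 htheta n_gt0 MJ); rewrite addr0.
apply: (op_sum_C htheta n_gt0 MJ cF); first exact: Sop_bop.
have [_ _ h] := SopP rho_N a0 Pa M0 aM u; have := h; congr opsums.
apply/funext => k; have mk := C_vNalg MJ (cm k).
rewrite (vNZ MJ (c k) mk).2 hc; apply/funext => x.
by rewrite (compP MJ (C_vNalg MJ (symbol_bound.1 k)) (monoP theta MJ k)).2.
Qed.

Lemma Psdo_cinfP (u : @coefs R n) : rapid u ->
  C_Tn theta (Psdo_cinf theta rho u) /\ L (Psdo_cinf theta rho u) = S (L (Defs.series theta u) Om).
Proof. by move=> hu; apply: wsum_C => k; rewrite series_coef. Qed.

(** [PV] agrees with [Psdo_cinf] on rapidly decaying series, which gives existence. These series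
    include the U^k, so bounded extensions agree on a basis. *)
Lemma PsdoP : @bounded_op R H2 (Psdo theta rho) /\ @lift_op R H2 V J2 (Psdo theta rho) = PVr.
Proof.
have heqE P u : @bounded_op R H2 P -> rapid u ->
    @heq R H2 (P (in_Lp (Defs.series theta u))) (in_Lp (Psdo_cinf theta rho u)) <->
    @lift_op R H2 V J2 P (L (Defs.series theta u) Om) = PVr (L (Defs.series theta u) Om).
  move=> bP ru; have [c1 _] := seriesP ru; have [c2 e2] := Psdo_cinfP ru.
  have [d1 j1] := in_LpP MJ (C_vNalg MJ c1); have [d2 j2] := in_LpP MJ (C_vNalg MJ c2).
  have [d3 j3] := (lift_bop M2 bP).2 _ d1.
  have E1 := etrans j3 (congr1 (@lift_op R H2 V J2 P) j1).
  have E2 := etrans j2 (congr1 (fun A => A Om) e2).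
  split=> h; first exact: etrans (esym E1) (etrans (proj1 (pres_heq M2 d3 d2) h) E2).
  by apply: (proj2 (pres_heq M2 d3 d2)); exact: etrans E1 (etrans h (esym E2)).
have bPV := PV_bop rho_N a0 Pa M0 aM.
have ex : exists P, [set P | @bounded_op R H2 P /\ forall u, rapid u ->
      @heq R H2 (P (in_Lp (Defs.series theta u))) (in_Lp (Psdo_cinf theta rho u))] P.
  have [bD eD] := dropP M2 bPV; exists (drop J2 PVr); split=> // u ru.
  by apply/heqE => //; rewrite eD.
have [bP hP] := xgetPex 0 ex; split=> //.
apply: bop_eq_onb => //; first exact: lift_isbop M2 _ bP.
move=> k; have rk := delt_rapid k.
have <- : L (Defs.series theta (fun j : Zn n => (j == k)%:R : R[i]^o)) Om = e k.
  by apply: coef_eq => j; rewrite series_coef // ow.1 eq_sym.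
by apply/heqE => //; exact: hP.
Qed.

(** The sum S_u lies in the C^*-algebra and represents P_rho u. Any other choice takes the same
    value at [Om], hence equals S_u because [Om] is separating. *)
Lemma Psdo_CP (u : H2) : hdom u ->
  C_Tn theta (Psdo_C theta rho u) /\ L (Psdo_C theta rho u) = S (J2 u).
Proof.
move=> du; have [bP eP] := PsdoP.
have [dP jP] := (lift_bop M2 bP).2 _ du.
have heqE b : C_Tn theta b -> @heq R H2 (in_Lp b) (Psdo theta rho u) <-> L b Om = S (J2 u) Om.
  move=> /(C_vNalg MJ) cb; have [d j] := in_LpP MJ cb.
  have hq := pres_heq M2 d dP; rewrite j jP eP in hq; exact: hq.
have [c1 e1] := wsum_C (fun k => erefl (ip (J2 u) (e k))).
have ex : exists b, [set b | C_Tn theta b /\ @heq R H2 (in_Lp b) (Psdo theta rho u)] b.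
  by exists (op_sum (fun k => ip (J2 u) (e k) *: (rho_at theta rho k \o U_mono theta k))); split=> //; apply/heqE => //; rewrite e1.
have [cb hb] := xgetPex 0 ex; split=> //.
apply: (Ninj htheta MJ); [by case: (C_vNalg MJ cb)|exact: Sop_N|].
by apply/(heqE _ cb).
Qed.

End symbols.

End pseudodifferential.

(** * Trace formulas *)

Section trace_formulas.
Context {R : realType} (n : nat) (theta : 'M[R]_n).
Hypothesis htheta : (theta^T = - theta)%R.
Hypothesis n_gt0 : (0 < n)%N.
Local Notation H := (@L2_Tn R n).
Variables (V : hspace R) (J : @L2_Tn R n -> V).
Hypothesis MJ : presents J.
Local Notation L := (@lift_op R H V J).
Local Notation Om := (@Om R n V J).
Local Notation N := (algN (Ucomm theta J)).
Local Notation W := (@WU R n theta V J).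
Local Notation H2 := (L2_theta theta).
Local Notation J2 := (@J2 R n theta V J).
Local Notation M2 := (J2_presents htheta MJ).
Local Notation e k := (W k Om).

Lemma eventually_bounded (a : nat -> R) c M : (forall i, 0 <= a i) ->
  (forall i, (M <= i)%N -> a i <= c) -> exists K, 0 <= K /\ forall i, a i <= K.
Proof.
move=> a0 hc; exists (\sum_(0 <= i < M) a i + `|c|); split.
  by rewrite addr_ge0 // sumr_ge0.
move=> i; have [Mi|iM] := leqP M i.
  apply: le_trans (hc i Mi) _; rewrite -[leLHS]add0r lerD ?sumr_ge0 //; exact: ler_norm.
rewrite -[leLHS]addr0 lerD // big_mkord (bigD1 (Ordinal iM)) //= lerDl sumr_ge0 //.
Qed.

Lemma nrm_le_form (w : V) (c : R) : 0 <= c -> (forall v, normc (ip w v) <= c * nrm v) -> nrm w <= c.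
Proof.
move=> c0 h; have := h w; rewrite ipuu normc_rc ger0_norm ?sqr_ge0 // expr2 => h2.
have [w0|w0] := ltP 0 (nrm w); first by rewrite -(ler_pM2r w0).
by apply: le_trans w0 c0.
Qed.

Lemma symbol_weights (m : R) (rho : 'rV[R]_n -> @coefs R n) : n%:R / 2 < m -> symbol theta (- m) rho ->
  exists (a : Zn n -> R) (M : R), [/\ forall k, 0 <= a k, forall k, obound (L (rho_at theta rho k)) (a k),
    0 <= M, forall B : {fset Zn n}, \sum_(k <- B) a k ^+ 2 <= M ^+ 2
    & n%:R < m -> exists M', forall B : {fset Zn n}, \sum_(k <- B) a k <= M'].
Proof.
move=> nm hrho; have [_ [c [c0 hc]]] := symbol_bound htheta n_gt0 MJ hrho.
have n2 : n%:R < 2 * m by lra.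
have [M1 hM1] := lattice_sum n_gt0 n2.
(* The squares are summable because 2 m > n; [M1] bounds the sums of (1 + |k|)^(-2 m), and its
   absolute value secures the sign under the root. *)
exists (fun k => c * (1 + enorm (@vecZ R n k)) `^ (- m)), (c * Num.sqrt `|M1|).
split=> //.
- by move=> k; rewrite mulr_ge0 ?powR_ge0.
- by rewrite mulr_ge0 ?sqrtr_ge0.
- move=> B; rewrite exprMn sqr_sqrtr //; under eq_bigr do rewrite exprMn.
  rewrite -mulr_sumr ler_wpM2l ?sqr_ge0 //; apply: le_trans (ler_norm _).
  apply: le_trans (hM1 B); apply: ler_sum => k _.
  by rewrite -powR_mulrn ?powR_ge0 // -powRrM (_ : - m * 2%:R = - (2 * m)) //; ring.
- move=> nm'; have [M' hM'] := lattice_sum n_gt0 nm'; exists (c * M') => B.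
  by rewrite -mulr_sumr ler_wpM2l.
Qed.

Theorem trace_lambda_Psdo (m : R) (rho : 'rV[R]_n -> coefs n) (x : nat -> oper n) :
  n%:R < m -> symbol theta (- m) rho -> Lp theta 2 x ->
  trace_class (lambda_Psdo theta x rho) /\
  sums_to cabs (fun k : Zn n => tau1 (fun i => x i \o rho_at theta rho k))
    (trace (lambda_Psdo theta x rho)).
Proof.
move=> nm hrho hx.
have nm2 : n%:R / 2 < m by have := ler0n R n; lra.
have [a [M [a0 Pa M0 aM /(_ nm) [M' hM']]]] := symbol_weights nm2 hrho.
have [mx cx] := proj1 (Lp2P theta MJ x) hx.
have [K [K0 hK]] : exists K, 0 <= K /\ forall i, nrm (L (x i) Om) <= K.
  have [l hl] := vcauchyP cx; have [M1 hM1] := hl 1 ltr01.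
  apply: (@eventually_bounded _ (nrm l + 1) M1) => [i|i Mi]; first exact: nrm_ge0.
  by apply: le_trans (nrm_leD _ l) _; rewrite lerD2l ltW // hM1.
pose rN := rho_N htheta n_gt0 MJ hrho.
pose S := Sop MJ rN a0 Pa M0 aM; pose P := PV MJ rN a0 Pa M0 aM.
have bP : bop P by exact: PV_bop.
have xN i : N (L (x i)) := (mx i).2.
(* |x_i S_u Om| <= |S_u| |x_i Om| turns the Cauchy property in L_2 into pointwise convergence of the
   operators, with the uniform bound [M * K]. *)
have [||u|T [lT bT hT]] := @op_lim _ _ (fun i => L (x i) \o P) (M * K).
- by move=> i; apply: islin_comp; [exact: bop_lin (N_bop (xN i))|exact: bop_lin].
- move=> i u /=; have h1 := mul_PV_bound htheta MJ rN a0 Pa M0 aM u (xN i); apply: le_trans h1 _.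
  by rewrite mulrC mulrA [_ * M]mulrC -!mulrA ler_wpM2l // ler_wpM2r ?nrm_ge0 // hK.
- move=> d d0; have p : 0 < nrm u * M + 1 by rewrite ltr_pwDr // mulr_ge0 ?nrm_ge0.
  have [M1 hM1] := cx (d / (nrm u * M + 1)) (divr_gt0 d0 p); exists M1 => i j Mi Mj /=.
  have [mb eb] := vNalgB MJ (mx i) (mx j).
  have := mul_PV_bound htheta MJ rN a0 Pa M0 aM u mb.2; rewrite eb => h; apply: le_lt_trans h _.
  have := hM1 i j Mi Mj; rewrite ltr_pdivlMr // => h2; apply: le_lt_trans h2.
  by rewrite mulrC ler_wpM2l ?nrm_ge0 // lerDl.
have bopT : bop T by split=> //; exists (M * K); split=> //; exact: mulr_ge0.
have [bL eL] : @bounded_op R H2 (lambda_Psdo theta x rho) /\ @lift_op R H2 V J2 (lambda_Psdo theta x rho) = T.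
  apply: (lift_eq M2 bopT) => u du.
  have [cb eb] := Psdo_CP htheta n_gt0 MJ hrho a0 Pa M0 aM du.
  have mb := C_vNalg MJ cb.
  have h : vconv (fun i => L (lambda_Psdo theta x rho u i) Om) (T (J2 u)).
    have := hT (J2 u); congr vconv; apply/funext => i.
    by rewrite /lambda_Psdo (compP MJ (mx i) mb).2 eb.
  split; last exact: J2P.
  apply/(Lp2P theta MJ); split; last exact: vconv_cauchy h.
  by move=> i; exact: (compP MJ (mx i) mb).1.
have oe := e2_onb theta MJ.
have tr_T : trace_approx (J2 \o @e2 R n theta) (@lift_op R H2 V J2 (lambda_Psdo theta x rho)).
  (* |T e_k| is at most [a k * K], and these bounds are summable because m > n. *)
  rewrite eL; apply: (@trace_approx_summable _ _ _ _ oe _ (M' * K)) => // B.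
  apply: (@le_trans _ _ (\sum_(k <- B) a k * K)); last by rewrite -mulr_suml ler_wpM2r.
  apply: ler_sum => k _; apply: vconv_le (hT _) _ => i /=; rewrite (e2P theta MJ k).2.
  apply: le_trans (mul_PV_e htheta MJ rN a0 Pa M0 aM k (xN i)) _.
  by rewrite ler_wpM2l.
have [h1 h2] := presents_trace M2 bL (fun k => (e2P theta MJ k).1) oe tr_T.
suff E : (fun k : Zn n => @hip R H2 (lambda_Psdo theta x rho (e2 theta k)) (e2 theta k)) =
    (fun k : Zn n => tau1 (fun i => x i \o rho_at theta rho k)).
  by split; [exact: h1|rewrite -E; exact: h2].
apply/funext => k; apply: (congr1 (@climn R)); apply/funext => i.
have [cb eb] := Psdo_CP htheta n_gt0 MJ hrho a0 Pa M0 aM (e2P theta MJ k).1.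
have mb := C_vNalg MJ cb; have mr := C_vNalg MJ ((symbol_bound htheta n_gt0 MJ hrho).1 k).
have [mxb exb] := compP MJ (mx i) mb; have [ms es] := starP MJ (monoP theta MJ k).
have [mc ec] := compP MJ mxb ms; have [mxr exr] := compP MJ (mx i) mr.
rewrite /lambda_Psdo /in_Lp (tauE MJ mc.1) (tauE MJ mxr.1) ec exb es exr eb (e2P theta MJ k).2 Sop_e.
by rewrite /tr /= -/(W k) (WU_adjK theta MJ).
Qed.

Theorem trace_sandwich (m : R) (rho sigma : 'rV[R]_n -> coefs n) (x : nat -> oper n) :
  n%:R / 2 < m -> symbol theta (- m) rho -> symbol theta (- m) sigma -> Lp theta 1 x ->
  trace_class (sandwich theta sigma x rho) /\
  sums_to cabs
    (fun k : Zn n => tau1 (fun i => x i \o (rho_at theta rho k \o star (rho_at theta sigma k))))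
    (trace (sandwich theta sigma x rho)).
Proof.
move=> nm hrho hsig hx.
have [a [M [a0 Pa M0 aM _]]] := symbol_weights nm hrho.
have [b [M' [b0 Pb M'0 bM _]]] := symbol_weights nm hsig.
have [mx cx] := Lp1P htheta MJ hx.
have xN i : N (L (x i)) := (mx i).2.
have [K [K0 hK]] : exists K, 0 <= K /\ forall i, norm1 Om (L (x i)) <= K.
  have [M1 hM1] := cx 1 ltr01.
  apply: (@eventually_bounded _ (4 * (norm1 Om (L (x M1)) + 1)) M1) => [i|i Mi].
    exact: (Nnorm1_ge0 htheta MJ (xN i)).
  apply: le_trans (Nnorm1_quasi htheta MJ (xN M1) (xN i)) _.
  by rewrite ler_wpM2l // lerD2l ltW // hM1.
pose rN := rho_N htheta n_gt0 MJ hrho; pose sN := rho_N htheta n_gt0 MJ hsig.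
pose S := Sop MJ rN a0 Pa M0 aM; pose P := PV MJ rN a0 Pa M0 aM.
pose S' := Sop MJ sN b0 Pb M'0 bM; pose Q := PV MJ sN b0 Pb M'0 bM.
have bP : bop P by exact: PV_bop.
have bQ : bop Q by exact: PV_bop.
have bQa := adjV_bop bQ.
have SN u : N (S u) by exact: Sop_N.
have S'N u : N (S' u) by exact: Sop_N.
have Pb_u : obound P M by exact: PV_bound.
have Qb_u : obound Q M' by exact: PV_bound.
(* 2 is the constant of [Ntr_bound]; [M] and [M'] bound the norms of S_u and S'_v for unit
   vectors. *)
pose kap := 2 * (M * M').
have kap0 : 0 <= kap by rewrite !mulr_ge0.
have form_bound B u v : N B -> normc (ip (B (P u)) (Q v)) <= kap * norm1 Om B * nrm u * nrm v.
  move=> nB; rewrite -[ip _ _]/(ip ((B \o S u) Om) (S' v Om)).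
  rewrite -(tr_star htheta MJ (algN_comp nB (SN u)) (S'N v)).
  have [_ h1 _] := SopP MJ rN a0 Pa M0 aM u; have [_ h2 _] := SopP MJ sN b0 Pb M'0 bM v.
  have c1 : 0 <= nrm u * M by rewrite mulr_ge0 ?nrm_ge0.
  have c2 : 0 <= nrm v * M' by rewrite mulr_ge0 ?nrm_ge0.
  have h3 := obound_comp c1 h1 (obound_adj c2 (N_bop (S'N v)) h2).
  have h := Ntr_bound htheta MJ nB (algN_comp (SN u) (N_adj MJ (S'N v))) (mulr_ge0 c1 c2) h3.
  apply: le_trans h _; rewrite le_eqVlt; apply/orP; left; apply/eqP; rewrite /kap; ring.
have op_bound B u : N B -> nrm (adjV Q (B (P u))) <= kap * norm1 Om B * nrm u.
  move=> nB; have n0 := Nnorm1_ge0 htheta MJ nB.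
  apply: nrm_le_form => [|v]; first by rewrite !mulr_ge0 ?nrm_ge0.
  by rewrite ip_adjl //; exact: form_bound.
pose A i := adjV Q \o (L (x i) \o P).
have lA i : islin (A i).
  apply: islin_comp; first exact: bop_lin.
  by apply: islin_comp; [exact: bop_lin (N_bop (xN i))|exact: bop_lin].
have AB i j u : nrm (A i u - A j u) <= kap * norm1 Om (fun w => L (x i) w - L (x j) w) * nrm u.
  have [mb eb] := vNalgB MJ (mx i) (mx j); have := op_bound _ u mb.2.
  by rewrite eb (islinB (bop_lin bQa)).
have kap1 : 0 < kap + 1 by rewrite ltr_wpDl.
have [//||u|T [lT bT hT]] := @op_lim _ _ A (kap * K).
- move=> i u; apply: le_trans (op_bound _ u (xN i)) _.
  by rewrite ler_wpM2r ?nrm_ge0 // ler_wpM2l.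
- move=> d d0; have p : 0 < kap * nrm u + 1 by rewrite ltr_pwDr // mulr_ge0 ?nrm_ge0.
  have [M1 hM1] := cx (d / (kap * nrm u + 1)) (divr_gt0 d0 p); exists M1 => i j Mi Mj.
  apply: le_lt_trans (AB i j u) _.
  have := hM1 i j Mi Mj; rewrite ltr_pdivlMr // => h2; apply: le_lt_trans h2.
  have [mb eb] := vNalgB MJ (mx i) (mx j); have := Nnorm1_ge0 htheta MJ mb.2; rewrite eb => n0.
  by rewrite mulrAC mulrC ler_wpM2l // lerDl.
have bopT : bop T by split=> //; exists (kap * K); split=> //; exact: mulr_ge0.
(* The approximants in fact converge in operator norm, because [AB] bounds their differences
   uniformly on the unit ball. *)
have AT d : 0 < d -> exists i, forall u, nrm (T u - A i u) <= d * nrm u.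
  move=> d0; have [M1 hM1] := cx (d / (kap + 1)) (divr_gt0 d0 kap1); exists M1 => u.
  apply/ler_addgt0Pr => t t0; have [M3 hM3] := hT u t t0.
  pose j := maxn M1 M3; have h1 := hM3 j (leq_maxr _ _).
  have h2 : nrm (A j u - A M1 u) <= d * nrm u.
    apply: le_trans (AB j M1 u) _; rewrite ler_wpM2r ?nrm_ge0 //.
    have := hM1 j M1 (leq_maxl _ _) (leqnn _); rewrite ltr_pdivlMr // => h3; apply: le_trans (ltW h3).
    have [mb eb] := vNalgB MJ (mx j) (mx M1); have := Nnorm1_ge0 htheta MJ mb.2; rewrite eb => n0.
    by rewrite mulrC ler_wpM2l // lerDl.
  have := nrm_dist (T u) (A j u) (A M1 u); rewrite nrmBC in h1.
  by move=> h4; rewrite [leRHS]addrC; apply: le_trans h4 (lerD (ltW h1) h2).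
have formE (u v : H2) : hdom u -> hdom v ->
    tau1 (fun i => star (Psdo_C theta sigma v) \o (x i \o Psdo_C theta rho u)) = ip (T (J2 u)) (J2 v).
  move=> du dv; apply: climn_cconv.
  have [cu eu] := Psdo_CP htheta n_gt0 MJ hrho a0 Pa M0 aM du; have mu := C_vNalg MJ cu.
  have [cv ev] := Psdo_CP htheta n_gt0 MJ hsig b0 Pb M'0 bM dv; have mv := C_vNalg MJ cv.
  have := cconv_ip (hT (J2 u)) (vconv_cst (J2 v)); congr cconv; apply/funext => i.
  have [ms es] := starP MJ mv; have [m1 e1] := compP MJ (mx i) mu; have [m2 e2] := compP MJ ms m1.
  have E : L (star (Psdo_C theta sigma v) \o (x i \o Psdo_C theta rho u)) =
      adjV (S' (J2 v)) \o (L (x i) \o S (J2 u)).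
    exact: etrans e2 (congr2 (fun f g => f \o g) (etrans es (congr1 adjV ev))
      (etrans e1 (congr1 (fun f => L (x i) \o f) eu))).
  apply: etrans (esym (etrans (tauE MJ m2.1) (congr1 (tr Om) E))).
  exact: etrans (ip_adjl _ _ bQ) (esym (ip_adjl _ _ (N_bop (S'N (J2 v))))).
have [bL eL hL] : [/\ @bounded_op R H2 (sandwich theta sigma x rho),
    @lift_op R H2 V J2 (sandwich theta sigma x rho) = T &
    forall u v : H2, hdom u -> hdom v -> hip (sandwich theta sigma x rho u) v =
      tau1 (fun i => star (Psdo_C theta sigma v) \o (x i \o Psdo_C theta rho u))].
  have ex : exists T', [set T' | @bounded_op R H2 T' /\
    forall u v, @hdom R H2 u -> @hdom R H2 v -> hip (T' u) v =
      tau1 (fun i => star (Psdo_C theta sigma v) \o (x i \o Psdo_C theta rho u))] T'.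
    have [bD eD] := dropP M2 bopT; exists (drop J2 T); split; first exact: bD.
    move=> u v du dv; have [d1 j1] := (lift_bop M2 bD).2 _ du.
    have h := pres_ip M2 d1 dv; rewrite h; apply: etrans (esym (formE u v du dv)).
    by apply: (congr1 (fun w => ip w (J2 v))); apply: (etrans j1); rewrite eD.
  have [b1 h1] := xgetPex 0 ex; split; [exact: b1| |exact: h1].
  (* A bounded operator is determined by its sesquilinear form, so whatever operator is picked lifts
     to [T]. *)
  apply/funext => w; apply: ip_ext => z.
  have [u [du <-]] := pres_surj M2 w; have [v [dv <-]] := pres_surj M2 z.
  have [d1 j1] := (lift_bop M2 b1).2 _ du.
  apply: etrans (formE u v du dv); apply: etrans (h1 u v du dv).
  by apply: etrans (esym (pres_ip M2 d1 dv)); apply: (congr1 (fun w => ip w (J2 v))); exact: esym j1.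
have oe := e2_onb theta MJ.
have tr_T : trace_approx (J2 \o @e2 R n theta) (@lift_op R H2 V J2 (sandwich theta sigma x rho)).
  (* |z rho(k) U^k|_2^2 <= a_k^2 |z|_2^2 with |z|_2^2 <= K gives the first weights; |y|_2^2 <= 4 K
     and the sum of the b_k^2, at most M'^2, give the constant [2 * Num.sqrt K * M']. *)
  rewrite eL; apply: (@trace_approx_hs _ _ _ _ oe _ (fun k => a k ^+ 2 * K) (2 * Num.sqrt K * M') (M ^+ 2 * K)) => //.
  - by move=> k; rewrite mulr_ge0 ?sqr_ge0.
  - by rewrite !mulr_ge0 ?sqrtr_ge0.
  - by move=> B; rewrite -mulr_suml ler_wpM2r.
  (* Half of the error goes to replacing [x] by [x i], and half to the factorization of [x i], whose
     error is amplified by at most M M' through [P] and [Q]. *)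
  move=> d d0; have [i hi] := AT _ (half_gt0 d0).
  have p : 0 < M * M' + 1 by rewrite ltr_wpDl // mulr_ge0.
  have [y [z [yN zN hyz hz hy]]] := Nfactorization htheta MJ (xN i) (divr_gt0 (half_gt0 d0) p).
  exists (z \o P), (y \o Q); split.
  - exact: bop_comp (N_bop zN) bP.
  - exact: bop_comp (N_bop yN) bQ.
  - move=> u v.
    have -> : ip (T u) v = ip (T u - A i u) v + ip (L (x i) (P u)) (Q v).
      by rewrite ipBl /A /= (ip_adjl _ _ bQ) subrK.
    apply: le_trans (le_normcD _ _) _.
    have h1 := le_trans (cauchy_schwarz (T u - A i u) v) (ler_wpM2r (nrm_ge0 v) (hi u)).
    have h2 := hyz (P u) (Q v).
    have h3 : d / 2 / (M * M' + 1) * nrm (P u) * nrm (Q v) <= d / 2 * nrm u * nrm v.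
      have h4 := ler_pM (nrm_ge0 _) (nrm_ge0 _) (Pb_u u) (Qb_u v).
      have q0 : 0 <= d / 2 / (M * M' + 1) by rewrite !divr_ge0 // ltW.
      rewrite -mulrA; apply: le_trans (ler_wpM2l q0 h4) _.
      have -> : d / 2 / (M * M' + 1) * (M * nrm u * (M' * nrm v)) =
        (d / 2 * nrm u * nrm v) * ((M * M') / (M * M' + 1)) by field; rewrite gt_eqF.
      apply: ler_piMr; first by rewrite !mulr_ge0 ?nrm_ge0 ?invr_ge0 // ltW.
      by rewrite ler_pdivrMr // mul1r lerDl.
    apply: le_trans (lerD h1 (le_trans h2 (lerD (lexx _) h3))) _.
    by rewrite le_eqVlt; apply/orP; left; apply/eqP; rewrite /=; field.
  - move=> k /=; rewrite (e2P theta MJ k).2.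
    have h := mul_PV_e htheta MJ rN a0 Pa M0 aM k zN.
    have h0 : 0 <= a k * nrm (z Om) by rewrite mulr_ge0 ?nrm_ge0.
    apply: (@le_trans _ _ ((a k * nrm (z Om)) ^+ 2)); first by apply: lerXn2r; rewrite ?nnegrE ?nrm_ge0.
    by rewrite exprMn hz ler_wpM2l ?sqr_ge0.
  - move=> B; apply: (@le_trans _ _ (\sum_(k <- B) b k ^+ 2 * (4 * K))).
      apply: ler_sum => k _ /=; rewrite (e2P theta MJ k).2.
      have h := mul_PV_e htheta MJ sN b0 Pb M'0 bM k yN.
      have h0 : 0 <= b k * nrm (y Om) by rewrite mulr_ge0 ?nrm_ge0.
      apply: (@le_trans _ _ ((b k * nrm (y Om)) ^+ 2)); first by apply: lerXn2r; rewrite ?nnegrE ?nrm_ge0.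
      rewrite exprMn ler_wpM2l ?sqr_ge0 //; apply: le_trans hy _; by rewrite ler_wpM2l.
    rewrite -mulr_suml !exprMn sqr_sqrtr //.
    have -> : 2 ^+ 2 * K * M' ^+ 2 = M' ^+ 2 * (4 * K) by ring.
    by rewrite ler_wpM2r // mulr_ge0.
have [h1 h2] := presents_trace M2 bL (fun k => (e2P theta MJ k).1) oe tr_T.
suff E : (fun k : Zn n => @hip R H2 (sandwich theta sigma x rho (e2 theta k)) (e2 theta k)) =
    (fun k : Zn n => tau1 (fun i => x i \o (rho_at theta rho k \o star (rho_at theta sigma k)))).
  by split; [exact: h1|rewrite -E; exact: h2].
apply/funext => k; have [dk jk] := e2P theta MJ k.
apply: etrans (hL _ _ dk dk) _; apply: (congr1 (@climn R)); apply/funext => i.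
have [cu eu] := Psdo_CP htheta n_gt0 MJ hrho a0 Pa M0 aM dk; have mu := C_vNalg MJ cu.
have [cv ev] := Psdo_CP htheta n_gt0 MJ hsig b0 Pb M'0 bM dk; have mv := C_vNalg MJ cv.
have mr := C_vNalg MJ ((symbol_bound htheta n_gt0 MJ hrho).1 k).
have ms := C_vNalg MJ ((symbol_bound htheta n_gt0 MJ hsig).1 k).
have [m1 e1] := starP MJ mv; have [m2 e4] := compP MJ (mx i) mu; have [m3 e3] := compP MJ m1 m2.
have [m4 e5] := starP MJ ms; have [m5 e6] := compP MJ mr m4; have [m6 e7] := compP MJ (mx i) m5.
have E1 : L (star (Psdo_C theta sigma (e2 theta k)) \o (x i \o Psdo_C theta rho (e2 theta k))) =
    adjV (S' (e k)) \o (L (x i) \o S (e k)).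
  apply: etrans e3 (congr2 (fun f g => f \o g) (etrans e1 (congr1 adjV _)) (etrans e4 (congr1 (fun f => L (x i) \o f) _))).
    exact: etrans ev (congr1 S' jk).
  exact: etrans eu (congr1 S jk).
have E2 : L (x i \o (rho_at theta rho k \o star (rho_at theta sigma k))) =
    L (x i) \o (L (rho_at theta rho k) \o adjV (L (rho_at theta sigma k))).
  exact: etrans e7 (congr1 (fun f => L (x i) \o f) (etrans e6 (congr1 (fun f => L (rho_at theta rho k) \o f) e5))).
apply: etrans (etrans (tauE MJ m3.1) (congr1 (tr Om) E1)) _.
apply: etrans (esym (etrans (tauE MJ m6.1) (congr1 (tr Om) E2))).
(* Traciality moves (sigma(k) U^k)^* to the right of rho(k) U^k, where the unitary U^k cancels
   against its adjoint. *)
apply: etrans (NtrC htheta MJ (N_adj MJ (S'N (e k))) (algN_comp (xN i) (SN (e k)))) _.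
have -> : S (e k) = L (rho_at theta rho k) \o W k by exact: Sop_e.
have -> : S' (e k) = L (rho_at theta sigma k) \o W k by exact: Sop_e.
rewrite (adjV_comp (N_bop ms.2) (N_bop (W_N theta MJ k))).
congr (tr Om _); apply/funext => u /=.
by rewrite (WU_adjK theta MJ).
Qed.

End trace_formulas.

Theorem proposition4p12 (R : realType) (n : nat) (theta : 'M[R]_n)
    (hn : (2 <= n)%N) (htheta : theta^T = - theta) :
  (forall (m : R) (rho : 'rV[R]_n -> coefs n) (x : nat -> oper n),
     n%:R < m -> symbol theta (- m) rho -> Lp theta 2 x ->
     trace_class (lambda_Psdo theta x rho) /\
     sums_to cabs
       (fun k : Zn n => tau1 (fun i => x i \o rho_at theta rho k))
       (trace (lambda_Psdo theta x rho)))
  /\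
  (forall (m : R) (rho sigma : 'rV[R]_n -> coefs n) (x : nat -> oper n),
     n%:R / 2 < m -> symbol theta (- m) rho -> symbol theta (- m) sigma ->
     Lp theta 1 x ->
     trace_class (sandwich theta sigma x rho) /\
     sums_to cabs
       (fun k : Zn n =>
          tau1 (fun i => x i \o (rho_at theta rho k
                                 \o star (rho_at theta sigma k))))
       (trace (sandwich theta sigma x rho)))
  /\
  (forall (m : R) (rho : 'rV[R]_n -> coefs n) (x : nat -> oper n),
     n%:R / 2 < m -> symbol theta (- m) rho -> Lp theta 1 x ->
     trace_class (sandwich theta rho x rho) /\
     sums_to cabs
       (fun k : Zn n =>
          tau1 (fun i => x i \o (rho_at theta rho k
                                 \o star (rho_at theta rho k))))
       (trace (sandwich theta rho x rho))).
Proof.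
have n_gt0 : (0 < n)%N by exact: leq_trans hn.
have [V [J MJ]] := @torus_presentable R n.
split; last split.
- by move=> m rho x; exact: (trace_lambda_Psdo htheta n_gt0 MJ).
- by move=> m rho sigma x; exact: (trace_sandwich htheta n_gt0 MJ).
- move=> m rho x nm hrho; exact: (trace_sandwich htheta n_gt0 MJ nm hrho hrho).
Qed.
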